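(* Let $S_g$ ($g \geq 2$) be a closed orientable surface of genus $g$. Let $K$ be any real number field and let $A$ be any quaternion algebra over $K$ such that $A \otimes_K \mathbb{R} \cong M_2(\mathbb{R})$. Then there exists a hyperbolic structure on $S_g$ such that $K$ is its invariant trace field and $A$ is its invariant quaternion algebra.
   Context: A real number field is a field $K \subset \mathbb{R}$ with $[K:\mathbb{Q}]<\infty$. A hyperbolic structure on $S_g$ corresponds to a Fuchsian group $\Gamma \subset \mathrm{PSL}(2,\mathbb{R})$ with $\mathbb{H}^2/\Gamma \cong S_g$; let $\bar\Gamma \subset \mathrm{SL}(2,\mathbb{R})$ be its preimage. The invariant trace field is $\mathbb{Q}(\{\mathrm{tr}\,\gamma^2 : \gamma \in \bar\Gamma\})$, and the invariant quaternion algebra is the algebra (over the invariant trace field) generated by the squares $\gamma^2$, $\gamma\in\bar\Gamma$, i.e. the set of finite sums $\sum a_i \gamma_i^2$ with $a_i$ in the invariant trace field and $\gamma_i \in \bar\Gamma$. A quaternion algebra $\left(\frac{a,b}{K}\right)$ over $K$ ($a,b\in K^*$) is the 4-dimensional $K$-algebra with basis $1,\mathbf{i},\mathbf{j},\mathbf{k}$, $\mathbf{i}^2=a$, $\mathbf{j}^2=b$, $\mathbf{ij}=-\mathbf{ji}=\mathbf{k}$. *)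

(* Defs.v *)
From HB Require Import structures.
From mathcomp Require Import all_boot all_order all_algebra.
From mathcomp Require Import reals.
Set Implicit Arguments. Unset Strict Implicit. Unset Printing Implicit Defensive.
Import Order.TTheory GRing.Theory Num.Theory.
Local Open Scope ring_scope.

Section Defs.
Variable R : realType.

Definition is_subfield (F : R -> Prop) : Prop :=
  F 0 /\ F 1 /\
  (forall x y, F x -> F y -> F (x + y)) /\
  (forall x, F x -> F (- x)) /\
  (forall x y, F x -> F y -> F (x * y)) /\
  (forall x, F x -> x != 0 -> F x^-1).

Definition real_number_field (K : R -> Prop) : Prop :=
  is_subfield K /\
  exists (n : nat) (e : 'I_n -> R), (forall i, K (e i)) /\
    forall x, K x -> exists q : 'I_n -> rat, x = \sum_(i < n) ratr (q i) * e i.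

(* (a,b / K) ⊗_K R ≅ M_2(R): an R-algebra map (a,b/R) -> M_2(R), i.e.
   matrices I, J with I^2 = a, J^2 = b, IJ = -JI. *)
Definition quat_splits_over_R (a b : R) : Prop :=
  exists I J : 'M[R]_2, [/\ I * I = a%:M, J * J = b%:M & I * J = - (J * I)].

(* letter (i, c, e): c = false is a_i, c = true is b_i; e = true means inverse *)
Definition letter (g : nat) := ('I_g * bool * bool)%type.
Definition inv_letter g (l : letter g) : letter g := (l.1, ~~ l.2).

Definition relator (g : nat) : seq (letter g) :=
  flatten [seq [:: (i, false, false); (i, true, false);
                   (i, false, true); (i, true, true)] | i <- enum 'I_g].

(* equality in <a_1,b_1,...,a_g,b_g | prod [a_i,b_i]> *)
Inductive wequiv (g : nat) : seq (letter g) -> seq (letter g) -> Prop :=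
| we_refl w : wequiv w w
| we_sym u v : wequiv u v -> wequiv v u
| we_trans u v w : wequiv u v -> wequiv v w -> wequiv u w
| we_cancel u v x : wequiv (u ++ v) (u ++ x :: inv_letter x :: v)
| we_rel u v : wequiv (u ++ v) (u ++ relator g ++ v).

Definition word_trivial g (w : seq (letter g)) : Prop := wequiv w [::].

Definition letter_eval g (ab : 'I_g -> 'M[R]_2 * 'M[R]_2) (l : letter g)
  : 'M[R]_2 :=
  let m := if l.1.2 then (ab l.1.1).2 else (ab l.1.1).1 in
  if l.2 then invmx m else m.

Definition word_eval g (ab : 'I_g -> 'M[R]_2 * 'M[R]_2) (w : seq (letter g))
  : 'M[R]_2 := \prod_(l <- w) letter_eval ab l.

(* Gamma-bar: preimage in SL(2,R) of the image Gamma in PSL(2,R) *)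
Definition Gammabar g (ab : 'I_g -> 'M[R]_2 * 'M[R]_2) (M : 'M[R]_2) : Prop :=
  exists w, M = word_eval ab w \/ M = - word_eval ab w.

Definition pm1 (M : 'M[R]_2) : Prop := M = 1 \/ M = - 1.

(* Möbius action of a 2x2 matrix on the upper half plane, z = (x, y), y > 0 *)
Definition mobius (M : 'M[R]_2) (z : R * R) : R * R :=
  let p := M 0 0 in let q := M 0 1 in let r := M 1 0 in let s := M 1 1 in
  let x := z.1 in let y := z.2 in
  let d := (r * x + s) ^+ 2 + (r * y) ^+ 2 in
  (((p * x + q) * (r * x + s) + p * r * y ^+ 2) / d, y / d).

(* A hyperbolic structure on S_g: a faithful representation of pi_1(S_g) into
   PSL(2,R) (given by lifts in SL(2,R) of the images of the generators) whose
   image Gamma is discrete and cocompact, i.e. H^2/Gamma ≅ S_g. *)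
Definition hyperbolic_structure g (ab : 'I_g -> 'M[R]_2 * 'M[R]_2) : Prop :=
  [/\ (forall i, \det (ab i).1 = 1 /\ \det (ab i).2 = 1),
      pm1 (word_eval ab (relator g)),
      (forall w, pm1 (word_eval ab w) -> word_trivial w),
      (exists eps : R, 0 < eps /\ forall M, Gammabar ab M ->
          (forall i j, `|M i j - (1 : 'M[R]_2) i j| < eps) -> M = 1) &
      (* cocompactness: translates of a compact box cover H^2 *)
      (exists C : R, 0 < C /\ forall z : R * R, 0 < z.2 ->
          exists M, Gammabar ab M /\
            [/\ `|(mobius M z).1| <= C, C^-1 <= (mobius M z).2
              & (mobius M z).2 <= C])].

Definition inv_trace_field g (ab : 'I_g -> 'M[R]_2 * 'M[R]_2) (x : R) : Prop :=
  forall F : R -> Prop, is_subfield F ->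
    (forall M, Gammabar ab M -> F (\tr (M * M))) -> F x.

Definition inv_quat_alg g (ab : 'I_g -> 'M[R]_2 * 'M[R]_2) (X : 'M[R]_2)
  : Prop :=
  exists (n : nat) (k : 'I_n -> R) (G : 'I_n -> 'M[R]_2),
    [/\ forall i, inv_trace_field ab (k i), forall i, Gammabar ab (G i) &
        X = \sum_(i < n) k i *: (G i * G i)].

(* the invariant quaternion algebra is isomorphic, as a K-algebra, to (a,b/K):
   it has a K-basis 1, i, j, ij with i^2 = a, j^2 = b, ij = -ji. *)
Definition inv_quat_alg_iso g (ab : 'I_g -> 'M[R]_2 * 'M[R]_2)
  (K : R -> Prop) (a b : R) : Prop :=
  exists I J : 'M[R]_2,
    inv_quat_alg ab I /\ inv_quat_alg ab J /\
    I * I = a%:M /\ J * J = b%:M /\ I * J = - (J * I) /\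
        (forall X, inv_quat_alg ab X <->
           exists c0 c1 c2 c3 : R, [/\ K c0, K c1, K c2, K c3 &
             X = c0 *: 1 + c1 *: I + c2 *: J + c3 *: (I * J)]) /\
        (forall c0 c1 c2 c3 : R, K c0 -> K c1 -> K c2 -> K c3 ->
           c0 *: 1 + c1 *: I + c2 *: J + c3 *: (I * J) = 0 ->
           [/\ c0 = 0, c1 = 0, c2 = 0 & c3 = 0]).

End Defs.

(* Main.v *)
(** Let [c_0, ..., c_(2g+1)] be half-turns of the hyperbolic plane with product
    [1], and put [h_i = c_0 ... c_(2i)].  The elements
    [a_i = h_i^-1 c_(2i+1)] and [b_i = c_(2i+2) h_i] satisfy
    [[a_i, b_i] = h_i^-2 h_(i+1)^2], so their product of commutators telescopes
    to [h_0^-2 h_g^2 = 1]: the even words in the half-turns are a quotient of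
    the surface group of genus [g].

    For the half-turns about the midpoints of the sides of the regular
    [(2g+2)]-gon with angle sum [2 pi], a path in the orbit of the center that
    returns near its start can be shortened at a point farthest from the start:
    either it backtracks there, or it turns around a vertex and can be pushed to
    the other side of that vertex, where all orbit points are closer by a
    definite amount.  This proves discreteness and faithfulness, and descending
    towards the center proves cocompactness.  Only finitely many strict
    inequalities are used, so nearby half-turns with product [1] do as well.

    A half-turn is a pure quaternion of positive norm, up to scaling, and the
    relation is linear in the last free one: it has to be a commutator [[P, Y]]
    with the product [P] of its predecessors.  So such families inside the given
    algebra are dense.  In [c_1 = c_0 (1 + p)] and [c_2 = c_0 (1 + p')] one can
    moreover take [p'^2 = (w theta)^2 p^2] with [w] rational and
    [K = Q(theta^2)]; then [p^2] and [theta^2] lie in the invariant trace field,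
    and [1], [p], [p'], [p p'] span the algebra. *)

(* A half-turn taken from the algebra must be divided by the square root of its norm, so the group
   itself does not lie in the algebra; only squares of its elements do, which is why the invariant
   field and algebra are the ones that come out as K and A. The same effect dictates the generator
   of K: a rotated multiple of p inside the algebra has square v^2 p^2 with v in K, and the traces
   used see only this square. A generator can enter only squared, so K has to be Q(theta^2), not
   merely Q(theta).

   Descent cannot be asked of points near the start. It is imposed beyond a threshold lying strictly
   between the circumradius and the distance of neighbouring centers, and there all inequalities
   hold by a factor uniform in the point. Moving the half-turns changes each norm by at most a small
   multiple of itself, so one neighbourhood serves for infinitely many points.

   Signs are kept: the half-turns have product exactly 1 in SL_2, so equivalent words in the
   generators evaluate to the same matrix. Reversing a word of half-turns inverts it only up to
   sign. *)
Require Import Defs.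
From HB Require Import structures.
From mathcomp Require Import all_boot all_order all_algebra.
From mathcomp Require Import reals.
From mathcomp Require Import boolp classical_sets topology normedtype sequences realfun trigo.
From mathcomp Require Import separable ring lra zify.
From Stdlib Require Import -(notations) Setoid Morphisms.
Set Implicit Arguments. Unset Strict Implicit. Unset Printing Implicit Defensive.
Import Order.TTheory GRing.Theory Num.Theory.
Import numFieldNormedType.Exports.
Local Open Scope ring_scope.

(** * Two by two matrices *)

Section Mk2.
Variable R : comNzRingType.
Implicit Types (M N : 'M[R]_2) (a b c d : R).

Definition mk2 a b c d : 'M[R]_2 :=
  \matrix_(i, j) if i == 0 then if j == 0 then a else b
                 else if j == 0 then c else d.

Lemma mk2E00 a b c d : mk2 a b c d 0 0 = a. Proof. by rewrite mxE. Qed.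
Lemma mk2E01 a b c d : mk2 a b c d 0 1 = b. Proof. by rewrite mxE. Qed.
Lemma mk2E10 a b c d : mk2 a b c d 1 0 = c. Proof. by rewrite mxE. Qed.
Lemma mk2E11 a b c d : mk2 a b c d 1 1 = d. Proof. by rewrite mxE. Qed.
Definition mk2E := (mk2E00, mk2E01, mk2E10, mk2E11).

Lemma forall_ord2 (P : 'I_2 -> Prop) : P 0 -> P 1 -> forall i, P i.
Proof.
move=> P0 P1 [[|[|//]] lt_i]; first by rewrite (_ : Ordinal _ = 0) //; exact: val_inj.
by rewrite (_ : Ordinal _ = 1) //; exact: val_inj.
Qed.

Lemma mx2P M N : M 0 0 = N 0 0 -> M 0 1 = N 0 1 -> M 1 0 = N 1 0 ->
  M 1 1 = N 1 1 -> M = N.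
Proof. by move=> *; apply/matrixP; do 2!apply: forall_ord2. Qed.

Lemma mul2E M N i j : (M * N) i j = M i 0 * N 0 j + M i 1 * N 1 j.
Proof.
rewrite mxE !big_ord_recl big_ord0 addr0.
by congr (M i _ * N _ j + M i _ * N _ j); apply: val_inj.
Qed.

Lemma tr2E M : \tr M = M 0 0 + M 1 1.
Proof.
rewrite /mxtrace !big_ord_recl big_ord0 addr0.
by congr (M _ _ + M _ _); apply: val_inj.
Qed.

Lemma det2E M : \det M = M 0 0 * M 1 1 - M 0 1 * M 1 0.
Proof.
rewrite (expand_det_row _ 0) !big_ord_recl big_ord0 addr0 /cofactor !det_mx11.
rewrite !mxE /= expr0 mul1r expr1 mulN1r mulrN.
by congr (M _ _ * M _ _ - M _ _ * M _ _); apply: val_inj.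
Qed.

Lemma one2E : (1 : 'M[R]_2) = mk2 1 0 0 1.
Proof. by apply: mx2P; rewrite mk2E mxE. Qed.

Lemma scalar2E a : a%:M = mk2 a 0 0 a.
Proof. by apply: mx2P; rewrite mk2E mxE ?mulr1n ?mulr0n. Qed.

Lemma scale2E a M i j : (a *: M) i j = a * M i j. Proof. by rewrite mxE. Qed.
Lemma add2E M N i j : (M + N) i j = M i j + N i j. Proof. by rewrite mxE. Qed.
Lemma opp2E M i j : (- M) i j = - M i j. Proof. by rewrite mxE. Qed.
Lemma zero2E i j : (0 : 'M[R]_2) i j = 0. Proof. by rewrite mxE. Qed.

Definition mx2E := (mul2E, tr2E, det2E, one2E, scalar2E, scale2E, add2E, opp2E,
  zero2E, mk2E).

Lemma det2M M N : \det (M * N) = \det M * \det N.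
Proof. exact: det_mulmx. Qed.

Lemma tr2C M N : \tr (M * N) = \tr (N * M).
Proof. exact: mxtrace_mulC. Qed.

Lemma det2_scale a M : \det (a *: M) = a ^+ 2 * \det M.
Proof. exact: detZ. Qed.

Definition adj2 M := (\tr M)%:M - M.

Lemma adj2E M : adj2 M = mk2 (M 1 1) (- M 0 1) (- M 1 0) (M 0 0).
Proof. by apply: mx2P; rewrite /adj2 !mx2E; ring. Qed.

Lemma mul_adj2 M : M * adj2 M = (\det M)%:M.
Proof. by apply: mx2P; rewrite adj2E !mx2E; ring. Qed.

Lemma cayley2 M : M * M = \tr M *: M - (\det M)%:M.
Proof. by apply: mx2P; rewrite !mx2E; ring. Qed.

Lemma tr_opp2 M : \tr (- M) = - \tr M. Proof. exact: raddfN. Qed.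

Lemma det_opp2 M : \det (- M) = \det M.
Proof. by rewrite !mx2E; ring. Qed.

End Mk2.

Section Mk2Unit.
Variable R : comUnitRingType.
Implicit Types M N : 'M[R]_2.

Lemma inv2_det1 M : \det M = 1 -> M^-1 = adj2 M.
Proof.
move=> dM; have u : M \is a GRing.unit by rewrite unitmxE dM unitr1.
by apply: (mulrI u); rewrite divrr // mul_adj2 dM.
Qed.

Lemma inv2_pure M : \det M = 1 -> \tr M = 0 -> M^-1 = - M.
Proof. by move=> dM tM; rewrite inv2_det1 // /adj2 tM raddf0 sub0r. Qed.

Lemma unit_det1 M : \det M = 1 -> M \is a GRing.unit.
Proof. by move=> dM; rewrite unitmxE dM unitr1. Qed.

Lemma det1_inv M : \det M = 1 -> \det M^-1 = 1.
Proof. by move=> dM; rewrite inv2_det1 // adj2E -dM !mx2E; ring. Qed.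

Lemma sqr_pure M : \det M = 1 -> \tr M = 0 -> M * M = - 1.
Proof. by move=> dM tM; rewrite cayley2 tM dM scale0r sub0r. Qed.

End Mk2Unit.

(** * Peak reduction *)

Section Norm.
Variable R : realType.
Implicit Types (g M N Q : 'M[R]_2).

(* For [M] in [SL_2] this is [2 cosh d(i, M i)]. *)
Definition nrm M := M 0 0 ^+ 2 + M 0 1 ^+ 2 + M 1 0 ^+ 2 + M 1 1 ^+ 2.

Lemma nrmN M : nrm (- M) = nrm M.
Proof. by rewrite /nrm !mx2E; ring. Qed.

Lemma nrm1 : nrm 1 = 2.
Proof. by rewrite /nrm !mx2E; ring. Qed.

Lemma nrm_ge2 M : \det M = 1 -> 2 <= nrm M.
Proof.
rewrite /nrm !mx2E => d1.
have := sqr_ge0 (M 0 0 - M 1 1); have := sqr_ge0 (M 0 1 + M 1 0).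
rewrite sqrrB sqrrD; lra.
Qed.

Lemma nrm_inv M : \det M = 1 -> nrm M^-1 = nrm M.
Proof. by move=> d1; rewrite inv2_det1 // adj2E /nrm !mx2E; ring. Qed.

(** Equality in PSL_2: half-turns square to -1, so rewriting words in them is controlled only up to
    sign. *)
Definition eqpm M N := M = N \/ M = - N.

Lemma eqpm_refl M : eqpm M M. Proof. by left. Qed.
Lemma eqpm_sym M N : eqpm M N -> eqpm N M.
Proof. by case=> ->; [left | right; rewrite opprK]. Qed.
Lemma eqpm_trans M N Q : eqpm M N -> eqpm N Q -> eqpm M Q.
Proof. by case=> -> [] ->; rewrite ?opprK; [left|right|right|left]. Qed.
Lemma eqpm_mul M N M' N' : eqpm M M' -> eqpm N N' -> eqpm (M * N) (M' * N').
Proof.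
by case=> -> [] ->; rewrite ?mulrN ?mulNr ?opprK; [left|right|right|left].
Qed.
Lemma eqpm_nrm M N : eqpm M N -> nrm M = nrm N.
Proof. by case=> ->; rewrite ?nrmN. Qed.
Lemma eqpm_inv M N : eqpm M N -> eqpm M^-1 N^-1.
Proof. by move=> [] ->; rewrite ?invrN; [left|right]. Qed.

End Norm.

Section Peak.
Variables (R : realType) (C : nat -> 'M[R]_2) (m : nat) (T0 d : R).
Implicit Types (g : 'M[R]_2) (w u v : seq nat).

Definition ev w : 'M[R]_2 := \prod_(i <- w) C i.

Lemma ev_nil : ev [::] = 1. Proof. exact: big_nil. Qed.
Lemma ev_cons i w : ev (i :: w) = C i * ev w. Proof. exact: big_cons. Qed.
Lemma ev_cat u v : ev (u ++ v) = ev u * ev v. Proof. exact: big_cat. Qed.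
Lemma ev_seq1 i : ev [:: i] = C i. Proof. exact: big_seq1. Qed.
Lemma ev_rcons w i : ev (rcons w i) = ev w * C i.
Proof. by rewrite -cats1 ev_cat ev_seq1. Qed.

(** Indices are read modulo [m]. The relation [ht_rel] holds in SL_2 itself, which makes the surface
    relator evaluate to 1 without a sign. *)
Record halfturns : Prop := Halfturns {
  ht_size : (4 <= m)%N;
  ht_det i : \det (C i) = 1;
  ht_tr i : \tr (C i) = 0;
  ht_per i : C (i + m)%N = C i;
  ht_rel : ev (iota 0 m) = 1 }.

(** Right multiplication by [C i] steps from the tile [g] to its neighbour across side [i]. Vertex
    [k] lies between sides [k - 1] and [k]; the tiles around it are [g * ev (iota k l)] for [l < m],
    with [l = 1] and [l = m - 1] the neighbours across these two sides, and [ds_vertex] concerns the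
    others. Writing [(k + m).-1] gives side [k - 1] also for [k = 0]. *)
Record descent : Prop := Descent {
  ds_T0 : 2 < T0;
  ds_d0 : 0 < d;
  ds_d1 : d < 1;
  ds_far i : T0 < nrm (C i);
  ds_red g : \det g = 1 -> T0 <= nrm g ->
    exists i, nrm (g * C i) <= (1 - d) * nrm g;
  ds_adj g i j : \det g = 1 -> T0 <= nrm g ->
    nrm (g * C i) <= nrm g -> nrm (g * C j) <= nrm g ->
    [\/ i = j %[mod m], i = j.+1 %[mod m] | j = i.+1 %[mod m]];
  ds_vertex g k l : \det g = 1 -> T0 <= nrm g ->
    nrm (g * C k) <= nrm g -> nrm (g * C (k + m).-1) <= nrm g ->
    (2 <= l <= m - 2)%N -> nrm (g * ev (iota k l)) <= (1 - d) * nrm g }.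

Hypotheses (hC : halfturns) (hD : descent).

Let m_gt0 : (0 < m)%N. Proof. exact: leq_trans (ht_size hC). Qed.

Lemma ev_det w : \det (ev w) = 1.
Proof.
elim: w => [|i w IH]; first by rewrite ev_nil det1.
by rewrite ev_cons det2M IH (ht_det hC) mulr1.
Qed.

Lemma ev_unit w : ev w \is a GRing.unit.
Proof. exact/unit_det1/ev_det. Qed.

Lemma C_sqr i : C i * C i = -1.
Proof. exact: sqr_pure (ht_det hC i) (ht_tr hC i). Qed.

Lemma ev_rev w : eqpm (ev (rev w)) (ev w)^-1.
Proof.
elim: w => [|i w IH]; first by rewrite ev_nil invr1; left.
rewrite rev_cons ev_rcons ev_cons invrM ?ev_unit ?unit_det1 ?(ht_det hC) //.
by apply: eqpm_mul IH _; right; rewrite inv2_pure ?(ht_det hC) ?(ht_tr hC) ?opprK.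
Qed.

Lemma C_mod i j : i = j %[mod m] -> C i = C j.
Proof.
have red k : C (k %% m)%N = C k.
  rewrite [in RHS](divn_eq k m) addnC; elim: (k %/ m)%N => [|q IH].
    by rewrite mul0n addn0.
  by rewrite mulSnr addnA (ht_per hC).
by move=> eij; rewrite -red eij red.
Qed.

Lemma ev_period k : ev (iota k m) = 1.
Proof.
elim: k => [|k IH]; first exact: ht_rel hC.
apply: (mulrI (unit_det1 (ht_det hC k))).
rewrite mulr1 -ev_cons -[RHS](ht_per hC) -ev_seq1.
rewrite (_ : k :: _ = iota k m ++ [:: (k + m)%N]) ?ev_cat ?IH ?mul1r //.
by rewrite -[RHS](iotaD k m 1) addn1.
Qed.

(** A full turn around a vertex is 1 and reversal inverts up to sign, so both ways around the vertex
    lead to the same tile. *)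
Lemma ev_vertex k l n : (l + n = m)%N ->
  eqpm (ev (iota k l)) (ev (rev (iota (k + l) n))).
Proof.
move=> ln; have := ev_period k; rewrite -ln iotaD ev_cat => e.
apply: eqpm_sym; apply: eqpm_trans (ev_rev _) _; left.
by apply: (mulIr (ev_unit (iota (k + l) n))); rewrite mulVr ?ev_unit.
Qed.

Definition pts g w : seq 'M[R]_2 := scanl (fun h i => h * C i) g w.

Lemma foldl_ev g w : foldl (fun h i => h * C i) g w = g * ev w.
Proof.
elim: w g => [|i w IH] g /=; first by rewrite ev_nil mulr1.
by rewrite IH ev_cons mulrA.
Qed.

Lemma pts_cat g u v : pts g (u ++ v) = pts g u ++ pts (g * ev u) v.
Proof. by rewrite /pts scanl_cat foldl_ev. Qed.

Lemma size_pts g w : size (pts g w) = size w. Proof. exact: size_scanl. Qed.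

Lemma nth_pts g w j : (j < size w)%N -> nth 0 (pts g w) j = g * ev (take j.+1 w).
Proof.
elim: w g j => [|i w IH] g [|j] //= lt_j; first by rewrite take0 ev_seq1.
by rewrite IH // ev_cons mulrA.
Qed.

(** In units of [d], a drop by the factor [1 - d] lowers the norm by [nrm g >= 2], hence lowers this
    integer part. *)
Definition level g : nat := Num.truncn (nrm g / d).
(** In base [m], fewer than [m] points below level L weigh less than one point of level L, so
    exchanging a peak for the rest of a vertex circuit is a gain. *)
Definition weight (s : seq 'M[R]_2) : nat := \sum_(p <- s) m ^ level p.

Lemma weight_cat s t : weight (s ++ t) = (weight s + weight t)%N.
Proof. exact: big_cat. Qed.

Lemma level_pm g h : eqpm g h -> level g = level h.
Proof. by rewrite /level => /eqpm_nrm ->. Qed.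

Lemma level_drop g h : \det g = 1 -> nrm h <= (1 - d) * nrm g ->
  (level h < level g)%N.
Proof.
move=> dg le_hg; have d0 := ds_d0 hD.
have h0 : 0 <= nrm h by rewrite /nrm !addr_ge0 ?sqr_ge0.
have g2 := nrm_ge2 dg.
have nn : 0 <= nrm h / d by rewrite divr_ge0 // ltW.
rewrite /level truncn_gt_nat -natr1 -lerBrDr.
have /andP[le_h _] := truncn_itv nn; apply: le_trans le_h _.
rewrite -(@ler_pM2r _ d) // mulrBl !divfK ?gt_eqF // mul1r; nra.
Qed.

Lemma weight_pts_pm g h w : eqpm g h -> weight (pts g w) = weight (pts h w).
Proof.
rewrite /weight; elim: w g h => [|i w IH] g h gh /=; first by rewrite !big_nil.
have ghi : eqpm (g * C i) (h * C i) by apply: eqpm_mul gh (eqpm_refl _).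
by rewrite !big_cons (IH _ _ ghi) (level_pm ghi).
Qed.

Lemma weight_lt s L : (size s < m)%N -> (forall p, p \in s -> (level p < L)%N) ->
  (weight s < m ^ L)%N.
Proof.
case: L => [|L] lt_sm lt_sL.
  case: s lt_sm lt_sL => [|p s] _ h; first by rewrite /weight big_nil.
  by have := h p (mem_head _ _).
apply: (@leq_ltn_trans (size s * m ^ L)).
  elim: s lt_sL {lt_sm} => [|p s IH] lt_sL; first by rewrite /weight big_nil.
  rewrite /weight big_cons mulSn leq_add ?IH //; last first.
    by move=> q qs; apply: lt_sL; rewrite inE qs orbT.
  by rewrite leq_pexp2l // -ltnS lt_sL ?mem_head.
by rewrite expnS ltn_mul2r expn_gt0 m_gt0.
Qed.

(** The last point of [r] is, up to sign, the point reached through [x] and [y], so it and all later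
    points keep their levels; only the peak is traded for lower points. *)
Lemma weight_replace u r v x y :
  (forall l, (l < (size r).-1)%N ->
     (level (ev u * ev (take l.+1 r)) < level (ev u * C x))%N) ->
  (size r < m)%N -> eqpm (ev u * ev r) (ev u * C x * C y) ->
  (weight (pts 1 (u ++ r ++ v)) < weight (pts 1 (u ++ x :: y :: v)))%N.
Proof.
move=> lev_r lt_rm eq_r.
rewrite !pts_cat !weight_cat mul1r ltn_add2l (weight_pts_pm _ eq_r).
rewrite /= [X in (_ < X)%N]/weight !big_cons -/(weight _) addnA ltn_add2r.
case/lastP: r lev_r lt_rm eq_r => [|r z] lev_r lt_rm eq_r.
  by rewrite /weight big_nil addn_gt0 expn_gt0 m_gt0.
rewrite -cats1 pts_cat weight_cat /= /weight !big_cons big_nil addn0.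
rewrite (_ : level (_ * C z) = level (ev u * C x * C y)); last first.
  by rewrite -mulrA -ev_rcons; exact: level_pm.
rewrite ltn_add2r; apply: weight_lt.
  by rewrite size_pts; apply: leq_trans lt_rm; rewrite size_rcons.
move=> p /(nthP 0)[j lt_j <-]; rewrite size_pts in lt_j.
rewrite nth_pts //; have := lev_r j; rewrite size_rcons /= => /(_ lt_j).
by rewrite -cats1 takel_cat.
Qed.

(** The path starts at norm 2 below [T0], its first step leaves the ball by [ds_far], and it ends
    inside, so its maximum is attained at an interior point. *)
Lemma peakP w : w != [::] -> nrm (ev w) <= T0 ->
  exists u x y v, [/\ w = u ++ x :: y :: v, T0 <= nrm (ev u * C x),
    nrm (ev u) <= nrm (ev u * C x) & nrm (ev u * C x * C y) <= nrm (ev u * C x)].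
Proof.
move=> w0 end_w; pose f (j : 'I_(size w).+1) := nrm (ev (take j w)).
have sw : (0 < size w)%N by case: (w) w0.
pose j1 : 'I_(size w).+1 := Ordinal (sw : (1 < (size w).+1)%N).
case: (@Order.TotalTheory.arg_maxP _ _ _ j1 predT f) => //= j _ maxj.
have fj : T0 < f j.
  apply: lt_le_trans (maxj j1 isT); rewrite /f /=.
  by case: (w) w0 => // i w' _; rewrite /= take0 ev_seq1 (ds_far hD).
case: j maxj fj => [[|j] /= lt_j] maxj fj.
  by move: fj; rewrite /f /= take0 ev_nil nrm1 ltNge (ltW (ds_T0 hD)).
have lt_jw : (j.+1 < size w)%N.
  rewrite ltn_neqAle; apply/andP; split=> //; apply: contraTneq fj => ej.
  by rewrite /f /= ej take_size -leNgt.
have lt_jw' := ltnW lt_jw.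
have e1 : drop j w = nth 0%N w j :: nth 0%N w j.+1 :: drop j.+2 w.
  by rewrite (drop_nth 0%N) // (drop_nth 0%N).
exists (take j w), (nth 0%N w j), (nth 0%N w j.+1), (drop j.+2 w).
have E1 : ev (take j.+1 w) = ev (take j w) * C (nth 0%N w j).
  by rewrite (take_nth 0%N) // ev_rcons.
have E2 : ev (take j.+2 w) = ev (take j w) * C (nth 0%N w j) * C (nth 0%N w j.+1).
  by rewrite (take_nth 0%N) // ev_rcons E1.
split; first by rewrite -e1 cat_take_drop.
- by rewrite -E1; apply/ltW/fj.
- by rewrite -E1; exact: (maxj (Ordinal (ltnW lt_j : (j < (size w).+1)%N))).
- rewrite -E2 -E1.
  exact: (maxj (Ordinal (lt_jw : (j.+2 < (size w).+1)%N))).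
Qed.

Lemma pred_mod i j : i = j.+1 %[mod m] -> C j = C (i + m).-1.
Proof.
move=> eij; apply: C_mod; apply/eqP.
rewrite -(eqn_modDr 1) !addn1 prednK ?addn_gt0 ?m_gt0 ?orbT //.
by rewrite modnDr -eij.
Qed.

(* A highest point of a path back to the base point is left through sides that
   are equal or share a vertex; in the second case the path is pushed to the
   other side of that vertex, where all points are lower. *)
Theorem peak_reduction (P : seq nat -> Prop) :
  P [::] ->
  (forall u v x y, x = y %[mod m] -> P (u ++ v) -> P (u ++ x :: y :: v)) ->
  (forall u v x y, x = y.+1 %[mod m] -> P (u ++ iota x.+1 (m - 2) ++ v) ->
     P (u ++ x :: y :: v)) ->
  (forall u v x y, y = x.+1 %[mod m] -> P (u ++ rev (iota y.+1 (m - 2)) ++ v) ->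
     P (u ++ x :: y :: v)) ->
  forall w, nrm (ev w) <= T0 -> P w.
Proof.
move=> P0 Pe Pl Pr w; have [n] := ubnP (weight (pts 1 w)).
elim: n w => // n IH w; rewrite ltnS => lt_w end_w.
have [-> //|w0] := eqVneq w [::].
have [u [x [y [v [ew hp hu hy]]]]] := peakP w0 end_w.
have m4 := ht_size hC.
set p := ev u * C x in hp hu hy.
have dp : \det p = 1 by rewrite det2M ev_det (ht_det hC) mulr1.
(* Since [C x] squares to -1, stepping back from the peak crosses side [x] as well: both path
   neighbours of [p] are neighbours across a side of [p]. *)
have eu : eqpm (ev u) (p * C x) by right; rewrite /p -mulrA C_sqr mulrN1 opprK.
have hx : nrm (p * C x) <= nrm p by rewrite -(eqpm_nrm eu).
have step r : eqpm (ev u * ev r) (p * C y) ->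
    (forall l, (l < (size r).-1)%N -> (level (ev u * ev (take l.+1 r)) < level p)%N) ->
    (size r < m)%N -> P (u ++ r ++ v).
  move=> er lr sr; apply: IH.
    by apply: leq_trans lt_w; rewrite ew; apply: weight_replace.
  apply: le_trans end_w; rewrite le_eqVlt; apply/orP; left; apply/eqP.
  apply: eqpm_nrm; rewrite ew !ev_cat !ev_cons !mulrA.
  exact: eqpm_mul er (eqpm_refl _).
rewrite ew; have [exy|exy|exy] := ds_adj hD dp hp hx hy.
- apply: (Pe _ _ _ _ exy); apply: (step [::]) => //.
  by rewrite ev_nil mulr1 -(C_mod exy).
(* In the circuit around vertex [x] of the tile [p], the path came from place 1 and goes on to place
   [m - 1]; the new path visits places 2 to [m - 1] instead of returning through [p]. *)
- apply: (Pl _ _ _ _ exy); apply: step; last by rewrite size_iota; lia.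
    apply: eqpm_trans (eqpm_mul eu (eqpm_refl _)) _.
    rewrite -mulrA -ev_cons; apply: eqpm_mul (eqpm_refl _) _.
    rewrite (_ : x :: _ = iota x (m - 2).+1) //.
    apply: eqpm_trans (@ev_vertex x _ 1 _) _; first by lia.
    rewrite (pred_mod exy) /= ev_seq1 (_ : (x + _)%N = (x + m).-1); last by lia.
    exact: eqpm_refl.
  move=> l; rewrite size_iota => lt_l; apply: level_drop => //.
  rewrite (eqpm_nrm (eqpm_mul eu (eqpm_refl _))) -mulrA -ev_cons take_iota.
  rewrite (_ : minn _ _ = l.+1); last by lia.
  apply: (ds_vertex hD (l := l.+2)) => //; last by lia.
  by rewrite -(pred_mod exy).
(* Mirror image at vertex [y]: after [l] letters of the reversed arc the path is at place
   [m - 1 - l] of the circuit. *)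
- have ey l : (l <= m - 2)%N ->
    eqpm (ev u * ev (take l (rev (iota y.+1 (m - 2))))) (p * ev (iota y (m.-1 - l))).
    move=> le_l; apply: eqpm_trans (eqpm_mul eu (eqpm_refl _)) _.
    rewrite -mulrA -ev_cons; apply: eqpm_mul (eqpm_refl _) _.
    apply: eqpm_sym; apply: eqpm_trans (@ev_vertex y _ (l + 1) _) _; first by lia.
    rewrite iotaD rev_cat /= !ev_cons (pred_mod exy) take_rev size_iota drop_iota.
    left; congr (C _ * ev (rev (iota _ _))); lia.
  apply: (Pr _ _ _ _ exy); apply: step; last by rewrite size_rev size_iota; lia.
    have := ey (m - 2)%N (leqnn _); rewrite take_oversize ?size_rev ?size_iota //.
    by rewrite (_ : (m.-1 - (m - 2))%N = 1%N) ?ev_seq1 //; lia.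
  move=> l; rewrite size_rev size_iota => lt_l; apply: level_drop => //.
  rewrite (eqpm_nrm (ey _ _)); last by lia.
  apply: (ds_vertex hD) => //; last by lia.
  by rewrite -(pred_mod exy).
Qed.

Lemma reduce_into g : \det g = 1 -> exists w, nrm (g * ev w) <= T0.
Proof.
have [n] := ubnP (level g); elim: n g => // n IH g; rewrite ltnS => le_g dg.
have [small|/ltW big] := leP (nrm g) T0; first by exists [::]; rewrite ev_nil mulr1.
have [i hi] := ds_red hD dg big.
have [||w hw] := IH (g * C i).
- exact: leq_trans (level_drop dg hi) le_g.
- by rewrite det2M dg (ht_det hC) mulr1.
by exists (i :: w); rewrite ev_cons mulrA.
Qed.

End Peak.

(** * The surface group inside the group generated by half-turns *)

Section SurfaceGroup.
Variable g : nat.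
Implicit Types (l : letter g) (u v w : seq (letter g)).
Local Notation "u =~ v" := (wequiv u v) (at level 70).

#[local] Hint Resolve we_refl : core.

Global Instance wequiv_equivalence : Equivalence (@wequiv g).
Proof.
by split; [exact: we_refl | exact: we_sym | exact: we_trans].
Qed.

Lemma wequiv_catl x u v : u =~ v -> x ++ u =~ x ++ v.
Proof.
elim=> {u v} [w|u v _|u v w _ + _|u v y|u v]; first exact: we_refl.
- exact: we_sym.
- exact: we_trans.
- by rewrite !catA; exact: we_cancel.
- by rewrite !(catA x); exact: we_rel.
Qed.

Lemma wequiv_catr x u v : u =~ v -> u ++ x =~ v ++ x.
Proof.
elim=> {u v} [w|u v _|u v w _ + _|u v y|u v]; first exact: we_refl.
- exact: we_sym.
- exact: we_trans.
- by rewrite -!catA; exact: we_cancel.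
- by rewrite -!catA; exact: we_rel.
Qed.

Global Instance wequiv_cat : Proper (respectful (@wequiv g) (respectful (@wequiv g) (@wequiv g))) cat.
Proof.
move=> u u' eu v v' ev.
exact: we_trans (wequiv_catr _ eu) (wequiv_catl _ ev).
Qed.

Definition winv w := rev (map (@inv_letter g) w).

Lemma inv_letterK : involutive (@inv_letter g).
Proof. by case=> [[i c] e]; rewrite /inv_letter /= negbK. Qed.

Lemma winv_cat u v : winv (u ++ v) = winv v ++ winv u.
Proof. by rewrite /winv map_cat rev_cat. Qed.

Lemma winvK : involutive winv.
Proof.
move=> w; rewrite /winv map_rev revK -map_comp map_id_in // => l _.
exact: inv_letterK.
Qed.

Lemma winv_nil : winv [::] = [::]. Proof. by []. Qed.

Lemma winvr w : w ++ winv w =~ [::].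
Proof.
elim/last_ind: w => [|w l IH]; first exact: we_refl.
rewrite -cats1 winv_cat -catA /= -[X in _ =~ X]/([::] ++ [::]).
apply: we_trans IH; apply: we_sym; exact: we_cancel.
Qed.

Lemma winvl w : winv w ++ w =~ [::].
Proof. by rewrite -{2}[w]winvK; exact: winvr. Qed.

Lemma winvKl w v : w ++ winv w ++ v =~ v.
Proof. by rewrite catA winvr. Qed.

Lemma winvKr w v : winv w ++ w ++ v =~ v.
Proof. by rewrite catA winvl. Qed.

Global Instance wequiv_inv : Proper (respectful (@wequiv g) (@wequiv g)) winv.
Proof.
move=> u v e; apply: we_trans (we_sym (winvKr v (winv u))) _.
rewrite -[X in _ =~ X]cats0; apply: wequiv_catl.
apply: (we_trans _ (winvr u)); apply: wequiv_catr; exact: we_sym.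
Qed.

Lemma wequiv_divl u v w : u ++ v =~ w -> v =~ winv u ++ w.
Proof. by move=> <-; rewrite winvKr. Qed.

Lemma wequiv_divr u v w : u ++ v =~ w -> u =~ w ++ winv v.
Proof. by move=> <-; rewrite -catA winvr cats0. Qed.

Lemma wequiv_inv1 u v : u ++ v =~ [::] -> v =~ winv u.
Proof. by move/wequiv_divl; rewrite cats0. Qed.

Definition wgen (c : bool) (i : nat) : seq (letter g) :=
  if insub i is Some j then [:: (j, c, false)] else [::].
Local Notation wa := (wgen false).
Local Notation wb := (wgen true).

(** Since [a_j^-1 b_j^-1 = c_(2j+1) c_(2j+2)], these products telescope to [c_0 h_i]. *)
Fixpoint T i := if i is j.+1 then T j ++ winv (wa j) ++ winv (wb j) else [::].
Fixpoint D i :=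
  if i is j.+1 then D j ++ wa j ++ wb j ++ winv (wa j) ++ winv (wb j) else [::].
(** With [c_0^2 = 1] the product of the first [i] commutators is [h_i^2 = (h_i c_0)(c_0 h_i)], that
    is [D i = H i T i]; solving for [H i] gives a word without half-turns. *)
Definition H i := D i ++ winv (T i).

Lemma D_relator : D g = relator g.
Proof.
rewrite /relator.
have nthP (j : 'I_g) : nth j (enum 'I_g) j = j by exact: nth_ord_enum.
suff: forall n, (n <= g)%N -> D n = flatten [seq
    [:: (i, false, false); (i, true, false); (i, false, true); (i, true, true)]
    | i <- take n (enum 'I_g)].
  by move=> /(_ g (leqnn _)); rewrite take_oversize ?size_enum_ord.
elim=> [|n IH] lt_n; first by rewrite take0.
have ng : (n < size (enum 'I_g))%N by rewrite size_enum_ord.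
rewrite (take_nth (Ordinal lt_n) ng) map_rcons flatten_rcons -IH ?(ltnW lt_n) //=.
rewrite (_ : nth _ _ _ = Ordinal lt_n); last exact: (nthP (Ordinal lt_n)).
by rewrite /wgen insubT.
Qed.

Lemma D_end : D g =~ [::].
Proof. by rewrite D_relator -[relator g]cats0; apply: we_sym; exact: (we_rel [::]). Qed.

(* Conjugation by [c_0], as a substitution on words; [H i] is [h_i c_0] and
   [T i] is [c_0 h_i]. *)
Definition tau_gen (c : bool) i :=
  if c then T i ++ winv (wb i) ++ H i else winv (H i) ++ winv (wa i) ++ winv (T i).
Definition tau_letter l :=
  if l.2 then winv (tau_gen l.1.2 l.1.1) else tau_gen l.1.2 l.1.1.
Definition tau w := flatten (map tau_letter w).

Lemma tau_cat u v : tau (u ++ v) = tau u ++ tau v.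
Proof. by rewrite /tau map_cat flatten_cat. Qed.

Lemma tau_winv w : tau (winv w) = winv (tau w).
Proof.
elim: w => // l w IH; rewrite -cat1s winv_cat !tau_cat winv_cat IH; congr cat.
rewrite /tau /= !cats0; case: l => [[i c] []] //=.
by rewrite /tau_letter /= winvK.
Qed.

Lemma tau_wgen c i : (i < g)%N -> tau (wgen c i) = tau_gen c i.
Proof. by move=> lt_i; rewrite /wgen insubT /tau /= cats0. Qed.

Ltac wnorm := rewrite ?winv_cat ?winvK ?winv_nil -?catA ?cats0 ?cat0s.
Ltac wsimp := wnorm; repeat (progress (rewrite ?winvKl ?winvKr ?winvl ?winvr; wnorm)).

Lemma H_rec i : H i.+1 =~ D i ++ wa i ++ wb i ++ winv (T i).
Proof. by rewrite /H /=; wsimp. Qed.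

Lemma tau_T i : (i <= g)%N -> tau (T i) =~ H i.
Proof.
elim: i => [|i IH] lt_i; first by rewrite /H /=; exact: we_refl.
rewrite H_rec /= !tau_cat !tau_winv !tau_wgen // IH ?(ltnW lt_i) // /tau_gen /H.
by wsimp.
Qed.

(** At [i = g] the relator goes to a conjugate of itself, which is what makes [tau] well defined on
    the surface group. *)
Lemma tau_D i : (i <= g)%N -> tau (D i) =~ T i ++ D i ++ winv (T i).
Proof.
elim: i => [|i IH] lt_i; first exact: we_refl.
rewrite /= !tau_cat !tau_winv !tau_wgen // IH ?(ltnW lt_i) // /tau_gen /H.
by wsimp.
Qed.

Lemma tau_H i : (i <= g)%N -> tau (H i) =~ T i.
Proof.
by move=> le_i; rewrite /H tau_cat tau_winv tau_D // tau_T // /H; wsimp.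
Qed.

Global Instance wequiv_tau : Proper (respectful (@wequiv g) (@wequiv g)) tau.
Proof.
move=> u v; elim=> {u v} [w|u v _|u v w _ + _|u v l|u v]; first exact: we_refl.
- exact: we_sym.
- exact: we_trans.
- rewrite -cat1s -[inv_letter l :: v]cat1s !tau_cat.
  by rewrite -[[:: inv_letter l]]/(winv [:: l]) tau_winv winvKl.
- rewrite !tau_cat -D_relator tau_D // D_end; by wsimp.
Qed.

Lemma tauK w : tau (tau w) =~ w.
Proof.
have gen c i : (i < g)%N -> tau (tau_gen c i) =~ wgen c i.
  move=> lt_i; have le_i := ltnW lt_i.
  case: c; rewrite [tau_gen _ _]/(_ ++ _ ++ _) tau_cat (tau_cat (winv _)).
    by rewrite !tau_winv tau_H // tau_T // tau_wgen // /tau_gen; wsimp.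
  by rewrite !tau_winv tau_H // tau_T // tau_wgen // /tau_gen; wsimp.
elim: w => [|[[i c] e] w IH]; first exact: we_refl.
rewrite -cat1s !tau_cat IH; apply: wequiv_catr.
have ei : [:: (i, c, e)] = if e then winv (wgen c i) else wgen c i.
  by rewrite /wgen valK; case: e.
by rewrite ei /tau_letter; case: e {ei} => /=; rewrite cats0 ?tau_winv gen ?ltn_ord.
Qed.

Local Notation m := (g.*2.+2).

(* The half-turns are [c_k = halfturn k * c_0]; for [k = 2g+1] the generator
   [wgen false g] is the empty word. *)
Definition halfturn k := if k is j.+1
  then (if odd j then wb j./2 else winv (wa j./2)) ++ winv (T j./2) else [::].

Lemma halfturn_odd i : halfturn i.*2.+1 = winv (wa i) ++ winv (T i).
Proof. by rewrite /halfturn odd_double doubleK. Qed.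

Lemma halfturn_even i : halfturn i.*2.+2 = wb i ++ winv (T i).
Proof. by rewrite /halfturn /= odd_double uphalf_double. Qed.

Lemma wgen_end c : wgen c g = [::].
Proof. by rewrite /wgen insubN // ltnn. Qed.

(** This is [c_k^2 = 1]: writing [c_k = halfturn k * c_0], the square is [halfturn k] times its
    conjugate. The surface relation enters at [k = 2g + 1]. *)
Lemma halfturn_sqr k : (k < m)%N -> halfturn k ++ tau (halfturn k) =~ [::].
Proof.
case: k => [|k] lt_k; first exact: we_refl.
rewrite -[k](odd_double_half k) in lt_k *; set i := k./2 in lt_k *.
case: (odd k) lt_k => lt_k; rewrite ?add1n ?add0n in lt_k *.
  have lt_i : (i < g)%N by lia.
  rewrite halfturn_even !tau_cat tau_winv tau_wgen // tau_T ?(ltnW lt_i) //.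
  by rewrite /tau_gen; wsimp.
rewrite halfturn_odd !tau_cat !tau_winv tau_T; last by lia.
have [->|ni] := eqVneq i g.
  by rewrite wgen_end /H; wsimp; rewrite D_end; wsimp.
by rewrite tau_wgen ?/tau_gen; [wsimp | lia].
Qed.

Lemma tau_halfturn k : (k < m)%N -> tau (halfturn k) =~ winv (halfturn k).
Proof. by move=> lt_k; apply: wequiv_inv1; exact: halfturn_sqr. Qed.

(** Normal form in the semidirect product of the surface group with the group of order two generated
    by [c_0]: a word [w] in half-turns equals [psi w] times [c_0] to the power [size w]. *)
Fixpoint psi (w : seq nat) :=
  if w is k :: w' then halfturn (k %% m) ++ tau (psi w') else [::].

Definition tau_if (b : bool) w := if b then tau w else w.

Global Instance wequiv_tau_if b : Proper (respectful (@wequiv g) (@wequiv g)) (tau_if b).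
Proof. by case: b => u v e /=; rewrite /tau_if ?e. Qed.

Lemma psi_cat (u v : seq nat) : psi (u ++ v) =~ psi u ++ tau_if (odd (size u)) (psi v).
Proof.
elim: u => [|k u IH]; first exact: we_refl.
rewrite /= IH tau_cat -catA; do 2!apply: wequiv_catl.
by case: odd => /=; rewrite ?tauK.
Qed.

Lemma psi_cons2 x y : psi [:: x; y] =~ halfturn (x %% m) ++ tau (halfturn (y %% m)).
Proof. by rewrite /= cats0. Qed.

Lemma psi_sqr x y : x = y %[mod m] -> psi [:: x; y] =~ [::].
Proof. by move=> exy; rewrite psi_cons2 exy halfturn_sqr // ltn_mod. Qed.

Lemma psi_replace (u r : seq nat) x y (v : seq nat) : odd (size r) = false -> psi r =~ psi [:: x; y] ->
  psi (u ++ r ++ v) =~ psi (u ++ x :: y :: v).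
Proof.
move=> sr er; rewrite psi_cat (psi_cat u) -[x :: _]/([:: x; y] ++ v).
have -> // : psi (r ++ v) =~ psi ([:: x; y] ++ v).
by rewrite (psi_cat r) (psi_cat [:: x; y]) sr er.
Qed.

Lemma psi_rev r : psi (rev r) ++ tau_if (odd (size r)) (psi r) =~ [::].
Proof.
rewrite -[size r]size_rev -psi_cat; elim: r => [|k r IH]; first exact: we_refl.
rewrite rev_cons cat_rcons -(@psi_replace (rev r) [::]) //.
by apply: we_sym; exact: psi_sqr.
Qed.

Lemma psi_prefix i : (i <= g)%N -> psi (iota 0 i.*2.+1) =~ H i.
Proof.
elim: i => [|i IH] lt_i; first exact: we_refl.
have -> : iota 0 i.+1.*2.+1 = iota 0 i.*2.+1 ++ [:: i.*2.+1; i.*2.+2].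
  by rewrite (_ : i.+1.*2.+1 = (i.*2.+1 + 2)%N) ?iotaD //; lia.
rewrite psi_cat IH ?(ltnW lt_i) // size_iota /= odd_double /tau_if /= cats0.
rewrite tau_cat tauK !modn_small; try lia.
rewrite tau_halfturn; last by lia.
by rewrite halfturn_odd halfturn_even H_rec /H; wsimp.
Qed.

(** For [k = 0] the prefix contributes [H g], cancelled by the conjugate of [halfturn (2g + 1)], the
    inverse of [T g]. Cyclic shifts follow by conjugation. *)
Lemma psi_period k : psi (iota k m) =~ [::].
Proof.
elim: k => [|k IH].
  rewrite (_ : m = g.*2.+1 + 1)%N ?iotaD ?psi_cat ?psi_prefix //; last by lia.
  rewrite size_iota /= odd_double /tau_if /= cats0 add0n modn_small ?halfturn_odd; last by lia.
  by rewrite wgen_end tau_cat !tau_winv tau_T //; wsimp.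
have e1 : psi (iota k.+1 g.*2.+1) =~ halfturn (k %% m).
  rewrite -[X in X =~ _]tauK -[X in _ =~ X]tauK.
  have /wequiv_inv1 -> : halfturn (k %% m) ++ tau (psi (iota k.+1 g.*2.+1)) =~ [::] by [].
  by rewrite (tau_halfturn (k := k %% m)) // ltn_mod.
rewrite (_ : m = g.*2.+1 + 1)%N ?iotaD ?psi_cat; last by lia.
rewrite e1 size_iota /= odd_double /tau_if /= cats0 (_ : (_ + _)%N = (k + m)%N); last by lia.
by rewrite modnDr halfturn_sqr // ltn_mod.
Qed.

Lemma psi_vertexl x y : x = y.+1 %[mod m] ->
  psi (iota x.+1 (m - 2)) =~ psi [:: x; y].
Proof.
move=> exy; have := psi_period x.
have ey : (x + g.*2.+1 = y %[mod m])%N.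
  by apply/eqP; rewrite -(eqn_modDr 1) !addn1 -addnS modnDr exy.
rewrite (_ : iota x m = x :: iota x.+1 (m - 2) ++ [:: (x + g.*2.+1)%N]); last first.
  by rewrite subn2 /= -[[:: (x + _)%N]]/(iota (x + g.*2.+1)%N 1) addnS -addSn -iotaD addn1.
rewrite /= psi_cat size_iota (_ : odd _ = false) /=; last by lia.
rewrite cats0 ey => /wequiv_inv1 e.
have {e} e := wequiv_tau e; rewrite tauK tau_winv in e.
rewrite cats0 (wequiv_divr e) tau_halfturn ?ltn_mod // winvK tau_halfturn //.
by rewrite ltn_mod.
Qed.

Lemma psi_vertexr x y : y = x.+1 %[mod m] ->
  psi (rev (iota y.+1 (m - 2))) =~ psi [:: x; y].
Proof.
move=> exy; have := psi_rev (iota y.+1 (m - 2)).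
rewrite size_iota (_ : odd _ = false) /=; last by lia.
rewrite (psi_vertexl exy) => e; rewrite (wequiv_divr e).
by have := psi_rev [:: y; x]; rewrite /= => /wequiv_divr ->.
Qed.

Lemma psi_even_rev r : ~~ odd (size r) -> psi (rev r) =~ winv (psi r).
Proof.
by move=> /negbTE sr; have := psi_rev r; rewrite sr /= => /wequiv_divr.
Qed.

Definition phi_gen (c : bool) i := if c then i.*2.+2 :: iota 0 i.*2.+1
  else rcons (rev (iota 0 i.*2.+1)) i.*2.+1.
Definition phi_letter l :=
  if l.2 then rev (phi_gen l.1.2 l.1.1) else phi_gen l.1.2 l.1.1.
Definition phi w := flatten (map phi_letter w).

Lemma size_phi_gen c i : odd (size (phi_gen c i)) = false.
Proof.
have si : size (iota 0 i.*2.+1) = i.*2.+1 by rewrite size_iota.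
have sp : size (phi_gen c i) = i.+1.*2.
  case: c; last by rewrite size_rcons size_rev si.
  by rewrite /phi_gen -[LHS]/(size (iota 0 i.*2.+1)).+1 si.
by rewrite sp odd_double.
Qed.

Lemma psi_phi_gen c i : (i < g)%N -> psi (phi_gen c i) =~ wgen c i.
Proof.
move=> lt_i; have le_i := ltnW lt_i; have pH := psi_prefix le_i.
rewrite /phi_gen; case: c.
  rewrite -cat1s psi_cat pH /tau_if /= tau_H // cats0 modn_small; last by lia.
  by rewrite halfturn_even; wsimp.
have := psi_rev (iota 0 i.*2.+1); rewrite pH size_iota [odd _]/= odd_double [tau_if _ _]/= tau_H //.
move=> /wequiv_divr e; rewrite -cats1 psi_cat e size_rev size_iota [odd _]/= odd_double.
rewrite /tau_if /= cats0 modn_small; last by lia.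
rewrite tau_halfturn; last by lia.
by rewrite halfturn_odd; wsimp.
Qed.

Lemma psi_phi w : psi (phi w) =~ w.
Proof.
elim: w => [|[[i c] e] w IH]; first exact: we_refl.
rewrite -[phi _]/(phi_letter (i, c, e) ++ phi w) psi_cat IH.
have -> : odd (size (phi_letter (i, c, e))) = false.
  by rewrite /phi_letter; case: e => /=; rewrite ?size_rev size_phi_gen.
rewrite /tau_if -cat1s; apply: wequiv_catr; rewrite /phi_letter.
have pg : psi (phi_gen c i) =~ [:: (i, c, false)].
  by rewrite psi_phi_gen // /wgen valK.
case: e => //=; rewrite psi_even_rev ?size_phi_gen // pg; exact: we_refl.
Qed.

End SurfaceGroup.

(** * The hyperbolic structure *)

Section Structure.
Variables (R : realType) (g : nat) (C : nat -> 'M[R]_2) (T0 d : R).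
Local Notation m := (g.*2.+2).
Hypotheses (hC : halfturns C m) (hD : descent C m T0 d).
Local Notation ev := (ev C).

Definition hword i := iota 0 i.*2.+1.
Definition gens (i : 'I_g) : 'M[R]_2 * 'M[R]_2 :=
  ((ev (hword i))^-1 * C i.*2.+1, C i.*2.+2 * ev (hword i)).

Lemma pm_ev_unitE w (M : 'M[R]_2) : eqpm M (ev w) -> eqpm M^-1 (ev (rev w)).
Proof.
move=> e; apply: eqpm_trans (eqpm_sym (ev_rev hC w)).
exact: eqpm_inv e.
Qed.

Lemma letter_eval_phi l : eqpm (letter_eval gens l) (ev (phi_letter l)).
Proof.
case: l => [[i c] e]; rewrite /phi_letter /letter_eval /=.
have gen : eqpm (if c then (gens i).2 else (gens i).1) (ev (phi_gen c i)).
  case: c; rewrite /phi_gen.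
    by rewrite ev_cons; exact: eqpm_refl.
  rewrite ev_rcons; apply: eqpm_mul (eqpm_refl _).
  exact/eqpm_sym/(ev_rev hC).
by case: e => //; exact: pm_ev_unitE.
Qed.

Lemma word_eval_cat (u v : seq (letter g)) :
  word_eval gens (u ++ v) = word_eval gens u * word_eval gens v.
Proof. exact: big_cat. Qed.

Lemma word_eval_cons l (v : seq (letter g)) :
  word_eval gens (l :: v) = letter_eval gens l * word_eval gens v.
Proof. exact: big_cons. Qed.

Lemma word_eval_seq1 l : word_eval gens [:: l] = letter_eval gens l.
Proof. exact: big_seq1. Qed.

Lemma word_eval_phi w : eqpm (word_eval gens w) (ev (phi w)).
Proof.
elim: w => [|l w IH].
  by rewrite /word_eval big_nil ev_nil; exact: eqpm_refl.
rewrite word_eval_cons -[phi _]/(phi_letter l ++ phi w) ev_cat.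
exact: eqpm_mul (letter_eval_phi l) IH.
Qed.

Lemma gens_det i : \det (gens i).1 = 1 /\ \det (gens i).2 = 1.
Proof.
by rewrite !det2M det1_inv ?(ev_det hC) // !(ht_det hC) !mulr1.
Qed.

Lemma letter_eval_det l : \det (letter_eval gens l) = 1.
Proof.
have [] := gens_det l.1.1; rewrite /letter_eval.
by case: l.1.2 => d1 d2; case: l.2 => //; exact: det1_inv.
Qed.

Lemma word_eval_det w : \det (word_eval gens w) = 1.
Proof.
elim: w => [|l w IH]; first by rewrite /word_eval big_nil det1.
by rewrite word_eval_cons det2M letter_eval_det IH mulr1.
Qed.

Lemma letter_eval_inv l : letter_eval gens (inv_letter l) = (letter_eval gens l)^-1.
Proof.
rewrite /letter_eval /inv_letter /=; case: l.2 => //=.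
by rewrite -[invmx _]/(_^-1)%R invrK.
Qed.

Lemma word_eval_winv w : word_eval gens (winv w) = (word_eval gens w)^-1.
Proof.
elim: w => [|l w IH]; first by rewrite /word_eval big_nil invr1.
rewrite -cat1s winv_cat !word_eval_cat IH !word_eval_seq1 letter_eval_inv.
by rewrite invrM ?unit_det1 ?word_eval_det ?letter_eval_det.
Qed.

Lemma word_eval_wgen c (i : 'I_g) :
  word_eval gens (wgen g c i) = if c then (gens i).2 else (gens i).1.
Proof. by rewrite /wgen valK word_eval_seq1. Qed.

(** The telescoping carried out in SL_2, where a half-turn has its negative as inverse. The minus
    sign is [h_0^-2 = c_0^-2]; at [i = g] it is cancelled by [c_(2g+1)^2 = -1]. *)
Lemma word_eval_D i : (i <= g)%N -> word_eval gens (D g i) = - (ev (hword i) * ev (hword i)).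
Proof.
elim: i => [|i IH] lt_i.
  by rewrite /word_eval big_nil /hword /= ev_seq1 (C_sqr hC) opprK.
have e i' : i' = Ordinal lt_i -> (i : nat) = i' by move->.
rewrite /= !word_eval_cat !word_eval_winv IH ?(ltnW lt_i) //.
rewrite (e _ erefl) !word_eval_wgen /gens /=.
have -> : ev (hword i.+1) = ev (hword i) * C i.*2.+1 * C i.*2.+2.
  rewrite /hword (_ : i.+1.*2.+1 = (i.*2.+1 + 2)%N); last by lia.
  by rewrite iotaD ev_cat !ev_cons ev_nil mulr1 mulrA.
set h := ev (hword i); set c := C _; set c' := C _.
have [uh uc uc'] : [/\ h \is a GRing.unit, c \is a GRing.unit & c' \is a GRing.unit].
  by split; apply: unit_det1; rewrite ?(ev_det hC) ?(ht_det hC).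
have ic : c^-1 = - c by apply: inv2_pure; [exact: ht_det hC _|exact: ht_tr hC _].
have ic' : c'^-1 = - c' by apply: inv2_pure; [exact: ht_det hC _|exact: ht_tr hC _].
rewrite !invrM ?unitrV // invrK ic ic' !(mulNr, mulrN, opprK).
by congr (- _); rewrite -!mulrA !mulVKr.
Qed.

Lemma word_eval_relator : word_eval gens (relator g) = 1.
Proof.
rewrite -D_relator word_eval_D //.
have e : ev (hword g) * C g.*2.+1 = 1.
  by rewrite -(ht_rel hC) -ev_rcons -cats1 /hword -[g.*2.+2]addn1 iotaD.
have -> : ev (hword g) = - C g.*2.+1.
  have u := unit_det1 (ht_det hC g.*2.+1).
  apply: (mulIr u); rewrite e mulNr (C_sqr hC) opprK //.
by rewrite mulrNN (C_sqr hC) opprK.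
Qed.

Lemma wequiv_word_eval u v : wequiv u v -> word_eval gens u = word_eval gens v.
Proof.
elim=> {u v} [|u v _ -> //|u v w _ -> _ -> //|u v l|u v] //.
  rewrite !word_eval_cat !word_eval_cons letter_eval_inv mulVKr //.
  exact/unit_det1/letter_eval_det.
by rewrite !word_eval_cat word_eval_relator mul1r.
Qed.

(** Every move of the peak reduction preserves [psi], and [psi] recovers the surface word from its
    spelling in half-turns. Faithfulness and discreteness are both instances. *)
Lemma small_trivial w : nrm (word_eval gens w) <= T0 -> word_trivial w.
Proof.
rewrite (eqpm_nrm (word_eval_phi w)) => small.
rewrite /word_trivial -[X in wequiv X _](psi_phi w).
pose P w := wequiv (psi g w) [::].
apply: (peak_reduction hC hD (P := P)) small => {w}; rewrite /P.
- exact: we_refl.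
- move=> u v x y exy; rewrite -(@psi_replace g u [::]) //.
  by rewrite psi_sqr; [exact: we_refl|].
- move=> u v x y exy; rewrite (psi_replace u v _ (psi_vertexl exy)) //.
  by rewrite size_iota; lia.
- move=> u v x y exy; rewrite (psi_replace u v _ (psi_vertexr exy)) //.
  by rewrite size_rev size_iota; lia.
Qed.

Lemma word_eval_faithful w : pm1 (word_eval gens w) -> word_trivial w.
Proof.
move=> e; apply: small_trivial; rewrite (eqpm_nrm (e : eqpm _ 1)) nrm1.
exact/ltW/(ds_T0 hD).
Qed.

Lemma Gammabar_discrete : exists eps : R, 0 < eps /\ forall M, Gammabar gens M ->
  (forall i j, `|M i j - (1 : 'M[R]_2) i j| < eps) -> M = 1.
Proof.
(* Entries within [e] of the identity give norm at most [2 + 4 e + 4 e^2], and [e <= 1/2] bounds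
   this by [2 + 6 e <= T0]. The same bound later excludes -1. *)
have T2 := ds_T0 hD; pose e := Num.min (1 / 2) ((T0 - 2) / 6).
have e0 : 0 < e by rewrite lt_min; apply/andP; split; lra.
have [e1 e2] : e <= 1 / 2 /\ e <= (T0 - 2) / 6.
  by rewrite /e; split; rewrite ge_min lexx ?orbT.
exists e; split=> // M [w eM] close.
have entry i j : - e <= M i j - (1 : 'M[R]_2) i j <= e.
  by rewrite -ler_norml; exact/ltW/close.
have := (entry 0 0, entry 0 1, entry 1 0, entry 1 1); rewrite !mx2E.
move=> [[[/andP[a1 a2] /andP[b1 b2]] /andP[c1 c2]] /andP[d1' d2]].
have {eM} eM : eqpm M (word_eval gens w) by [].
have small : nrm (word_eval gens w) <= T0.
  rewrite -(eqpm_nrm eM) /nrm; nra.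
have := wequiv_word_eval (small_trivial small).
rewrite {2}/word_eval big_nil => e3; rewrite e3 in eM; case: eM => eM; first by rewrite eM one2E.
by exfalso; move: a1; rewrite eM !mx2E; lra.
Qed.

Lemma Gammabar1 : Gammabar gens 1.
Proof. by exists [::]; left; rewrite /word_eval big_nil. Qed.

Lemma Gammabar_pm M N : eqpm M N -> Gammabar gens N -> Gammabar gens M.
Proof. by move=> e [w eN]; exists w; exact: (eqpm_trans e (eN : eqpm _ _)). Qed.

Lemma Gammabar_mul M N : Gammabar gens M -> Gammabar gens N -> Gammabar gens (M * N).
Proof.
move=> [u eu] [v ev]; exists (u ++ v); rewrite word_eval_cat.
exact: (@eqpm_mul R M N _ _ eu ev).
Qed.

Lemma Gammabar_inv M : Gammabar gens M -> Gammabar gens M^-1.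
Proof.
move=> [w ew]; exists (winv w); rewrite word_eval_winv.
exact: (eqpm_inv (ew : eqpm _ _)).
Qed.

Lemma Gammabar_gen c i : Gammabar gens (if c then (gens i).2 else (gens i).1).
Proof. by exists (wgen g c i); left; rewrite word_eval_wgen. Qed.

Lemma C_inv i : (C i)^-1 = - C i.
Proof. exact: inv2_pure (ht_det hC i) (ht_tr hC i). Qed.

(** Letters are taken in pairs: [c_i c_j] is [(c_0 c_i)^-1 (c_0 c_j)] up to sign. *)
Lemma Gammabar_even_below n :
  (forall j, (j < n)%N -> Gammabar gens (C 0 * C j)) ->
  forall w, all (fun j => j < n)%N w -> ~~ odd (size w) -> Gammabar gens (ev w).
Proof.
move=> h w; have [k] := ubnP (size w); elim: k w => // k IH [|i [|j w]] //.
  by rewrite ev_nil => _ _ _; exact: Gammabar1.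
rewrite /= negbK => lt_k /and3P[li lj lw] ow; rewrite !ev_cons mulrA.
apply: Gammabar_mul; last by apply: IH => //; lia.
apply: Gammabar_pm (Gammabar_mul (Gammabar_inv (h _ li)) (h _ lj)).
rewrite invrM ?unit_det1 ?(ht_det hC) // !C_inv mulrNN -mulrA (mulrA (C 0)).
by rewrite (C_sqr hC) mulN1r mulrN; right; rewrite opprK.
Qed.

(** From [c_(2i+1) = h_i a_i] and [c_(2i+2) = b_i h_i^-1], where [h_i] uses only earlier half-turns.
    So the image is the whole group of even words. *)
Lemma Gammabar_half j : (j < m)%N -> Gammabar gens (C 0 * C j).
Proof.
have [n] := ubnP j; elim: n j => // n IH j; rewrite ltnS => le_jn lt_jm.
have below : forall w, all (fun i => i < j)%N w -> ~~ odd (size w) -> Gammabar gens (ev w).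
  apply: Gammabar_even_below => i lt_ij; apply: IH; first exact: leq_trans le_jn.
  exact: ltn_trans lt_jm.
have hw i : (i.*2.+1 <= j)%N -> Gammabar gens (C 0 * ev (hword i)).
  move=> le_ij; rewrite -ev_cons; apply: below.
    rewrite /= (leq_trans _ le_ij) //; apply/allP => k; rewrite mem_iota => /andP[_ lk].
    exact: leq_trans le_ij.
  by rewrite /= size_iota /= odd_double.
case: j lt_jm {le_jn below} hw => [|j] lt_jm hw.
  by apply: Gammabar_pm Gammabar1; right; rewrite (C_sqr hC).
rewrite -[j](odd_double_half j) in lt_jm hw *; set i := j./2 in lt_jm hw *.
have uC k : C k \is a GRing.unit by exact: unit_det1 (ht_det hC k).
have uh : ev (hword i) \is a GRing.unit by exact: ev_unit hC _.
have h_i : Gammabar gens (C 0 * ev (hword i)) by apply: hw; lia.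
case: (odd j) lt_jm {hw} => lt_jm; rewrite ?add1n ?add0n in lt_jm *.
  have lt_ig : (i < g)%N by lia.
  have := Gammabar_inv (Gammabar_mul (Gammabar_gen true (Ordinal lt_ig)) (Gammabar_inv h_i)).
  apply: Gammabar_pm; rewrite /= [(C 0 * _)^-1]invrM ?uC // -mulrA mulVKr //.
  by rewrite invrM ?unitrV ?uC // invrK C_inv mulrN; right; rewrite opprK.
(* The last half-turn belongs to no generator; by the relation it is [- h_g]. *)
have [eg|ng] := eqVneq i g.
  apply: Gammabar_pm h_i; right; rewrite -mulrN; congr (_ * _).
  apply: (mulIr (uC g.*2.+1)); rewrite eg (C_sqr hC) mulNr -ev_rcons -cats1.
  by rewrite -(ht_rel hC) /hword -[g.*2.+2]addn1 iotaD.
have lt_ig : (i < g)%N by lia.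
apply: Gammabar_pm (Gammabar_mul h_i (Gammabar_gen false (Ordinal lt_ig))).
by rewrite /= -!mulrA mulVKr //; left.
Qed.

Lemma Gammabar_even w : ~~ odd (size w) -> Gammabar gens (ev w).
Proof.
move=> ow; have -> : ev w = ev [seq (i %% m)%N | i <- w].
  elim: w {ow} => //= i w IH; rewrite !ev_cons IH; congr (_ * _).
  by apply: (C_mod hC); rewrite modn_mod.
apply: (@Gammabar_even_below m); rewrite ?size_map //; last first.
  by apply/allP => _ /mapP[j _ ->]; rewrite ltn_mod.
by move=> j lt_j; apply: Gammabar_half.
Qed.

Lemma nrm_mul (M N : 'M[R]_2) : nrm (M * N) <= nrm M * nrm N.
Proof.
have cs (a b c e : R) : (a * c + b * e) ^+ 2 <= (a ^+ 2 + b ^+ 2) * (c ^+ 2 + e ^+ 2).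
  rewrite -subr_ge0 (_ : _ - _ = (a * e - b * c) ^+ 2) ?sqr_ge0 //; ring.
rewrite /nrm !mul2E.
have h1 := cs (M 0 0) (M 0 1) (N 0 0) (N 1 0).
have h2 := cs (M 0 0) (M 0 1) (N 0 1) (N 1 1).
have h3 := cs (M 1 0) (M 1 1) (N 0 0) (N 1 0).
have h4 := cs (M 1 0) (M 1 1) (N 0 1) (N 1 1).
apply: le_trans (lerD (lerD (lerD h1 h2) h3) h4) _.
rewrite le_eqVlt; apply/orP; left; apply/eqP; ring.
Qed.

(** Descent may end at an odd word; one more step [c_0] repairs the parity and costs at most the
    factor [nrm (C 0)]. *)
Lemma reduce_into_even h : \det h = 1 ->
  exists2 w, ~~ odd (size w) & nrm (h * ev w) <= T0 * nrm (C 0).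
Proof.
move=> dh; have [w small] := reduce_into hC hD dh.
have c2 := nrm_ge2 (ht_det hC 0); have T2 := ds_T0 hD.
case: (boolP (odd (size w))) => ow; last first.
  exists w => //; apply: le_trans small _; nra.
exists (rcons w 0%N); first by rewrite size_rcons /= ow.
rewrite ev_rcons mulrA; apply: le_trans (nrm_mul _ _) _.
by rewrite ler_pM2r //; apply: lt_le_trans c2.
Qed.

(* The matrix moving [i] to the point [(x, y)], for [t] the square root of [y]. *)
Definition point_mx (x t : R) : 'M[R]_2 := mk2 t (x / t) 0 t^-1.

(** The upper half plane formula [2 cosh d(i, z) = (x^2 + y^2 + 1) / y] at the image point. *)
Lemma nrm_mobius (M : 'M[R]_2) x t : 0 < t -> \det M = 1 ->
  let z := mobius M (x, t ^+ 2) in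
  0 < z.2 /\ nrm (M * point_mx x t) * z.2 = z.1 ^+ 2 + z.2 ^+ 2 + 1.
Proof.
move=> t0 dM z; have := dM; rewrite det2E => e.
have tn : t != 0 by rewrite gt_eqF.
set p := M 0 0 in e; set q := M 0 1 in e; set r := M 1 0 in e; set s := M 1 1 in e.
pose D := (r * x + s) ^+ 2 + (r * t ^+ 2) ^+ 2.
have D0 : 0 < D.
  rewrite /D ltNge; apply/negP => le0.
  have s1 := sqr_ge0 (r * x + s); have s2 := sqr_ge0 (r * t ^+ 2).
  have /eqP : (r * t ^+ 2) ^+ 2 = 0 by lra.
  have /eqP : (r * x + s) ^+ 2 = 0 by lra.
  rewrite !sqrf_eq0 mulf_eq0 expf_eq0 (negbTE tn) andbF orbF => /eqP e1 /eqP e2.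
  by move: e e1; rewrite e2 mul0r add0r mulr0 => e /eqP; rewrite -/s => /eqP es; move: e; rewrite es; lra.
have Dn : D != 0 by rewrite gt_eqF.
have z2 : z.2 = t ^+ 2 / D by [].
have z1 : z.1 = ((p * x + q) * (r * x + s) + p * r * (t ^+ 2) ^+ 2) / D by [].
split; first by rewrite z2 divr_gt0 ?exprn_gt0.
have -> : nrm (M * point_mx x t) =
    ((p * x + q) ^+ 2 + (p * t ^+ 2) ^+ 2 + D) / t ^+ 2.
  by rewrite /nrm !mx2E -/p -/q -/r -/s /D; field.
rewrite z1 z2.
have key : ((p * x + q) ^+ 2 + (p * t ^+ 2) ^+ 2) * D =
    ((p * x + q) * (r * x + s) + p * r * (t ^+ 2) ^+ 2) ^+ 2 + (t ^+ 2) ^+ 2.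
  rewrite -[X in _ = _ + X]mulr1 -[1](expr1n _ 2) -e /D; ring.
set B := (p * x + q) * _ + _ in key *; set A := _ + (p * t ^+ 2) ^+ 2 in key *.
have -> : A = (B ^+ 2 + (t ^+ 2) ^+ 2) / D by rewrite -key mulfK.
by field; rewrite tn Dn.
Qed.

Lemma Gammabar_cocompact : exists c : R, 0 < c /\ forall z : R * R, 0 < z.2 ->
  exists M, Gammabar gens M /\ [/\ `|(mobius M z).1| <= c,
    c^-1 <= (mobius M z).2 & (mobius M z).2 <= c].
Proof.
set c := T0 * nrm (C 0); exists c.
have c2 := nrm_ge2 (ht_det hC 0); have T2 := ds_T0 hD.
have c1 : 1 < c by rewrite /c; nra.
have c0 : 0 < c by exact: lt_trans c1.
split=> // [[x y]]; rewrite [(x, y).2]/= => y0; pose t := Num.sqrt y.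
have t0 : 0 < t by rewrite sqrtr_gt0.
have ey : y = t ^+ 2 by rewrite sqr_sqrtr ?ltW.
have dN : \det (point_mx x t) = 1.
  by rewrite !mx2E mulr0 subr0 divff ?gt_eqF.
have [w ow small] := reduce_into_even (det1_inv dN).
exists (ev w)^-1; split; first exact/Gammabar_inv/Gammabar_even.
have dw := ev_det hC w.
have := nrm_mobius x t0 (det1_inv dw); rewrite -ey.
have <- : nrm ((point_mx x t)^-1 * ev w) = nrm ((ev w)^-1 * point_mx x t).
  by rewrite -[RHS]nrm_inv ?det2M ?det1_inv ?dN ?mulr1 // invrM ?unitrV ?unit_det1 ?invrK.
case: mobius => x' y' /= [y'0]; move: small; set n := nrm _ => small e.
have x2 := sqr_ge0 x'; have y2 := sqr_ge0 y'.
(* The inequality [x'^2 + y'^2 + 1 <= c y'] contains all three bounds of the box. *)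
have le_n : n * y' <= c * y' by rewrite ler_pM2r.
have le1 : y' <= c.
  rewrite -(ler_pM2r y'0) -expr2; lra.
have le2 : 1 <= y' * c by rewrite mulrC; lra.
have le3 : c * y' <= c ^+ 2 by rewrite expr2 ler_pM2l.
split; [|by rewrite -(ler_pM2r c0) mulVf ?gt_eqF|exact: le1].
rewrite -(@ler_pXn2r _ 2) ?nnegrE ?(ltW c0) // real_normK ?num_real //; lra.
Qed.

Theorem gens_hyperbolic : hyperbolic_structure gens.
Proof.
split.
- exact: gens_det.
- by left; exact: word_eval_relator.
- exact: word_eval_faithful.
- exact: Gammabar_discrete.
- exact: Gammabar_cocompact.
Qed.

(** The generators are spelled without [c_(2g+1)], the half-turn that is determined by closing up
    the others. *)
Lemma Gammabar_word M : Gammabar gens M ->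
  exists2 w, all (fun i => i <= g.*2)%N w & eqpm M (ev w).
Proof.
move=> [w eM]; exists (phi w); last exact: eqpm_trans (eM : eqpm _ _) (word_eval_phi w).
elim: w {eM} => // [[[i c] e]] w IH.
rewrite -[phi _]/(phi_letter (i, c, e) ++ phi w) all_cat IH andbT.
have li := ltn_ord i.
have hw : all (fun i => i <= g.*2)%N (hword i).
  by apply/allP => k; rewrite mem_iota => /andP[_ lk]; lia.
have gen : all (fun i => i <= g.*2)%N (phi_gen c i).
  rewrite /phi_gen; case: c; first by rewrite -cat1s all_cat hw andbT /=; lia.
  by rewrite all_rcons all_rev hw andbT; lia.
by rewrite /phi_letter; case: e => //=; rewrite all_rev.
Qed.

End Structure.

(** * The regular tessellation *)

Section Regular.
Variables (R : realType) (m : nat).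
Hypothesis m_ge6 : (6 <= m)%N.
Implicit Types (t : R) (g h : 'M[R]_2) (k l : nat).

Definition ral : R := pi / m%:R.
Local Notation al := ral.
Local Notation c := (cos al).
Local Notation s := (sin al).

Let m0 : (0 : R) < m%:R. Proof. by rewrite ltr0n; apply: leq_trans m_ge6. Qed.

Lemma ral_m : al * m%:R = pi. Proof. by rewrite divfK ?gt_eqF. Qed.

Lemma ral_gt0 : 0 < al. Proof. by rewrite divr_gt0 ?pi_gt0. Qed.

Lemma ral_lt : 4 * al < pi.
Proof.
rewrite -ral_m mulrC ltr_pM2l ?ral_gt0 // ltr_nat; exact: leq_trans m_ge6.
Qed.

Lemma csE : c ^+ 2 + s ^+ 2 = 1. Proof. exact: cos2Dsin2. Qed.

Lemma c_gt0 : 0 < c.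
Proof.
have a0 := ral_gt0; have a1 := ral_lt; apply: cos_gt0_pihalf; apply/andP; split; lra.
Qed.

Lemma s_gt0 : 0 < s.
Proof. have a0 := ral_gt0; have a1 := ral_lt; apply: sin_gt0_pi; apply/andP; split; lra. Qed.

Lemma cos2alE : cos (2 * al) = c ^+ 2 - s ^+ 2.
Proof. by rewrite mulr2n mulrDl mul1r cosD !expr2. Qed.

Lemma sin2alE : sin (2 * al) = 2 * s * c.
Proof. by rewrite mulr2n mulrDl mul1r sinD; ring. Qed.

Lemma cos2_gt0 : 0 < c ^+ 2 - s ^+ 2.
Proof.
rewrite -cos2alE; have a0 := ral_gt0; have a1 := ral_lt.
apply: cos_gt0_pihalf; apply/andP; split; lra.
Qed.

Lemma s_lt_c : s < c.
Proof.
have := cos2_gt0; rewrite subr_gt0 ltr_pXn2r ?nnegrE //; first exact/ltW/s_gt0.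
exact/ltW/c_gt0.
Qed.

(* [rq] is the hyperbolic cosine of the circumradius of the [m]-gon with all
   angles [2 pi / m]; [rmu] and [rnu] are the exponentials of plus and minus
   that radius. *)
Definition rq : R := c ^+ 2 / s ^+ 2.
Local Notation q := rq.
Definition rsg : R := Num.sqrt (q ^+ 2 - 1).
Local Notation sg := rsg.
Definition rmu : R := q + sg.
Definition rnu : R := q - sg.
Local Notation mu := rmu.
Local Notation nu := rnu.

Lemma qs : q * s ^+ 2 = c ^+ 2.
Proof. by rewrite divfK // expf_neq0 // gt_eqF ?s_gt0. Qed.

Lemma q_gt1 : 1 < q.
Proof.
rewrite ltr_pdivlMr ?exprn_gt0 ?s_gt0 // mul1r -subr_gt0; exact: cos2_gt0.
Qed.

Lemma s2q : s ^+ 2 * (q + 1) = 1. Proof. by have := csE; have := qs; lra. Qed.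
Lemma c2q : c ^+ 2 * (q + 1) = q. Proof. by rewrite -qs -mulrA s2q mulr1. Qed.

Lemma sgE : sg ^+ 2 = q ^+ 2 - 1.
Proof. by rewrite sqr_sqrtr //; have := q_gt1; nra. Qed.

Lemma sg_gt0 : 0 < sg.
Proof. by rewrite sqrtr_gt0; have := q_gt1; nra. Qed.

Lemma munu : mu * nu = 1.
Proof.
rewrite /rmu /rnu; transitivity (q ^+ 2 - sg ^+ 2); first ring.
by rewrite sgE; ring.
Qed.

(** [rot t] and [ell t] are rotations by the angle [2 t] in opposite senses, about the center [i]
    and about the vertex [i mu] of the polygon. *)
Definition rot t : 'M[R]_2 := mk2 (cos t) (- sin t) (sin t) (cos t).
Definition ell t : 'M[R]_2 := mk2 (cos t) (mu * sin t) (- nu * sin t) (cos t).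

Lemma rotD t u : rot (t + u) = rot t * rot u.
Proof. by apply: mx2P; rewrite !mx2E ?cosD ?sinD; ring. Qed.

Lemma ellD t u : ell (t + u) = ell t * ell u.
Proof.
have e := munu; apply: mx2P; rewrite !mx2E ?cosD ?sinD; try ring.
all: transitivity (cos t * cos u - mu * nu * (sin t * sin u)); last by ring.
all: by rewrite e; ring.
Qed.

Lemma rot0 : rot 0 = 1. Proof. by rewrite /rot sin0 cos0 oppr0 one2E. Qed.
Lemma ell0 : ell 0 = 1. Proof. by rewrite /ell sin0 cos0 !mulr0 one2E. Qed.
Lemma rotpi : rot pi = -1.
Proof. by apply: mx2P; rewrite !mx2E ?sinpi ?cospi ?oppr0. Qed.
Lemma ellpi : ell pi = -1.
Proof. by apply: mx2P; rewrite !mx2E ?sinpi ?cospi ?mulr0 ?oppr0. Qed.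

Lemma rot_det t : \det (rot t) = 1.
Proof. by rewrite !mx2E -(cos2Dsin2 t); ring. Qed.

Lemma ell_det t : \det (ell t) = 1.
Proof.
rewrite !mx2E; transitivity (cos t ^+ 2 + mu * nu * sin t ^+ 2); first by ring.
by rewrite munu mul1r cos2Dsin2.
Qed.

Lemma rotK t : rot t * rot (- t) = 1.
Proof. by rewrite -rotD subrr rot0. Qed.

Lemma rotVK t : rot (- t) * rot t = 1.
Proof. by rewrite -rotD addNr rot0. Qed.

Lemma nrm_rotr g t : nrm (g * rot t) = nrm g.
Proof.
rewrite /nrm !mx2E -[RHS]mulr1 -(cos2Dsin2 t); ring.
Qed.

Lemma nrm_rotl g t : nrm (rot t * g) = nrm g.
Proof. rewrite /nrm !mx2E -[RHS]mulr1 -(cos2Dsin2 t); ring. Qed.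

(** The right triangle formed by the center, a vertex and the midpoint of a side has angle [pi / m]
    at the first two; the product of the rotations by [2 pi / m] about these is the half-turn about
    the third. In this shape consecutive factors telescope around a vertex. *)
Definition reg k : 'M[R]_2 := rot (al *+ k) * ell al * rot (- (al *+ k.+1)).

Lemma reg_det k : \det (reg k) = 1.
Proof. by rewrite !det2M !rot_det ell_det !mulr1. Qed.

Lemma reg_tr k : \tr (reg k) = 0.
Proof.
rewrite /reg -mulrA tr2C -mulrA -rotD mulrSr opprD addrAC addNr add0r.
rewrite !mx2E sinN cosN (_ : _ + _ = 2 * (c ^+ 2 - q * s ^+ 2)).
  by rewrite qs subrr mulr0.
rewrite /rmu /rnu; ring.
Qed.

Lemma al_m : al *+ m = pi. Proof. by rewrite -mulr_natr ral_m. Qed.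

Lemma reg_per k : reg (k + m) = reg k.
Proof.
rewrite /reg -addSn !mulrnDr al_m opprD (rotD (al *+ k)) (rotD (- _)) rotpi.
have -> : rot (- pi) = -1 by apply: mx2P; rewrite !mx2E ?sinN ?cosN ?sinpi ?cospi ?oppr0.
by rewrite !mulrN !mulr1 !mulNr opprK.
Qed.

Lemma ev_reg k l :
  ev reg (iota k l) = rot (al *+ k) * ell (al *+ l) * rot (- (al *+ (k + l))).
Proof.
elim: l k => [|l IH] k; first by rewrite ev_nil mulr0n ell0 mulr1 addn0 rotK.
rewrite [iota _ _]/= ev_cons IH /reg -!mulrA (mulrA (rot (- _))) rotVK mul1r.
by rewrite (mulrA (ell al)) -ellD -mulrS addSnnS.
Qed.

Lemma reg_rel : ev reg (iota 0 m) = 1.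
Proof.
rewrite ev_reg add0n al_m mulr0n rot0 ellpi mul1r mulN1r.
by apply: mx2P; rewrite !mx2E ?sinN ?cosN ?sinpi ?cospi ?oppr0 ?opprK.
Qed.

Lemma reg_halfturns : halfturns reg m.
Proof.
split; [exact: leq_trans m_ge6|exact: reg_det|exact: reg_tr|exact: reg_per|].
exact: reg_rel.
Qed.

Lemma nrm_ev_reg g k l :
  nrm (g * ev reg (iota k l)) = nrm (g * rot (al *+ k) * ell (al *+ l)).
Proof. by rewrite ev_reg mulrA nrm_rotr mulrA. Qed.

Lemma nrm_reg_mul g k : nrm (g * reg k) = nrm (g * rot (al *+ k) * ell al).
Proof. by rewrite /reg mulrA nrm_rotr mulrA. Qed.

Lemma nrm_reg_pred g k :
  nrm (g * reg (k + m).-1) = nrm (g * rot (al *+ k) * ell (- al)).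
Proof.
have m1 : (m.-1.+1 = m)%N by rewrite prednK // (leq_trans _ m_ge6).
have e : ev reg (iota k m.-1) * reg (k + m).-1 = 1.
  rewrite -(ev_period reg_halfturns k) -ev_rcons; congr ev.
  rewrite -[in RHS]m1 -addn1 iotaD -cats1; congr (_ ++ [:: _]); lia.
have e2 : reg (k + m).-1 = - ev reg (iota k m.-1).
  have h2 : reg (k + m).-1 * reg (k + m).-1 = -1.
    by apply: sqr_pure; [exact: reg_det|exact: reg_tr].
  apply: (mulIr (unit_det1 (reg_det (k + m).-1))).
  by rewrite h2 mulNr e.
rewrite e2 mulrN nrmN nrm_ev_reg.
have -> : al *+ m.-1 = - al + pi.
  by apply: (addrI al); rewrite -mulrS m1 al_m addrA subrr add0r.
by rewrite ellD ellpi mulrN1 mulrN nrmN.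
Qed.

(** Here [l * al] stays [2 al] away from 0 and [pi]. These [l] are the places around a vertex other
    than a tile and its two neighbours there. *)
Lemma trig_mid l : (2 <= l <= m - 2)%N ->
  `|cos (al *+ l)| <= cos (2 * al) /\ sin (2 * al) <= sin (al *+ l).
Proof.
move=> /andP[l2 lm]; have a0 := ral_gt0; have a1 := ral_lt.
have hl : 2 * al <= al *+ l.
  by rewrite -(mulr_natr al l) mulrC ler_pM2l // ler_nat.
have hm : al *+ l <= pi - 2 * al.
  rewrite -al_m -(mulr_natr al l) -(mulr_natr al m) (mulrC 2) -mulrBr ler_pM2l //.
  by rewrite -(natrB _ (_ : 2 <= m)%N) ?ler_nat //; lia.
have p0 := @pi_gt0 R.
have i1 : 2 * al \in `[0, pi] by rewrite in_itv /=; lra.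
have i2 : al *+ l \in `[0, pi] by rewrite in_itv /=; lra.
have i3 : pi - 2 * al \in `[0, pi] by rewrite in_itv /=; lra.
have cl : cos (al *+ l) <= cos (2 * al).
  by rewrite leNgt ltr_cos // -leNgt.
have cu : - cos (2 * al) <= cos (al *+ l).
  have -> : - cos (2 * al) = cos (pi - 2 * al) by rewrite cosB cospi sinpi; ring.
  by rewrite leNgt ltr_cos // -leNgt.
have hc : `|cos (al *+ l)| <= cos (2 * al) by rewrite ler_norml cu cl.
split=> //.
have s1 : 0 <= sin (al *+ l) by apply: sin_ge0_pi; apply/andP; split; lra.
have s2 : 0 <= sin (2 * al) by apply: sin_ge0_pi; apply/andP; split; lra.
rewrite -(@ler_pXn2r _ 2) ?nnegrE // !sin2cos2 lerD2l lerN2.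
by rewrite -[leLHS]real_normK ?num_real // ler_pXn2r ?nnegrE // (le_trans _ hc).
Qed.

(** Halfway between [2 q], the value at the circumradius, and [4 q - 2], the norm of every
    [reg k]. *)
Definition rT0 : R := 3 * q - 1.
Local Notation T0 := rT0.

Lemma gram_det g :
  (g 0 0 ^+ 2 + g 1 0 ^+ 2) * (g 0 1 ^+ 2 + g 1 1 ^+ 2) -
  (g 0 0 * g 0 1 + g 1 0 * g 1 1) ^+ 2 = (\det g) ^+ 2.
Proof. by rewrite det2E; ring. Qed.

(* With [S = g^T g], the two components of the vector from the base point
   towards the vertex fixed by [ell], and across. *)
Definition vtx_along g := nu * (g 0 1 ^+ 2 + g 1 1 ^+ 2) - mu * (g 0 0 ^+ 2 + g 1 0 ^+ 2).
Definition vtx_across g := 2 * (g 0 0 * g 0 1 + g 1 0 * g 1 1).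

Lemma nrm_ell g t : nrm g - nrm (g * ell t) =
  2 * sg * sin t * (vtx_along g * sin t - vtx_across g * cos t).
Proof.
have e := munu; have sE : 2 * sg = mu - nu by rewrite /rmu /rnu; ring.
rewrite sE /vtx_along /vtx_across /nrm !mx2E.
set c2 := cos t; set s2 := sin t.
set a := g 0 0; set b := g 0 1; set x := g 1 0; set y := g 1 1.
have ecs : 1 - c2 ^+ 2 = s2 ^+ 2 * (mu * nu) by rewrite e mulr1 [RHS]sin2cos2.
transitivity ((a ^+ 2 + b ^+ 2 + x ^+ 2 + y ^+ 2) * (1 - c2 ^+ 2) -
  s2 ^+ 2 * (mu ^+ 2 * (a ^+ 2 + x ^+ 2) + nu ^+ 2 * (b ^+ 2 + y ^+ 2)) -
  2 * (a * b + x * y) * (mu - nu) * s2 * c2); first by ring.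
rewrite ecs; ring.
Qed.

(** This is [2 cosh] of the distance from the base point to the vertex [g (i mu)]. It completes
    [vtx_along] and [vtx_across] to a vector on a hyperboloid, and [vtx_radE] is the law of
    cosines. *)
Definition vtx_rad g := mu * (g 0 0 ^+ 2 + g 1 0 ^+ 2) + nu * (g 0 1 ^+ 2 + g 1 1 ^+ 2).

Lemma vtx_radE g : nrm g = q * vtx_rad g + sg * vtx_along g.
Proof.
rewrite /nrm /vtx_rad /vtx_along; transitivity
  ((g 0 0 ^+ 2 + g 1 0 ^+ 2) * (mu * nu) + (g 0 1 ^+ 2 + g 1 1 ^+ 2) * (mu * nu)).
  by rewrite munu; ring.
rewrite /rmu /rnu; ring.
Qed.

Lemma vtx_rad_sqr g : \det g = 1 ->
  vtx_rad g ^+ 2 = vtx_along g ^+ 2 + vtx_across g ^+ 2 + 4.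
Proof.
move=> dg; have e := gram_det g; rewrite dg expr1n in e.
transitivity (vtx_along g ^+ 2 + 4 * (mu * nu) *
  ((g 0 0 ^+ 2 + g 1 0 ^+ 2) * (g 0 1 ^+ 2 + g 1 1 ^+ 2))).
  by rewrite /vtx_rad /vtx_along; ring.
rewrite munu -[X in 4 * 1 * X](subrK ((g 0 0 * g 0 1 + g 1 0 * g 1 1) ^+ 2)) e.
by rewrite /vtx_across; ring.
Qed.

(** If [vtx_along] were small against [nrm g], the hypothesis would make [vtx_across] small too, and
    the hyperboloid equation would leave [nrm g] no room above [2 q], against [2 q < T0]. *)
Lemma vtx_along_large : exists2 ka : R, 0 < ka & forall g, \det g = 1 -> T0 <= nrm g ->
  `|vtx_across g| * c <= vtx_along g * s + ka * s / 2 * nrm g ->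
  ka * nrm g <= vtx_along g.
Proof.
have q1 := q_gt1; have sg0 := sg_gt0; have s0 := s_gt0; have sc := s_lt_c.
have T2 : 2 * q < T0 by rewrite /rT0; lra.
have T00 : 0 < T0 by lra.
pose r := 4 * q ^+ 2 / T0 ^+ 2.
have r1 : r < 1.
  by rewrite ltr_pdivrMr ?exprn_gt0 // mul1r; nra.
have r0 : 0 <= r by apply: divr_ge0; [nra | exact: sqr_ge0].
(* Chosen so that [ka K = 1 - r] contradicts [(1 - ka sg)^2 <= 5 q^2 ka^2 + r], the inequality
   reached at the end. *)
pose K := 2 * sg + 5 * q ^+ 2 + 1; have K1 : 1 < K by rewrite /K; nra.
have K0 : 0 < K by lra.
pose ka := (1 - r) / K; have ka0 : 0 < ka by rewrite divr_gt0 // subr_gt0.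
have kaK : ka * K = 1 - r by rewrite divfK // gt_eqF.
have ka1 : ka <= 1 by nra.
have kasg : ka * sg <= 1 by rewrite /K in kaK; nra.
exists ka => // g dg hT hY; rewrite leNgt; apply/negP.
set T := nrm g in hT hY *; set B := vtx_along g in hY *.
move=> hB; have T_gt0 : 0 < T by lra.
set Y := vtx_across g in hY; have Y0 := normr_ge0 Y.
have c0 := c_gt0.
have B1 : - (ka * T) <= B.
  suff : 0 <= B + ka * T by lra.
  have : 0 <= (B + ka * T / 2) * s by have := mulr_ge0 Y0 (ltW c0); lra.
  by rewrite pmulr_lge0 //; have := mulr_ge0 (ltW ka0) (ltW T_gt0); lra.
have B2 : B ^+ 2 <= ka ^+ 2 * T ^+ 2 by rewrite -exprMn; nra.
have Y1 : `|Y| <= 2 * (ka * T).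
  have kT := mulr_gt0 ka0 T_gt0.
  rewrite -(ler_pM2r c0); apply: (le_trans hY).
  have : B * s <= ka * T * s by rewrite ler_pM2r // ltW.
  have : ka * T * s <= ka * T * c by rewrite ler_pM2l // ltW.
  have := mulr_gt0 kT c0; lra.
have Y2 : Y ^+ 2 <= 4 * (ka ^+ 2 * T ^+ 2).
  by rewrite -[Y ^+ 2]real_normK ?num_real //; nra.
have U1 := vtx_radE g; have U2 := vtx_rad_sqr dg.
rewrite -/T -/B -/Y in U1 U2; set U := vtx_rad g in U1 U2.
have qU : (1 - ka * sg) * T <= q * U.
  have : sg * B <= sg * (ka * T) by rewrite ler_pM2l // ltW.
  lra.
have lo : 0 <= (1 - ka * sg) * T by rewrite mulr_ge0 ?subr_ge0 // ltW.
have qU2 : ((1 - ka * sg) * T) ^+ 2 <= (q * U) ^+ 2.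
  by rewrite ler_pXn2r ?nnegrE // (le_trans lo).
have rT : r * T0 ^+ 2 = 4 * q ^+ 2 by rewrite divfK // expf_neq0 // gt_eqF.
have four : 4 * q ^+ 2 <= r * T ^+ 2.
  by rewrite -rT ler_wpM2l // ler_pXn2r ?nnegrE // ltW.
have T2p : 0 < T ^+ 2 by rewrite exprn_gt0.
have up : (q * U) ^+ 2 <= (5 * q ^+ 2 * ka ^+ 2 + r) * T ^+ 2.
  rewrite exprMn U2; have q2 : 0 <= q ^+ 2 by rewrite sqr_ge0.
  have := ler_wpM2l q2 B2; have := ler_wpM2l q2 Y2; lra.
have := le_trans qU2 up; rewrite exprMn ler_pM2r //.
apply/negP; rewrite -ltNge; rewrite /K in kaK; nra.
Qed.

(** At [t = al] and [t = - al], [nrm_ell] turns the two hypotheses into a bound of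
    [|vtx_across| cos al] by [vtx_along sin al], up to slack. The gain at [l al] is then positive
    because [sin (2 al) cos al - cos (2 al) sin al = sin al]. *)
Lemma vertex_slack : exists e de : R, [/\ 0 < e, 0 < de & forall g l, \det g = 1 ->
  T0 <= nrm g -> nrm (g * ell al) <= (1 + e) * nrm g ->
  nrm (g * ell (- al)) <= (1 + e) * nrm g -> (2 <= l <= m - 2)%N ->
  nrm (g * ell (al *+ l)) <= (1 - 2 * de) * nrm g].
Proof.
have sg0 := sg_gt0; have s0 := s_gt0; have c0 := c_gt0.
have [ka ka0 hka] := vtx_along_large.
pose D := 2 * sg; have D0 : 0 < D by rewrite mulr_gt0.
have S0 : 0 < sin (2 * al) by rewrite sin2alE !mulr_gt0.
have C0 : 0 < cos (2 * al) by rewrite cos2alE cos2_gt0.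
exists (D * s * (ka * s / 2)), (D * sin (2 * al) * (ka * s / (4 * c))).
split; [by rewrite !(mulr_gt0, invr_gt0) | by rewrite !(mulr_gt0, invr_gt0) |].
move=> g l dg hT h1 h2 hl; have [cl sl] := trig_mid hl.
have := nrm_ell g al; have := nrm_ell g (- al); have := nrm_ell g (al *+ l).
have := hka g dg hT; move: hT h1 h2; rewrite -/D cosN sinN.
set T := nrm g; set B := vtx_along g; set Y := vtx_across g.
set F1 := nrm (g * ell al); set F2 := nrm (g * ell (- al)); set Fl := nrm _.
move=> hT h1 h2 hB el e2 e1.
have T0p : 0 < T by apply: lt_le_trans hT; have := q_gt1; rewrite /rT0; lra.
have Ds0 : 0 < D * s by rewrite mulr_gt0.
have y1 : Y * c <= B * s + ka * s / 2 * T.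
  rewrite -(ler_pM2l Ds0); lra.
have y2 : - Y * c <= B * s + ka * s / 2 * T.
  rewrite -(ler_pM2l Ds0); lra.
have y3 : `|Y| * c <= B * s + ka * s / 2 * T by case: (ger0P Y).
have {}hB := hB y3.
set be := al *+ l in cl sl el.
have sb : 0 < sin be by apply: lt_le_trans sl.
have kT : 0 < ka * T by rewrite mulr_gt0.
have t1 : B * sin (2 * al) <= B * sin be by rewrite ler_pM2l // (lt_le_trans kT).
have t2 : Y * cos be <= `|Y| * cos (2 * al).
  apply: le_trans (ler_norm _) _; rewrite normrM ler_wpM2l //.
have t3 : `|Y| * c * cos (2 * al) <= (B * s + ka * s / 2 * T) * cos (2 * al).
  by rewrite ler_pM2r.
have t4 : ka * T * s / 2 <= c * (B * sin be - Y * cos be).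
  have t5 : c * (B * sin (2 * al) - `|Y| * cos (2 * al)) <= c * (B * sin be - Y * cos be).
    by rewrite ler_pM2l //; lra.
  apply: le_trans t5.
  have key : sin (2 * al) * c - cos (2 * al) * s = s.
    rewrite sin2alE cos2alE; transitivity (s * (c ^+ 2 + s ^+ 2)); first by ring.
    by rewrite csE mulr1.
  have t6 : ka * T * s / 2 * cos (2 * al) <= ka * T * s / 2 * 1.
    by rewrite ler_pM2l ?cos_le1 // divr_gt0 // mulr_gt0.
  have t7 : ka * T * s <= B * s by rewrite ler_pM2r.
  have t8 : B * s = B * (sin (2 * al) * c - cos (2 * al) * s) by rewrite key.
  lra.
have t9 : D * sin (2 * al) * (ka * T * s / 2) <= D * sin be * (c * (B * sin be - Y * cos be)).
  have k1 : 0 < ka * T * s / 2 by rewrite !(mulr_gt0, invr_gt0).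
  apply: ler_pM => //; first by rewrite ltW ?mulr_gt0.
  - exact: ltW.
  - by rewrite ler_pM2l.
rewrite -(ler_pM2r c0).
have -> : (1 - 2 * (D * sin (2 * al) * (ka * s / (4 * c)))) * T * c
    = T * c - D * sin (2 * al) * (ka * T * s / 2).
  by field; rewrite gt_eqF.
have -> : Fl = T - D * sin be * (B * sin be - Y * cos be) by lra.
lra.
Qed.

End Regular.

(** * Norms of the neighbours of a tile as a function of direction *)

Section Regular2.
Variables (R : realType) (m : nat).
Hypothesis m_ge6 : (6 <= m)%N.
Implicit Types (t : R) (g h : 'M[R]_2) (k l : nat).
Local Notation al := (ral R m).
Local Notation c := (cos al).
Local Notation s := (sin al).
Local Notation q := (rq R m).
Local Notation sg := (rsg R m).
Local Notation mu := (rmu R m).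
Local Notation nu := (rnu R m).
Local Notation T0 := (rT0 R m).
Local Notation ell := (ell m).
Local Notation reg := (@reg R m).
Let q1 : 1 < q. Proof. exact: (q_gt1 R m_ge6). Qed.
Let s0 : 0 < s. Proof. exact: (s_gt0 R m_ge6). Qed.
Let c0 : 0 < c. Proof. exact: (c_gt0 R m_ge6). Qed.
Let sg0 : 0 < sg. Proof. exact: (sg_gt0 R m_ge6). Qed.
Let sgE : sg ^+ 2 = q ^+ 2 - 1. Proof. exact: (sgE R m_ge6). Qed.
Let s2q : s ^+ 2 * (q + 1) = 1. Proof. exact: (s2q R m_ge6). Qed.
Let c2q : c ^+ 2 * (q + 1) = q. Proof. exact: (c2q R m_ge6). Qed.
Let qs : q * s ^+ 2 = c ^+ 2. Proof. exact: (qs R m_ge6). Qed.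

(** [gramX] and [gramY] form the traceless part of [g^T g]; multiplying [g] by [rot t] turns this
    plane vector by the angle [2 t]. *)
Definition gramX g := g 0 0 ^+ 2 + g 1 0 ^+ 2 - (g 0 1 ^+ 2 + g 1 1 ^+ 2).
Definition gramY g := 2 * (g 0 0 * g 0 1 + g 1 0 * g 1 1).
Definition sideP g := 2 * sg * s * (q * s * gramX g + c * gramY g).
Definition sideQ g := 2 * sg * s * (q * s * gramY g - c * gramX g).

Lemma gramXY g : \det g = 1 -> gramX g ^+ 2 + gramY g ^+ 2 = nrm g ^+ 2 - 4.
Proof.
move=> dg; have := gram_det g; rewrite dg expr1n => e.
transitivity (nrm g ^+ 2 - 4 * ((g 0 0 ^+ 2 + g 1 0 ^+ 2) *
  (g 0 1 ^+ 2 + g 1 1 ^+ 2) - (g 0 0 * g 0 1 + g 1 0 * g 1 1) ^+ 2)).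
  by rewrite /gramX /gramY /nrm; ring.
by rewrite e mulr1.
Qed.

Lemma sidePQ g : \det g = 1 ->
  sideP g ^+ 2 + sideQ g ^+ 2 = 4 * q * (q - 1) * (nrm g ^+ 2 - 4).
Proof.
move=> /gramXY <-; rewrite /sideP /sideQ.
transitivity (4 * sg ^+ 2 * s ^+ 2 * (q ^+ 2 * s ^+ 2 + c ^+ 2) *
  (gramX g ^+ 2 + gramY g ^+ 2)); first by ring.
congr (_ * _); rewrite sgE -qs.
transitivity (4 * q * (q - 1) * (s ^+ 2 * (q + 1)) ^+ 2); first by ring.
by rewrite s2q expr1n mulr1.
Qed.

(** The law of cosines at the center of the tile: neighbouring centers are at distance of hyperbolic
    cosine [2 q - 1], and the amplitude in [sidePQ] is the product of the hyperbolic sines. *)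
Lemma nrm_side g t : nrm (g * rot t * ell al) =
  (2 * q - 1) * nrm g + sideP g * cos (t + t) + sideQ g * sin (t + t).
Proof.
have := nrm_ell m_ge6 (g * rot t) al; rewrite nrm_rotr => e.
have -> : nrm (g * rot t * ell al) = nrm g - (nrm g - nrm (g * rot t * ell al)) by ring.
rewrite {}e.
have -> : vtx_along m (g * rot t) = - sg * nrm g -
    q * (gramX g * cos (t + t) + gramY g * sin (t + t)).
  rewrite -(nrm_rotr g t) cosD sinD.
  transitivity (- sg * nrm (g * rot t) - q * gramX (g * rot t)).
    by rewrite /vtx_along /nrm /gramX /rmu /rnu; ring.
  by congr (_ - q * _); rewrite /gramX /gramY !mx2E; ring.
have -> : vtx_across (g * rot t) = - gramX g * sin (t + t) + gramY g * cos (t + t).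
  by rewrite cosD sinD /vtx_across /gramX /gramY !mx2E; ring.
rewrite /sideP /sideQ; set C := cos (t + t); set S := sin (t + t).
have -> : 2 * q - 1 = 1 + 2 * sg ^+ 2 * s ^+ 2.
  rewrite sgE; transitivity (1 + 2 * (q - 1) * (s ^+ 2 * (q + 1))); last by ring.
  by rewrite s2q; ring.
ring.
Qed.

Lemma cos2al_q : cos (2 * al) * (q + 1) = q - 1.
Proof. by rewrite (cos2alE R m) mulrBl c2q s2q. Qed.

(** Averaging the two inequalities leaves [cos (l al)] times a projection of (P, Q), and
    [|cos (l al)| <= (q - 1) / (q + 1)] makes this too small. The bound on [e] gives
    [(2 q - 2 - e)(q + 1) >= (q - 1)(2 q + 1)], and [(2 q + 1)^2] exceeds [4 q (q - 1)]. *)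
Lemma sides_disjoint g l e : 0 <= e -> e * (q + 1) <= q - 1 -> \det g = 1 ->
  (2 <= l <= m - 2)%N -> nrm (g * ell al) <= (1 + e) * nrm g ->
  nrm (g * rot (al *+ l) * ell al) <= (1 + e) * nrm g -> False.
Proof.
have q1' := q1; move=> e0 eq dg hl; have [cl _] := trig_mid R m_ge6 hl.
have := nrm_side g 0; rewrite rot0 mulr1 addr0 cos0 sin0 mulr0 addr0 mulr1 => ->.
rewrite nrm_side cosD sinD.
have PQ := sidePQ dg; have T2 := nrm_ge2 dg.
set T := nrm g in PQ T2 *; set P := sideP g in PQ *; set Q := sideQ g in PQ *.
set x := cos _ in cl *; set y := sin _ => h1 h2.
have xy : x ^+ 2 + y ^+ 2 = 1 by exact: cos2Dsin2.
have T0p : 0 < T by lra.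
have q10 : 0 < q + 1 by lra.
have a1 : (2 * q - 2 - e) * T <= - x * (P * x + Q * y).
  have -> : - x * (P * x + Q * y) =
    - (P + (P * (x * x - y * y) + Q * (x * y + y * x))) / 2 - P / 2 * (x ^+ 2 + y ^+ 2 - 1) by field.
  rewrite xy subrr mulr0 subr0; lra.
have a0 : 0 <= (2 * q - 2 - e) * T.
  rewrite mulr_ge0 ?(ltW T0p) //.
  have : 0 <= e * q by rewrite mulr_ge0 //; lra.
  lra.
have cs : (P * x + Q * y) ^+ 2 <= P ^+ 2 + Q ^+ 2.
  rewrite -[leRHS]mulr1 -xy -subr_ge0.
  by rewrite (_ : _ - _ = (P * y - Q * x) ^+ 2) ?sqr_ge0 //; ring.
have x2 : x ^+ 2 <= cos (2 * al) ^+ 2.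
  by rewrite -[x ^+ 2]real_normK ?num_real // ler_pXn2r ?nnegrE // (le_trans _ cl).
have a2 : ((2 * q - 2 - e) * T) ^+ 2 <= cos (2 * al) ^+ 2 * (4 * q * (q - 1) * T ^+ 2).
  apply: le_trans (_ : (- x * (P * x + Q * y)) ^+ 2 <= _).
    by rewrite ler_pXn2r ?nnegrE // (le_trans a0).
  rewrite exprMn sqrrN; apply: ler_pM; rewrite ?sqr_ge0 //.
  apply: le_trans cs _; rewrite PQ; apply: ler_wpM2l; [nra | lra].
have a3 : (2 * q - 2 - e) ^+ 2 * (q + 1) ^+ 2 <= 4 * q * (q - 1) ^+ 3.
  have Tp : 0 < T ^+ 2 by rewrite exprn_gt0.
  rewrite -(ler_pM2r Tp).
  have -> : 4 * q * (q - 1) ^+ 3 * T ^+ 2 =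
    (cos (2 * al) * (q + 1)) ^+ 2 * (4 * q * (q - 1) * T ^+ 2).
    by rewrite cos2al_q; ring.
  have := ler_wpM2r (sqr_ge0 (q + 1)) a2.
  rewrite !exprMn; set u := cos _ ^+ 2; lra.
have b1 : (q - 1) * (2 * q + 1) <= (2 * q - 2 - e) * (q + 1) by nra.
have b0 : 0 <= (q - 1) * (2 * q + 1) by nra.
have b2 : ((q - 1) * (2 * q + 1)) ^+ 2 <= ((2 * q - 2 - e) * (q + 1)) ^+ 2.
  by rewrite ler_pXn2r ?nnegrE // (le_trans b0).
have b3 : 4 * q * (q - 1) ^+ 3 < ((q - 1) * (2 * q + 1)) ^+ 2.
  rewrite exprMn -subr_gt0 (_ : _ - _ = (q - 1) ^+ 2 * (8 * q + 1)); last by ring.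
  by rewrite mulr_gt0 ?exprn_gt0 //; lra.
move: a3; rewrite -exprMn => a3.
by have := lt_le_trans b3 (le_trans b2 a3); rewrite ltxx.
Qed.

(** At the closest neighbour, comparison with the two adjacent sides puts the direction of the base
    point within [pi / m] of that side, so at least [cos al] of the amplitude is gained. With [2 q]
    in place of [T0] the inequality [r1] would be an equality. *)
Lemma side_reduces : exists2 de : R, 0 < de & forall g, \det g = 1 -> T0 <= nrm g ->
  exists k, nrm (g * reg k) <= (1 - 2 * de) * nrm g.
Proof.
have q1' := q1; have s0' := s0; have T1 : 1 < T0 by rewrite /rT0; lra.
pose r := 4 * q ^+ 2 * (q - 1) * (1 - 4 / T0 ^+ 2).
have r1 : (2 * q - 2) ^+ 2 * (q + 1) < r.
  have Tp : 0 < T0 ^+ 2 by rewrite exprn_gt0 //; lra.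
  rewrite -(ltr_pM2r Tp) /r -[ltRHS]mulrA mulrBl divfK ?gt_eqF // -subr_gt0.
  rewrite (_ : _ - _ = 4 * (q - 1) ^+ 2 * (5 * q - 1)); last by rewrite /rT0; ring.
  by rewrite !mulr_gt0 ?exprn_gt0 //; lra.
have q10 : 0 < q + 1 by lra.
pose de := (Num.sqrt (r / (q + 1)) - (2 * q - 2)) / 2.
have rq0 : (2 * q - 2) ^+ 2 < r / (q + 1) by rewrite ltr_pdivlMr.
have q20 : 0 <= 2 * q - 2 by lra.
have de0 : 0 < de.
  rewrite divr_gt0 // subr_gt0 -(@ltr_pXn2r _ 2) ?nnegrE ?sqrtr_ge0 //.
  by rewrite sqr_sqrtr // (le_trans _ (ltW rq0)) ?sqr_ge0.
exists de => // g dg hT.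
have m1 : (0 < m)%N by apply: leq_trans m_ge6.
pose a k := nrm (g * reg k).
case: (@Order.TotalTheory.arg_minP _ _ _ (Ordinal m1) predT (fun k : 'I_m => a k)) => //= k _ mink.
have mina j : a k <= a j.
  have := mink (Ordinal (ltn_pmod j m1)) isT; rewrite /a /=.
  by rewrite (C_mod (reg_halfturns R m_ge6) (i := (j %% m)%N) (j := j)) ?modn_mod.
(* Shifting by [m] gives the minimal side [n.+1] a predecessor. *)
pose n := (k + m).-1%N; have en : n.+1 = (k + m)%N by rewrite prednK // addn_gt0 m1 orbT.
have minn j : a n.+1 <= a j by rewrite en /a reg_per //; exact: mina.
exists n.+1; move: (minn n) (minn n.+2); rewrite /a !nrm_reg_mul.
rewrite (_ : al *+ n = al *+ n.+1 - al); last by rewrite mulrSr addrK.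
rewrite (_ : al *+ n.+2 = al *+ n.+1 + al); last by rewrite mulrSr.
rewrite !nrm_side; set t := al *+ n.+1.
rewrite (_ : t - al + (t - al) = t + t - 2 * al); last by ring.
rewrite (_ : t + al + (t + al) = t + t + 2 * al); last by ring.
rewrite cosB sinB (cosD _ (2 * al)) (sinD _ (2 * al)) (cos2alE R m) (sin2alE R m).
have PQ := sidePQ dg; set T := nrm g in PQ hT *.
set P := sideP g in PQ *; set Q := sideQ g in PQ *.
have xy := cos2Dsin2 (t + t); set x := cos (t + t) in xy *; set y := sin (t + t) in xy *.
pose A := - (P * x + Q * y); pose M := P * y - Q * x.
have AM : A ^+ 2 + M ^+ 2 = P ^+ 2 + Q ^+ 2.
  transitivity ((P ^+ 2 + Q ^+ 2) * (x ^+ 2 + y ^+ 2)); first by rewrite /A /M; ring.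
  by rewrite xy mulr1.
have cs : c ^+ 2 + s ^+ 2 = 1 := csE R m.
move=> h1 h2.
have k1 : 0 <= 2 * s * (A * s - M * c).
  have -> : 2 * s * (A * s - M * c) = A * (c ^+ 2 + s ^+ 2) - A * (c ^+ 2 - s ^+ 2) - M * (2 * s * c) by ring.
  by rewrite cs /A /M; lra.
have k2 : 0 <= 2 * s * (A * s + M * c).
  have -> : 2 * s * (A * s + M * c) = A * (c ^+ 2 + s ^+ 2) - A * (c ^+ 2 - s ^+ 2) + M * (2 * s * c) by ring.
  by rewrite cs /A /M; lra.
have ss0 : 0 < 2 * s by lra.
rewrite pmulr_rge0 // in k1; rewrite pmulr_rge0 // in k2.
have A0 : 0 <= A by rewrite -(pmulr_lge0 _ s0); lra.
have AM2 : c ^+ 2 * (P ^+ 2 + Q ^+ 2) <= A ^+ 2.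
  have -> : A ^+ 2 = c ^+ 2 * (A ^+ 2 + M ^+ 2) + ((A * s) ^+ 2 - (M * c) ^+ 2) +
    A ^+ 2 * (1 - (c ^+ 2 + s ^+ 2)) by ring.
  rewrite cs subrr mulr0 addr0 AM lerDl subr_sqr mulr_ge0 //; lra.
have T_gt0 : 0 < T by lra.
have T2 : T ^+ 2 * (1 - 4 / T0 ^+ 2) <= T ^+ 2 - 4.
  have Tp : 0 < T0 ^+ 2 by rewrite exprn_gt0 //; lra.
  rewrite mulrBr mulr1 lerD2l lerN2 mulrA ler_pdivlMr // mulrC ler_pM2r //.
  by rewrite ler_pXn2r ?nnegrE //; lra.
have A2 : ((2 * q - 2 + 2 * de) * T) ^+ 2 <= A ^+ 2.
  have -> : 2 * q - 2 + 2 * de = Num.sqrt (r / (q + 1)) by rewrite /de; field.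
  rewrite exprMn sqr_sqrtr; last exact: le_trans (sqr_ge0 _) (ltW rq0).
  apply: le_trans AM2; rewrite PQ.
  rewrite -(ler_pM2r q10) mulrAC divfK ?gt_eqF //.
  rewrite [leRHS](_ : _ = c ^+ 2 * (q + 1) * (4 * q * (q - 1) * (T ^+ 2 - 4))); last by ring.
  rewrite c2q /r.
  have k0 : 0 <= 4 * q ^+ 2 * (q - 1) by nra.
  have := ler_wpM2l k0 T2; lra.
have : (2 * q - 2 + 2 * de) * T <= A.
  by rewrite -(@ler_pXn2r _ 2) ?nnegrE // mulr_ge0 ?(ltW T_gt0) //; lra.
rewrite /A; lra.
Qed.

(* The slack [e] leaves room for perturbing the tessellation. *)
Theorem regular_slack : exists e de : R, [/\ 0 < e, 0 < de < 1,
  forall g, \det g = 1 -> T0 <= nrm g -> exists i, nrm (g * reg i) <= (1 - 2 * de) * nrm g,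
  forall g i j, \det g = 1 -> T0 <= nrm g ->
    nrm (g * reg i) <= (1 + e) * nrm g -> nrm (g * reg j) <= (1 + e) * nrm g ->
    [\/ i = j %[mod m], i = j.+1 %[mod m] | j = i.+1 %[mod m]] &
  forall g k l, \det g = 1 -> T0 <= nrm g -> nrm (g * reg k) <= (1 + e) * nrm g ->
    nrm (g * reg (k + m).-1) <= (1 + e) * nrm g ->
    (2 <= l <= m - 2)%N -> nrm (g * ev reg (iota k l)) <= (1 - 2 * de) * nrm g].
Proof.
have mid n : (0 < n)%N -> n != 1%N -> n != m.-1 -> (n < m)%N -> (2 <= n <= m - 2)%N.
  by move: m_ge6; lia.
have q1' := q1; have [d1 d10 hd1] := side_reduces.
have [e1 [d2 [e10 d20 hd2]]] := vertex_slack R m_ge6.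
have qq : 0 < (q - 1) / (q + 1) by rewrite divr_gt0; lra.
pose e := Num.min e1 ((q - 1) / (q + 1)).
pose de := Num.min (Num.min d1 d2) (1 / 2).
have e0 : 0 < e by rewrite lt_min e10.
have [ee1 eeq] : e <= e1 /\ e <= (q - 1) / (q + 1).
  by rewrite /e; split; rewrite ge_min lexx ?orbT.
have q10 : 0 < q + 1 by lra.
have eqq : e * (q + 1) <= q - 1 by rewrite -ler_pdivlMr.
have de0 : 0 < de by rewrite !lt_min d10 d20 /=; lra.
have dd1 : de <= d1 by rewrite /de !ge_min lexx.
have dd2 : de <= d2 by rewrite /de !ge_min lexx !orbT.
have dd3 : de <= 1 / 2 by rewrite /de ge_min lexx orbT.
have nrm0 g : 0 <= nrm g by rewrite /nrm !addr_ge0 ?sqr_ge0.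
have det_rot g t : \det g = 1 -> \det (g * rot t) = 1.
  by move=> dg; rewrite det2M dg rot_det mulr1.
have weak g d' x : de <= d' -> x <= (1 - 2 * d') * nrm g -> x <= (1 - 2 * de) * nrm g.
  move=> le_d h; apply: le_trans h _; apply: ler_wpM2r => //; lra.
exists e, de; split=> //; first by rewrite de0 /=; lra.
- move=> g dg hT; have [i hi] := hd1 g dg hT; exists i; exact: weak hi.
(* [l] is [j - i] modulo [m]. The values 0, 1 and [m - 1] are the three conclusions; any other is
   excluded after rotating side [i] to position 0. *)
- move=> g i j dg hT hi hj; pose l := ((j + (m - i %% m)) %% m)%N.
  have m1 : (0 < m)%N by apply: leq_trans m_ge6.
  have jl : (j = i + l %[mod m])%N.
    by rewrite /l modnDmr -modnDml addnCA subnKC ?modnDr // ltnW // ltn_pmod.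
  have lm : (l < m)%N by rewrite ltn_pmod.
  have [l0|l0] := posnP l; first by apply: Or31; rewrite jl l0 addn0.
  have [l1|l1] := eqVneq l 1%N; first by apply: Or33; rewrite jl l1 addn1.
  have [l2|l2] := eqVneq l m.-1.
    apply: Or32; rewrite -addn1 -modnDml jl modnDml l2 -addnA addn1 prednK //.
    by rewrite modnDr.
  exfalso; move: hi hj; rewrite (C_mod (reg_halfturns R m_ge6) jl) !nrm_reg_mul.
  rewrite mulrnDr rotD mulrA -(nrm_rotr g (al *+ i)).
  apply: (@sides_disjoint (g * rot (al *+ i)) l e (ltW e0)).
  - exact: eqq.
  - exact: det_rot.
  - exact: mid.
- move=> g k l dg hT hk hp hl; rewrite (nrm_ev_reg m_ge6).
  move: hT hk hp; rewrite nrm_reg_mul (nrm_reg_pred m_ge6) -(nrm_rotr g (al *+ k)).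
  move=> hT hk hp; apply: (weak _ _ _ dd2); apply: hd2; rewrite ?det_rot //.
    by apply: le_trans hk _; rewrite ler_wpM2r //; lra.
  by apply: le_trans hp _; rewrite ler_wpM2r //; lra.
Qed.
End Regular2.

(** * Stability of the descent under perturbation *)

Section Stability.
Variables (R : realType) (m : nat).
Hypothesis m_ge6 : (6 <= m)%N.
Implicit Types (A B g : 'M[R]_2) (k l : nat).
Local Notation reg := (@reg R m).
Local Notation q := (rq R m).

Definition close (e : R) A B := forall i j, `|A i j - B i j| <= e.
Definition entries_le (N : R) A := forall i j, `|A i j| <= N.

Lemma close_entries e N A B : entries_le N B -> close e A B -> entries_le (N + e) A.
Proof.
move=> hB hAB i j; rewrite -[A i j](subrK (B i j)) addrC.
by apply: le_trans (ler_normD _ _) _; apply: lerD.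
Qed.

Lemma close_mul e e' N A A' B B' : entries_le N A' -> entries_le N B ->
  close e A A' -> close e' B B' -> close (2 * N * (e + e')) (A * B) (A' * B').
Proof.
move=> hA hB hAA hBB i j; rewrite !mul2E.
have one (k : 'I_2) : `|A i k * B k j - A' i k * B' k j| <= N * (e + e').
  have -> : A i k * B k j - A' i k * B' k j =
    (A i k - A' i k) * B k j + A' i k * (B k j - B' k j) by ring.
  apply: le_trans (ler_normD _ _) _; rewrite !normrM mulrDr (mulrC N e).
  by apply: lerD; apply: ler_pM.
have -> : A i 0 * B 0 j + A i 1 * B 1 j - (A' i 0 * B' 0 j + A' i 1 * B' 1 j) =
  (A i 0 * B 0 j - A' i 0 * B' 0 j) + (A i 1 * B 1 j - A' i 1 * B' 1 j) by ring.
apply: le_trans (ler_normD _ _) _.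
have := one 0; have := one 1; lra.
Qed.

(** The error is proportional to [nrm g], so the multiplicative slack absorbs it for all [g] at
    once. *)
Lemma nrm_close e N A B g : 0 <= e -> e <= 1 -> 0 <= N -> entries_le N B ->
  close e A B -> `|nrm (g * A) - nrm (g * B)| <= 4 * e * (2 * N + 1) * nrm g.
Proof.
move=> e0 e1 N0 hB hAB.
have one (x y a b a' b' : R) : `|a| <= N -> `|b| <= N -> `|a' - a| <= e -> `|b' - b| <= e ->
    `|(x * a' + y * b') ^+ 2 - (x * a + y * b) ^+ 2| <= 2 * e * (2 * N + 1) * (x ^+ 2 + y ^+ 2).
  move=> ha hb haa hbb; set S := `|x| + `|y|.
  have S0 : 0 <= S by rewrite addr_ge0.
  have S2 : S ^+ 2 <= 2 * (x ^+ 2 + y ^+ 2).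
    rewrite -(real_normK (num_real x)) -(real_normK (num_real y)) /S -subr_ge0.
    by rewrite (_ : _ - _ = (`|x| - `|y|) ^+ 2) ?sqr_ge0 //; ring.
  have d1 : `|(x * a' + y * b') - (x * a + y * b)| <= e * S.
    have -> : (x * a' + y * b') - (x * a + y * b) = x * (a' - a) + y * (b' - b) by ring.
    apply: le_trans (ler_normD _ _) _; rewrite !normrM /S mulrDr !(mulrC e).
    by apply: lerD; apply: ler_wpM2l.
  have bound (z w : R) : `|z| <= N -> `|w - z| <= e -> `|w + z| <= 2 * N + 1.
    move=> hz hw; have -> : w + z = (w - z) + z + z by ring.
    apply: le_trans (ler_normD _ _) _; have := ler_normD (w - z) z; lra.
  have d2 : `|(x * a' + y * b') + (x * a + y * b)| <= (2 * N + 1) * S.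
    have -> : (x * a' + y * b') + (x * a + y * b) = x * (a' + a) + y * (b' + b) by ring.
    apply: le_trans (ler_normD _ _) _; rewrite !normrM /S mulrDr !(mulrC (2 * N + 1)).
    by apply: lerD; apply: ler_wpM2l => //; exact: bound.
  rewrite subr_sqr normrM.
  apply: le_trans (ler_pM (normr_ge0 _) (normr_ge0 _) d1 d2) _.
  have k0 : 0 <= e * (2 * N + 1) by rewrite mulr_ge0 //; lra.
  have := ler_wpM2l k0 S2; lra.
have o00 := one (g 0 0) (g 0 1) _ _ _ _ (hB 0 0) (hB 1 0) (hAB 0 0) (hAB 1 0).
have o01 := one (g 0 0) (g 0 1) _ _ _ _ (hB 0 1) (hB 1 1) (hAB 0 1) (hAB 1 1).
have o10 := one (g 1 0) (g 1 1) _ _ _ _ (hB 0 0) (hB 1 0) (hAB 0 0) (hAB 1 0).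
have o11 := one (g 1 0) (g 1 1) _ _ _ _ (hB 0 1) (hB 1 1) (hAB 0 1) (hAB 1 1).
rewrite /nrm !mul2E; move: o00 o01 o10 o11; rewrite !ler_norml.
move=> /andP[? ?] /andP[? ?] /andP[? ?] /andP[? ?]; apply/andP; split; lra.
Qed.

(** Rotations about the base point do not change the norm, so products around a vertex are bounded
    through the entries of [ell] alone. *)
Definition regN : R := 2 + (rmu R m) ^+ 2 + (rnu R m) ^+ 2.

Lemma regN_ge2 : 2 <= regN.
Proof. by rewrite /regN; have := sqr_ge0 (rmu R m); have := sqr_ge0 (rnu R m); lra. Qed.

Lemma entries_reg k l : entries_le regN (ev reg (iota k l)).
Proof.
have N2 := regN_ge2.
have : nrm (ev reg (iota k l)) <= regN.
  rewrite (ev_reg R m_ge6) nrm_rotr nrm_rotl /nrm /ell !mk2E /regN.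
  set t := ral R m *+ l; have ct : cos t ^+ 2 = 1 - sin t ^+ 2 by exact: cos2sin2.
  have s0 := sqr_ge0 (sin t); have c0 := sqr_ge0 (cos t).
  have h1 : sin t ^+ 2 <= 1 by lra.
  have h2 := ler_wpM2l (sqr_ge0 (rmu R m)) h1.
  have h3 := ler_wpM2l (sqr_ge0 (rnu R m)) h1.
  rewrite !exprMn sqrrN; lra.
set M := ev _ _; rewrite /nrm => hM.
have h00 := sqr_ge0 (M 0 0); have h01 := sqr_ge0 (M 0 1).
have h10 := sqr_ge0 (M 1 0); have h11 := sqr_ge0 (M 1 1).
have fin (x : R) : x ^+ 2 <= regN -> `|x| <= regN.
  move=> hx; have N0 : 0 <= regN by lra.
  rewrite -(@ler_pXn2r _ 2) ?nnegrE // real_normK ?num_real //.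
  by apply: le_trans hx _; rewrite expr2 ler_peMl //; lra.
by do 2!apply: forall_ord2; apply: fin; lra.
Qed.

Lemma close_ev e n : 0 < e -> exists2 eta : R, 0 < eta & forall C : nat -> 'M[R]_2,
  (forall k, close eta (C k) (reg k)) ->
  forall k l, (l <= n)%N -> close e (ev C (iota k l)) (ev reg (iota k l)).
Proof.
have N2 := regN_ge2.
elim: n e => [|n IH] e e0.
  exists 1 => // C _ k [|l] // _ i j; rewrite !ev_nil subrr normr0; exact: ltW.
pose N := regN + 1; pose e1 := Num.min (Num.min 1 e) (e / (4 * N)).
have N0 : 0 < N by rewrite /N; lra.
have e10 : 0 < e1 by rewrite !lt_min ltr01 e0 /= divr_gt0 // mulr_gt0.
have [h1 h2 h3] : [/\ e1 <= 1, e1 <= e & e1 <= e / (4 * N)].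
  by rewrite /e1; split; rewrite !ge_min lexx ?orbT.
have [eta eta0 heta] := IH e1 e10.
exists (Num.min eta e1); first by rewrite lt_min eta0.
move=> C hC k l le_l.
have hC1 i : close eta (C i) (reg i).
  by move=> a b; apply: le_trans (hC i a b) _; rewrite ge_min lexx.
have hC2 i : close e1 (C i) (reg i).
  by move=> a b; apply: le_trans (hC i a b) _; rewrite ge_min lexx orbT.
have [le_ln|] := leqP l n.
  by move=> i j; apply: le_trans h2; exact: heta.
case: l le_l => // l le_l _; rewrite [iota _ _]/= !ev_cons.
have hB := heta C hC1 k.+1 l le_l.
have hB' : entries_le N (ev C (iota k.+1 l)).
  move=> i j; apply: le_trans (close_entries (@entries_reg k.+1 l) hB i j) _.
  by rewrite /N lerD2l.
have hA' : entries_le N (reg k).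
  move=> i j; have := @entries_reg k 1 i j; rewrite ev_cons ev_nil mulr1 => h.
  by apply: le_trans h _; rewrite /N; lra.
move=> i j; apply: le_trans (close_mul hA' hB' (hC2 k) hB i j) _.
have : e1 * (4 * N) <= e by rewrite -ler_pdivlMr // mulr_gt0.
lra.
Qed.

Lemma nrm_reg k : nrm (reg k) = 4 * q - 2.
Proof.
rewrite /reg nrm_rotr nrm_rotl -[ell m _]mul1r -(mulr1 1) -{2}rot0.
rewrite (nrm_side m_ge6) nrm1 /sideP /sideQ.
have -> : gramX (1 : 'M[R]_2) = 0 by rewrite /gramX !mx2E; ring.
have -> : gramY (1 : 'M[R]_2) = 0 by rewrite /gramY !mx2E; ring.
by rewrite !mulr0 subr0 !(addr0, mulr0, mul0r); ring.
Qed.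

Theorem regular_stable : exists d eta : R, 0 < eta /\ forall C : nat -> 'M[R]_2,
  (forall k, close eta (C k) (reg k)) -> descent C m (rT0 R m) d.
Proof.
have q1 := q_gt1 R m_ge6; have N2 := regN_ge2.
have [e [d [e0 /andP[d0 d1] red adj vtx]]] := regular_slack R m_ge6.
(* [(q - 1) / 3] keeps [4 q - 2 - 2 ka] above the threshold [3 q - 1]; the other two bounds let the
   error be absorbed by [e] and by one of the two copies of [d]. *)
exists d; pose ka := Num.min (Num.min e d) ((q - 1) / 3).
have ka0 : 0 < ka by rewrite !lt_min e0 d0 /=; lra.
have [k1 k2 k3] : [/\ ka <= e, ka <= d & ka <= (q - 1) / 3].
  by rewrite /ka; split; rewrite !ge_min lexx ?orbT.
pose L := 4 * (2 * regN + 1); have L0 : 0 < L by rewrite /L; lra.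
pose e1 := Num.min 1 (ka / L).
have e10 : 0 < e1 by rewrite lt_min ltr01 divr_gt0.
have [h1 h2] : e1 <= 1 /\ e1 <= ka / L by rewrite /e1; split; rewrite !ge_min lexx ?orbT.
have [eta eta0 heta] := close_ev m e10.
exists eta; split=> // C hC.
have nrm0 g : 0 <= nrm g by rewrite /nrm !addr_ge0 ?sqr_ge0.
have near g k l : (l <= m)%N ->
    `|nrm (g * ev C (iota k l)) - nrm (g * ev reg (iota k l))| <= ka * nrm g.
  move=> le_l; have N0 : 0 <= regN by lra.
  apply: le_trans (nrm_close g (ltW e10) h1 N0 (@entries_reg k l) (heta C hC k l le_l)) _.
  apply: ler_wpM2r => //.
  have : e1 * L <= ka by rewrite -ler_pdivlMr.
  rewrite /L; lra.
have near1 g k : `|nrm (g * C k) - nrm (g * reg k)| <= ka * nrm g.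
  by have := near g k 1%N; rewrite !ev_cons !ev_nil !mulr1; apply; apply: leq_trans m_ge6.
have scale x y g : x <= y -> x * nrm g <= y * nrm g by move=> ?; apply: ler_wpM2r.
split.
- by rewrite /rT0; lra.
- exact: d0.
- exact: d1.
- move=> k; have := near1 1 k; rewrite !mul1r nrm1 nrm_reg ler_norml => /andP[lo _].
  by rewrite /rT0; lra.
- move=> g dg hT; have [k hk] := red g dg hT; exists k.
  have := near1 g k; rewrite ler_norml => /andP[_ up].
  have := scale _ _ g k2; lra.
- move=> g i j dg hT hi hj; apply: (adj g) => //.
    have := near1 g i; rewrite ler_norml => /andP[lo _].
    have := scale _ _ g k1; lra.
  have := near1 g j; rewrite ler_norml => /andP[lo _].
  have := scale _ _ g k1; lra.
- move=> g k l dg hT hk hp hl.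
  have lm : (l <= m)%N by case/andP: hl => _ lm; apply: leq_trans lm (leq_subr _ _).
  have := near g k l lm; rewrite ler_norml => /andP[_ up].
  have v : nrm (g * ev reg (iota k l)) <= (1 - 2 * d) * nrm g.
    apply: vtx => //.
      have := near1 g k; rewrite ler_norml => /andP[lo _].
      have := scale _ _ g k1; lra.
    have := near1 g (k + m).-1; rewrite ler_norml => /andP[lo _].
    have := scale _ _ g k1; lra.
  have := scale _ _ g k2; lra.
Qed.

End Stability.

(** * Number fields *)

Section NumberField.
Variable R : realType.
Implicit Types (F K : R -> Prop) (x y z : R).

Section Subfield.
Variable F : R -> Prop.
Hypothesis hF : is_subfield F.
Lemma sub0 : F 0. Proof. by case: hF. Qed.
Lemma sub1 : F 1. Proof. by case: hF => _ []. Qed.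
Lemma subD x y : F x -> F y -> F (x + y). Proof. by case: hF => _ [_ [h _]]; exact: h. Qed.
Lemma subN x : F x -> F (- x). Proof. by case: hF => _ [_ [_ [h _]]]; exact: h. Qed.
Lemma subM x y : F x -> F y -> F (x * y).
Proof. by case: hF => _ [_ [_ [_ [h _]]]]; exact: h. Qed.
Lemma subV x : F x -> F x^-1.
Proof.
have [->|x0] := eqVneq x 0; first by rewrite invr0.
by case: hF => _ [_ [_ [_ [_ h]]]] /h; apply.
Qed.
Lemma subB x y : F x -> F y -> F (x - y). Proof. by move=> ? ?; apply/subD/subN. Qed.
Lemma sub_div x y : F x -> F y -> F (x / y). Proof. by move=> ? ?; apply/subM/subV. Qed.
Lemma sub_nat n : F n%:R.
Proof. by elim: n => [|n IH]; [exact: sub0 | rewrite mulrSr; apply: subD IH sub1]. Qed.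
Lemma subX x n : F x -> F (x ^+ n).
Proof. by move=> Fx; elim: n => [|n IH]; [exact: sub1 | rewrite exprS; exact: subM]. Qed.
Lemma sub_int n : F n%:~R.
Proof. by case: n => n; [exact: sub_nat | rewrite NegzE mulrNz; apply/subN/sub_nat]. Qed.
Lemma sub_rat q : F (ratr q). Proof. apply: sub_div; exact: sub_int. Qed.
Lemma sub_sum n (f : 'I_n -> R) : (forall i, F (f i)) -> F (\sum_(i < n) f i).
Proof. by move=> h; elim/big_ind: _ => //; [exact: sub0 | exact: subD]. Qed.
Lemma sub_poly x (p : {poly rat}) : F x -> F (map_poly ratr p).[x].
Proof.
move=> Fx; rewrite horner_poly; apply: sub_sum => i.
by apply: subM; [exact: sub_rat | exact: subX].
Qed.
End Subfield.

(** The first [n + 1] powers of [x] have rational coordinates on [n] spanning elements, so a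
    rational combination of them vanishes. *)
Lemma number_field_algebraic K x : real_number_field K -> K x ->
  exists2 p : {poly rat}, p != 0 & root (map_poly ratr p) x.
Proof.
move=> [hK [n [e [_ he]]]] Kx.
have hx (i : 'I_n.+1) : exists u : 'I_n -> rat, x ^+ i = \sum_(j < n) ratr (u j) * e j.
  by apply: he; exact: subX.
have [q hq] := fin_all_exists hx.
pose M := \matrix_(i < n.+1, j < n) q i j.
have : kermx M != 0.
  rewrite kermx_eq0 /row_free neq_ltn; apply/orP; left.
  by rewrite ltnS rank_leq_col.
case/rowV0Pn => v /sub_kermxP vM v0.
exists (rVpoly v); first by apply: contraNneq v0 => e0; rewrite -[v]rVpolyK e0 linear0.
apply/eqP; rewrite (horner_coef_wide _ (n := n.+1)); last first.
  by rewrite size_map_poly size_poly.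
transitivity (\sum_(i < n.+1) \sum_(j < n) ratr (v 0 i * M i j) * e j).
  apply: eq_bigr => i _; rewrite coef_map coef_rVpoly_ord hq mulr_sumr.
  by apply: eq_bigr => j _; rewrite mxE rmorphM mulrA.
rewrite exchange_big big1 // => j _; rewrite -mulr_suml -rmorph_sum.
have /matrixP/(_ 0 j) := vM; rewrite !mxE => ->.
by rewrite rmorph0 mul0r.
Qed.

Definition gen_by z x := exists p : {poly rat}, x = (map_poly ratr p).[z].

Lemma gen_by_trans z y x : gen_by z y -> gen_by y x -> gen_by z x.
Proof.
move=> [p ->] [r ->]; exists (r \Po p).
by rewrite map_comp_poly horner_comp.
Qed.

Lemma primitive2 K x y : real_number_field K -> K x -> K y ->
  exists n : nat, gen_by (y *+ n - x) x /\ gen_by (y *+ n - x) y.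
Proof.
move=> hK Kx Ky.
have [p p0 px] := number_field_algebraic hK Kx.
have [r r0 ry] := number_field_algebraic hK Ky.
have [n [[u hu] [v hv]]] := pchar0_PET p0 px r0 ry (@Num.Theory.pchar_num _).
by exists n; split; [exists u | exists v].
Qed.

Lemma sub_gen_by F z x : is_subfield F -> F z -> gen_by z x -> F x.
Proof. by move=> hF Fz [p ->]; exact: sub_poly. Qed.

Lemma primitive_seq K (s : seq R) : real_number_field K -> (forall x, x \in s -> K x) ->
  exists2 z, K z & forall x, x \in s -> gen_by z x.
Proof.
move=> hK; elim: s => [|x s IH] hs; first by exists 0 => //; exact: sub0 hK.1.
have [z Kz hz] : exists2 z, K z & forall x, x \in s -> gen_by z x.
  by apply: IH => y ys; apply: hs; rewrite inE ys orbT.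
have Kx : K x by apply: hs; exact: mem_head.
have [n [gx gz]] := primitive2 hK Kx Kz.
exists (z *+ n - x).
  by rewrite -mulr_natr; apply: subB Kx; [exact: hK.1|apply: subM (sub_nat _ _) => //; exact: hK.1].
move=> y; rewrite inE => /predU1P[->//|ys]; exact: gen_by_trans gz (hz y ys).
Qed.

(* Completing the square turns the primitive element [theta n - theta^2] of
   [Q(theta)] into the square of [theta - n / 2], up to a rational. *)
Theorem square_generator K : real_number_field K -> exists th : R, [/\ K th, th != 0 &
  forall F, is_subfield F -> F (th ^+ 2) -> forall x, K x -> F x].
Proof.
move=> hK; have [hK1 [n [e [Ke he]]]] := hK.
have [z Kz hz] : exists2 z, K z & forall i, gen_by z (e i).
  have [|z Kz hz] := @primitive_seq K [seq e i | i <- enum 'I_n] hK.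
    by move=> _ /mapP[i _ ->].
  by exists z => // i; apply: hz; apply/map_f/mem_enum.
have gen F : is_subfield F -> F z -> forall x, K x -> F x.
  move=> hF Fz x /he[q ->]; apply: sub_sum => // i.
  apply: (subM hF); first exact: sub_rat.
  exact: sub_gen_by (hz i).
have [k [_ gz]] := primitive2 hK (subX hK1 2 Kz) Kz.
pose th := z - k%:R / 2.
have half F : is_subfield F -> F (k%:R / 2).
  by move=> hF; apply: sub_div => //; exact: sub_nat.
have genth F : is_subfield F -> F (th ^+ 2) -> forall x, K x -> F x.
  move=> hF Fth; apply: gen => //; apply: sub_gen_by gz => //.
  have -> : z *+ k - z ^+ 2 = (k%:R / 2) ^+ 2 - th ^+ 2.
    by rewrite /th -mulr_natr; field.
  by apply: subB => //; apply: subX => //; exact: half.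
have [th0|th0] := eqVneq th 0; last first.
  by exists th; split=> //; apply: subB => //; exact: half.
(* If [th] is zero, every subfield contains K, so 1 serves as well. *)
exists 1; split; [exact: sub1 | exact: oner_neq0 | move=> F hF _].
by apply: genth => //; rewrite th0 expr0n; exact: sub0.
Qed.

End NumberField.

(** * Quaternion algebras in [M_2(R)] *)

Section Quaternion.
Variable R : realType.
Implicit Types (X Y Z I J : 'M[R]_2) (K : R -> Prop) (a b c x y : R).

Lemma scalar2Z a : a%:M = a *: (1 : 'M[R]_2).
Proof. by apply: mx2P; rewrite !mx2E; ring. Qed.

Lemma trD2 X Y : \tr (X + Y) = \tr X + \tr Y. Proof. exact: mxtraceD. Qed.
Lemma trZ2 a X : \tr (a *: X) = a * \tr X. Proof. exact: mxtraceZ. Qed.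
Lemma tr1_2 : \tr (1 : 'M[R]_2) = 2. Proof. by rewrite !mx2E. Qed.

Lemma pure_anticomm X Y : \tr X = 0 -> \tr Y = 0 -> X * Y + Y * X = \tr (X * Y) *: 1.
Proof.
rewrite !tr2E => tX tY.
have eX : X 1 1 = - X 0 0 by apply/eqP; rewrite -addr_eq0 addrC tX.
have eY : Y 1 1 = - Y 0 0 by apply/eqP; rewrite -addr_eq0 addrC tY.
by apply: mx2P; rewrite !mx2E ?eX ?eY; ring.
Qed.

Lemma pure_sqr X : \tr X = 0 -> X * X = (- \det X) *: 1.
Proof. by move=> tX; rewrite cayley2 tX scale0r sub0r scalar2Z scaleNr. Qed.

Definition quat I J c0 c1 c2 c3 : 'M[R]_2 :=
  c0 *: 1 + c1 *: I + c2 *: J + c3 *: (I * J).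

Record quat_pair a b I J : Prop := QuatPair {
  qp_a : a != 0;
  qp_b : b != 0;
  qp_I : I * I = a%:M;
  qp_J : J * J = b%:M;
  qp_IJ : I * J = - (J * I) }.

Section Pair.
Variables (a b : R) (I J : 'M[R]_2).
Hypothesis hIJ : quat_pair a b I J.

Let a0 : a != 0. Proof. by case: hIJ. Qed.
Let b0 : b != 0. Proof. by case: hIJ. Qed.
Let II : I * I = a *: 1. Proof. by rewrite -scalar2Z; case: hIJ. Qed.
Let JJ : J * J = b *: 1. Proof. by rewrite -scalar2Z; case: hIJ. Qed.
Let IJ : I * J = - (J * I). Proof. by case: hIJ. Qed.
Let JI : J * I = - (I * J). Proof. by rewrite IJ opprK. Qed.

Lemma half0 x : x = - x -> x = 0.
Proof. by move=> e; lra. Qed.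

Lemma qp_trIJ : \tr (I * J) = 0.
Proof. by apply: half0; rewrite {1}IJ tr_opp2 tr2C. Qed.

Lemma qp_trI : \tr I = 0.
Proof.
apply: (mulfI b0); rewrite mulr0 -trZ2.
have -> : b *: I = I * J * J by rewrite -mulrA JJ -scalerAr mulr1.
by apply: half0; rewrite {1}IJ mulNr tr_opp2 -(mulrA J I J) (tr2C J).
Qed.

Lemma qp_trJ : \tr J = 0.
Proof.
apply: (mulfI a0); rewrite mulr0 -trZ2.
have -> : a *: J = I * (I * J) by rewrite mulrA II -scalerAl mul1r.
by apply: half0; rewrite {1}IJ mulrN tr_opp2 (mulrA I J I) (tr2C _ I).
Qed.

Lemma IJIJ : I * J * (I * J) = - (a * b) *: 1.
Proof.
rewrite mulrA -(mulrA I J I) JI mulrN mulrA II mulNr -scalerAl mul1r.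
by rewrite -scalerAl JJ scalerA scaleNr.
Qed.

Lemma qp_tr00 c0 c1 c2 c3 : \tr (quat I J c0 c1 c2 c3) = 2 * c0.
Proof.
by rewrite !trD2 !trZ2 tr1_2 qp_trI qp_trJ qp_trIJ; ring.
Qed.

Lemma quat_mulI c0 c1 c2 c3 :
  I * quat I J c0 c1 c2 c3 = quat I J (a * c1) c0 (a * c3) c2.
Proof.
rewrite /quat !mulrDr -!scalerAr mulr1 II mulrA II -scalerAl mul1r !scalerA.
rewrite (mulrC c1) (mulrC c3); do 2!rewrite [in LHS]addrAC.
by apply: mx2P; rewrite !mx2E; ring.
Qed.

Lemma quat_mulJ c0 c1 c2 c3 :
  J * quat I J c0 c1 c2 c3 = quat I J (b * c2) (- (b * c3)) c0 (- c1).
Proof.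
rewrite /quat !mulrDr -!scalerAr mulr1 JJ mulrA JI mulNr -mulrA JJ -scalerAr mulr1.
by apply: mx2P; rewrite !mx2E; ring.
Qed.

Lemma qp_tr_coef c0 c1 c2 c3 : let X := quat I J c0 c1 c2 c3 in
  [/\ \tr X = 2 * c0, \tr (I * X) = 2 * (a * c1), \tr (J * X) = 2 * (b * c2) &
      \tr (I * (J * X)) = 2 * (a * - (b * c3))].
Proof. by split; rewrite ?quat_mulJ ?quat_mulI qp_tr00. Qed.

(** The trace form is nondegenerate: a residue Z orthogonal to 1, I, J and IJ anticommutes with I
    and J, hence commutes with IJ, but it also anticommutes with IJ, so [2 Z I J = 0]. *)
Lemma quat_decomp X : X = quat I J (\tr X / 2) (\tr (I * X) / (2 * a))
  (\tr (J * X) / (2 * b)) (- \tr (I * (J * X)) / (2 * (a * b))).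
Proof.
set Y := quat _ _ _ _ _ _; apply/eqP; rewrite -subr_eq0; apply/eqP.
have [t0 t1 t2 t3] := qp_tr_coef (\tr X / 2) (\tr (I * X) / (2 * a))
  (\tr (J * X) / (2 * b)) (- \tr (I * (J * X)) / (2 * (a * b))).
rewrite -/Y in t0 t1 t2 t3; set Z := X - Y.
have trB M : \tr (M * Z) = \tr (M * X) - \tr (M * Y).
  by rewrite mulrBr trD2 tr_opp2.
have z0 : \tr Z = 0 by rewrite trD2 tr_opp2 t0; field.
have z1 : \tr (I * Z) = 0 by rewrite trB t1; field.
have z2 : \tr (J * Z) = 0 by rewrite trB t2; field.
have z3 : \tr (I * J * Z) = 0.
  by rewrite trB -!mulrA t3; field; rewrite a0 b0.
have anti M : \tr M = 0 -> \tr (M * Z) = 0 -> M * Z = - (Z * M).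
  by move=> tM tMZ; apply/eqP; rewrite -addr_eq0 pure_anticomm // tMZ scale0r.
have e1 := anti _ qp_trI z1; have e2 := anti _ qp_trJ z2.
have e3 := anti _ qp_trIJ z3.
have : I * J * Z = Z * (I * J).
  by rewrite -(mulrA I J Z) e2 mulrN (mulrA I Z J) e1 mulNr opprK -mulrA.
rewrite e3 => e4.
have : (2 : R) *: (Z * (I * J)) = 0.
  by rewrite scaler_nat mulr2n -{1}e4 addNr.
move/(congr1 (fun M => M * (I * J))); rewrite mul0r -scalerAl -mulrA IJIJ -scalerAr mulr1.
rewrite scalerA => /eqP; rewrite scaler_eq0 => /orP[|/eqP //].
by rewrite mulf_eq0 oppr_eq0 mulf_eq0 (negbTE a0) (negbTE b0) pnatr_eq0.
Qed.

Lemma quat_free c0 c1 c2 c3 : quat I J c0 c1 c2 c3 = 0 ->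
  [/\ c0 = 0, c1 = 0, c2 = 0 & c3 = 0].
Proof.
move=> e; have [] := qp_tr_coef c0 c1 c2 c3; rewrite e !mulr0 raddf0.
move=> h0 h1 h2 h3.
split; apply/eqP.
- by move/eqP: h0; rewrite eq_sym mulf_eq0 pnatr_eq0.
- by move/eqP: h1; rewrite eq_sym !mulf_eq0 pnatr_eq0 (negbTE a0).
- by move/eqP: h2; rewrite eq_sym !mulf_eq0 pnatr_eq0 (negbTE b0).
- by move/eqP: h3; rewrite eq_sym !mulf_eq0 oppr_eq0 mulf_eq0 pnatr_eq0 (negbTE a0) (negbTE b0).
Qed.

Variable K : R -> Prop.
Hypotheses (hK : is_subfield K) (Ka : K a) (Kb : K b).

(** The algebra (a,b/K) inside M_2(R), embedded through the splitting matrices. *)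
Definition inA X := exists c0 c1 c2 c3 : R, [/\ K c0, K c1, K c2, K c3 &
  X = quat I J c0 c1 c2 c3].

Lemma inA_add X Y : inA X -> inA Y -> inA (X + Y).
Proof.
move=> [c0 [c1 [c2 [c3 [h0 h1 h2 h3 ->]]]]] [d0 [d1 [d2 [d3 [k0 k1 k2 k3 ->]]]]].
exists (c0 + d0), (c1 + d1), (c2 + d2), (c3 + d3); split; try exact: (subD hK).
by apply: mx2P; rewrite !mx2E; ring.
Qed.

Lemma inA_scale x X : K x -> inA X -> inA (x *: X).
Proof.
move=> Kx [c0 [c1 [c2 [c3 [h0 h1 h2 h3 ->]]]]].
exists (x * c0), (x * c1), (x * c2), (x * c3); split; try exact: (subM hK).
by apply: mx2P; rewrite !mx2E; ring.
Qed.

Lemma inA_opp X : inA X -> inA (- X).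
Proof. by move=> hX; rewrite -scaleN1r; apply: inA_scale hX; apply: (subN hK); exact: (sub1 hK). Qed.

Lemma inA_sub X Y : inA X -> inA Y -> inA (X - Y).
Proof. by move=> hX hY; apply/inA_add/inA_opp. Qed.

Let K0 := sub0 hK.
Let K1 := sub1 hK.

Lemma inA1 : inA 1.
Proof. by exists 1, 0, 0, 0; split=> //; rewrite /quat !scale0r !addr0 scale1r. Qed.

Lemma inA0 : inA 0.
Proof. by exists 0, 0, 0, 0; split=> //; rewrite /quat !scale0r !addr0. Qed.

Lemma inA_I : inA I.
Proof. by exists 0, 1, 0, 0; split=> //; rewrite /quat !scale0r !addr0 add0r scale1r. Qed.

Lemma inA_J : inA J.
Proof. by exists 0, 0, 1, 0; split=> //; rewrite /quat !scale0r !addr0 !add0r scale1r. Qed.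

Lemma inA_mulI X : inA X -> inA (I * X).
Proof.
move=> [c0 [c1 [c2 [c3 [h0 h1 h2 h3 ->]]]]]; rewrite quat_mulI.
by exists (a * c1), c0, (a * c3), c2; split=> //; exact: subM.
Qed.

Lemma inA_mulJ X : inA X -> inA (J * X).
Proof.
move=> [c0 [c1 [c2 [c3 [h0 h1 h2 h3 ->]]]]]; rewrite quat_mulJ.
exists (b * c2), (- (b * c3)), c0, (- c1); split=> //; try exact: (subM hK).
  by apply: (subN hK); apply: (subM hK).
exact: (subN hK).
Qed.

Lemma inA_mul X Y : inA X -> inA Y -> inA (X * Y).
Proof.
move=> [c0 [c1 [c2 [c3 [h0 h1 h2 h3 ->]]]]] hY.
rewrite /quat !mulrDl -!scalerAl mul1r -mulrA.
by do !apply: inA_add; apply: inA_scale => //; do ?[apply: inA_mulI]; do ?[apply: inA_mulJ].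
Qed.

Lemma inA_tr X : inA X -> K (\tr X).
Proof.
move=> [c0 [c1 [c2 [c3 [h0 h1 h2 h3 ->]]]]]; rewrite qp_tr00.
by apply: subM => //; exact: (sub_nat hK 2).
Qed.

Lemma det2_tr X : \det X = ((\tr X) ^+ 2 - \tr (X * X)) / 2.
Proof. by rewrite !mx2E; field. Qed.

Lemma inA_det X : inA X -> K (\det X).
Proof.
move=> hX; rewrite det2_tr; apply: sub_div => //; last exact: (sub_nat hK 2).
apply: (subB hK); first by apply: (subX hK); exact: inA_tr.
by apply: inA_tr; exact: inA_mul.
Qed.

End Pair.

(** Coordinates in the new basis are quotients of traces, and traces of elements of the algebra lie
    in K. *)
Lemma inA_change a b I J a' b' I' J' K X : is_subfield K -> K a -> K b -> K a' -> K b' ->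
  quat_pair a b I J -> quat_pair a' b' I' J' ->
  inA I J K I' -> inA I J K J' -> inA I J K X -> inA I' J' K X.
Proof.
move=> hK Ka Kb Ka' Kb' h h' hI hJ hX; have K2 := sub_nat hK 2.
have tr_in Y : inA I J K Y -> K (\tr Y) by exact: inA_tr h _ hK _.
have mul_in Y Z : inA I J K Y -> inA I J K Z -> inA I J K (Y * Z).
  exact: (inA_mul h hK Ka Kb).
exists (\tr X / 2), (\tr (I' * X) / (2 * a')), (\tr (J' * X) / (2 * b')),
  (- \tr (I' * (J' * X)) / (2 * (a' * b'))); split; last exact: quat_decomp h' X.
- exact: (sub_div hK (tr_in _ hX) K2).
- by apply: (sub_div hK); [apply: tr_in; exact: mul_in | exact: (subM hK)].
- by apply: (sub_div hK); [apply: tr_in; exact: mul_in | exact: (subM hK)].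
- apply: (sub_div hK); last by apply: (subM hK) => //; exact: (subM hK).
  by apply: (subN hK); apply: tr_in; apply: (mul_in) => //; exact: mul_in.
Qed.

End Quaternion.

(** * Invariants of a group generated from scaled elements of the algebra *)

Section Invariants.
Variables (R : realType) (g : nat) (C : nat -> 'M[R]_2).
Local Notation m := (g.*2.+2).
Local Notation ab := (@gens R g C).
Hypothesis hC : halfturns C m.
Variables (K : R -> Prop) (a b : R) (I J : 'M[R]_2).
Hypotheses (hK : is_subfield K) (Ka : K a) (Kb : K b) (hIJ : quat_pair a b I J).
Local Notation A := (inA I J K).
Implicit Types (M N X Y : 'M[R]_2) (x y : R).

Hypothesis C_in : forall i, (i <= g.*2)%N -> exists r X, A X /\ C i = r *: X.

Let A1 : A 1. Proof. exact: inA1 hK. Qed.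
Let AM X Y : A X -> A Y -> A (X * Y). Proof. exact: (inA_mul hIJ hK Ka Kb). Qed.
Let AD X Y : A X -> A Y -> A (X + Y). Proof. exact: (inA_add hK). Qed.
Let AZ x X : K x -> A X -> A (x *: X). Proof. exact: (inA_scale hK). Qed.
Let Atr X : A X -> K (\tr X). Proof. exact: (inA_tr hIJ hK). Qed.
Let Adet X : A X -> K (\det X). Proof. exact: (inA_det hIJ hK Ka Kb). Qed.

Lemma det1_scale r X : \det (r *: X) = 1 -> \det X != 0 /\ r ^+ 2 = (\det X)^-1.
Proof.
rewrite det2_scale => e.
have d0 : \det X != 0.
  by apply/eqP => d0; move/eqP: e; rewrite d0 mulr0 eq_sym oner_eq0.
by split=> //; apply: (mulIf d0); rewrite e mulVf.
Qed.

(** The scalar [r] may lie outside K, but [r^2 = 1 / det X] is in K. *)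
Lemma sqr_in r X : \det (r *: X) = 1 -> A X -> A (r *: X * (r *: X)).
Proof.
move=> /det1_scale[_ er] AX; rewrite -scalerAl -scalerAr scalerA -expr2 er.
by apply: AZ; [apply: (subV hK); exact: Adet | exact: AM].
Qed.

Lemma ev_in w : all (fun i => i <= g.*2)%N w -> exists r X, A X /\ ev C w = r *: X.
Proof.
elim: w => [|i w IH] /=; first by exists 1, 1; rewrite ev_nil scale1r.
move=> /andP[/C_in[r [X [AX eX]]] /IH[r' [X' [AX' eX']]]].
exists (r * r'), (X * X'); split; first exact: AM.
by rewrite ev_cons eX eX' -scalerAl -scalerAr scalerA.
Qed.

Lemma Gammabar_sqr_in M : Gammabar ab M -> A (M * M).
Proof.
move=> /(Gammabar_word hC)[w /ev_in[r [X [AX eX]]] eM].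
have e : \det (r *: X) = 1 by rewrite -eX (ev_det hC).
case: eM => ->; rewrite ?mulrNN eX; exact: sqr_in.
Qed.

Lemma trace_field_sub x : inv_trace_field ab x -> K x.
Proof. by apply=> // M hM; apply/Atr/Gammabar_sqr_in. Qed.

Lemma quat_alg_sub X : inv_quat_alg ab X -> A X.
Proof.
move=> [n [k [G [hk hG ->]]]].
elim/big_ind: _ => [|Y Z|i _]; [exact: inA0 hK | exact: AD |].
by apply: AZ; [apply: trace_field_sub; exact: hk | apply: Gammabar_sqr_in; exact: hG].
Qed.

Hypothesis K_trace : forall x, K x -> inv_trace_field ab x.

Lemma quat_alg_add X Y : inv_quat_alg ab X -> inv_quat_alg ab Y -> inv_quat_alg ab (X + Y).
Proof.
move=> [n [k [G [hk hG ->]]]] [n' [k' [G' [hk' hG' ->]]]].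
exists (n + n')%N.
exists (fun i => match split i with inl j => k j | inr j => k' j end).
exists (fun i => match split i with inl j => G j | inr j => G' j end).
split; [by move=> i; case: split|by move=> i; case: split|].
rewrite big_split_ord /=; congr (_ + _); apply: eq_bigr => i _.
  by rewrite (unsplitK (inl i)).
by rewrite (unsplitK (inr i)).
Qed.

Lemma quat_alg_scale x X : K x -> inv_quat_alg ab X -> inv_quat_alg ab (x *: X).
Proof.
move=> Kx [n [k [G [hk hG ->]]]]; exists n, (fun i => x * k i), G; split=> //.
  by move=> i; apply: K_trace; apply: (subM hK) => //; exact: trace_field_sub.
by rewrite scaler_sumr; apply: eq_bigr => i _; rewrite scalerA.
Qed.

Lemma quat_alg_sqr M : Gammabar ab M -> inv_quat_alg ab (M * M).
Proof.
move=> hM; exists 1%N, (fun _ => 1), (fun _ => M); split=> //.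
  by move=> _; apply: K_trace; exact: sub1.
by rewrite big_ord1 scale1r.
Qed.

Lemma quat_alg1 : inv_quat_alg ab 1.
Proof. by rewrite -[1](mulr1 1); apply: quat_alg_sqr; exact: Gammabar1. Qed.

(* Cayley-Hamilton expresses an element of nonzero trace through its square. *)
Lemma quat_alg_gen r N : Gammabar ab (r *: N) -> \det (r *: N) = 1 -> A N -> \tr N != 0 ->
  inv_quat_alg ab N.
Proof.
move=> hG d1 AN t0; have [d0 er] := det1_scale d1.
have e : r *: N * (r *: N) = (\det N)^-1 *: (\tr N *: N - (\det N) *: 1).
  by rewrite -scalerAl -scalerAr scalerA -expr2 er cayley2 scalar2Z.
have -> : N = (\det N / \tr N) *: (r *: N * (r *: N)) + (\det N / \tr N) *: 1.
  by rewrite e; apply: mx2P; rewrite !mx2E; field; rewrite -?det2E -?tr2E d0 t0.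
have Kc : K (\det N / \tr N) by apply: (sub_div hK); [exact: Adet | exact: Atr].
apply: quat_alg_add; apply: quat_alg_scale => //; [exact: quat_alg_sqr | exact: quat_alg1].
Qed.

End Invariants.

(** * A configuration of three half-turns that forces the invariants *)

Section Config.
Variables (R : realType) (g : nat) (C : nat -> 'M[R]_2).
Local Notation m := (g.*2.+2).
Local Notation ab := (@gens R g C).
Hypothesis hC : halfturns C m.
Hypothesis g_gt0 : (0 < g)%N.
Variables (K : R -> Prop) (a b : R) (I J : 'M[R]_2).
Hypotheses (hK : is_subfield K) (Ka : K a) (Kb : K b) (hIJ : quat_pair a b I J).
Local Notation A := (inA I J K).
Variable th : R.
Hypothesis th_gen : forall F : R -> Prop, is_subfield F -> F (th ^+ 2) -> forall x, K x -> F x.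

(** The element [p2] is a rotated multiple of [p1] in the plane anticommuting with [X0]. Of the
    nonvanishing conditions, [s] and [w] give back [th^2], [y] lets [X0] be read off from [p1 p2],
    and the trace makes [(1 + p1)(1 - p2)] expressible through its square. *)
Record config : Prop := Config {
  cf_in : forall i, (i <= g.*2)%N -> exists r X, A X /\ C i = r *: X;
  cf_el : exists r0 r1 r2 s x y (w : rat) (X0 p1 p2 : 'M[R]_2),
    [/\ [/\ A X0, A p1, K x & K y], [/\ \tr X0 = 0, \tr p1 = 0 & X0 * p1 = - (p1 * X0)],
        [/\ C 0 = r0 *: X0, C 1 = r1 *: (X0 * (1 + p1)) & C 2 = r2 *: (X0 * (1 + p2))],
        [/\ p1 * p1 = s%:M, p2 = x *: p1 + y *: (X0 * p1) &
            p2 * p2 = ((ratr w * th) ^+ 2 * s)%:M] &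
        [/\ s != 0, y != 0, w != 0 & \tr ((1 + p1) * (1 - p2)) != 0]] }.

Hypothesis hcf : config.

Theorem config_invariants :
  (forall x, K x <-> inv_trace_field ab x) /\
  (forall X, A X -> inv_quat_alg ab X).
Proof.
case: hcf => C_in [r0 [r1 [r2 [s [x [y [w [X0 [p1 [p2]]]]]]]]]].
move=> [[AX0 Ap1 Kx Ky] [tX0 tp1 Xp] [c0 c1 c2] [e1 e2 e3] [s0 y0 w0 t0]].
have A1 : A 1 by exact: inA1 hK.
have AM X Y : A X -> A Y -> A (X * Y) by exact: (inA_mul hIJ hK Ka Kb).
have AD X Y : A X -> A Y -> A (X + Y) by exact: (inA_add hK).
have AB X Y : A X -> A Y -> A (X - Y) by exact: (inA_sub hK).
have AZ z X : K z -> A X -> A (z *: X) by exact: (inA_scale hK).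
have Ap2 : A p2 by rewrite e2; apply: AD; apply: AZ => //; exact: AM.
have X2 := pure_sqr tX0.
have tXp : \tr (X0 * p1) = 0.
  by apply: half0; rewrite {1}Xp tr_opp2 tr2C.
have tp2 : \tr p2 = 0 by rewrite e2 trD2 !trZ2 tp1 tXp !mulr0 addr0.
have pX : p1 * X0 = - (X0 * p1) by rewrite Xp opprK.
have Xp2 : p2 * X0 = - (X0 * p2).
  rewrite e2 mulrDl mulrDr -!scalerAl -!scalerAr -(mulrA X0 p1) pX mulrN !scalerN.
  by rewrite opprD.
pose i0 : 'I_g := Ordinal g_gt0.
pose k0 := r0 * r1 * \det X0; pose k1 := - (r2 * r0 * \det X0).
(* The generators [a_0 = c_0^-1 c_1] and [b_0 = c_2 c_0] are multiples of [1 + p1] and [1 - p2]. *)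
have g0 : Gammabar ab (k0 *: (1 + p1)).
  have := Gammabar_gen C false i0; apply: Gammabar_pm; left.
  rewrite /gens /= /hword /= ev_seq1 (C_inv hC) c0 c1 mulNr -scalerAl -scalerAr.
  by rewrite mulrA X2 -scalerAl mul1r !scalerA /k0 mulrN scaleNr opprK.
have g1 : Gammabar ab (k1 *: (1 - p2)).
  have := Gammabar_gen C true i0; apply: Gammabar_pm; left.
  have e : X0 * (1 + p2) * X0 = - \det X0 *: (1 - p2).
    by rewrite -mulrA mulrDl mul1r Xp2 mulrBr mulrA X2 -scalerAl mul1r scalerBr.
  rewrite /gens /= /hword /= ev_seq1 c0 c2 -scalerAl -scalerAr e !scalerA.
  by rewrite /k1 mulrN.
have gdet M : Gammabar ab M -> \det M = 1.
  by move=> [v [] ->]; rewrite ?det_opp2 (word_eval_det hC).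
have tN : \tr (- p2) = 0 by rewrite tr_opp2 tp2 oppr0.
have sN : - p2 * - p2 = ((ratr w * th) ^+ 2 * s)%:M by rewrite mulrNN.
have K_trace z : K z -> inv_trace_field ab z.
  move=> Kz F hF htr; apply: th_gen Kz => //.
  (* With determinant 1 the trace of the square is [t = 2 (1 + u) / (1 - u)], so
     [u = (t - 2) / (t + 2)], where [t + 2 = 4 / (1 - u)] is nonzero. *)
  have param k p u : Gammabar ab (k *: (1 + p)) -> \tr p = 0 -> p * p = u%:M -> F u.
    move=> hG tp pu; have [] := det1_scale (gdet _ hG).
    have dp : \det p = - u.
      have := pure_sqr tp; rewrite pu => /(congr1 (fun M : 'M[R]_2 => M 0 0)).
      by rewrite !mx2E mulr1 => ->; rewrite opprK.
    have -> : \det (1 + p) = 1 - u.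
      transitivity (1 + \tr p + \det p); first by rewrite !mx2E; ring.
      by rewrite tp dp addr0.
    move=> d0 ek; have := htr _ hG.
    rewrite -scalerAl -scalerAr scalerA -expr2 ek trZ2 mulrDl mul1r mulrDr mulr1 pu.
    rewrite !trD2 tr1_2 tp (_ : \tr (u%:M : 'M[R]_2) = 2 * u); last first.
      by rewrite !mx2E; ring.
    set t := _ * _ => Ft.
    have et : t * (1 - u) = 2 + 2 * u by rewrite /t mulrAC mulVf // mul1r; ring.
    have t2 : t + 2 != 0.
      apply/eqP => e; have : (t + 2) * (1 - u) = 4 by rewrite mulrDl et; ring.
      by rewrite e mul0r => /eqP; rewrite eq_sym pnatr_eq0.
    have -> : u = (t - 2) / (t + 2).
      apply: (mulIf t2); rewrite divfK //; apply/eqP; rewrite -subr_eq0; apply/eqP.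
      by transitivity (2 + 2 * u - t * (1 - u)); [ring | rewrite et subrr].
    have F2 := sub_nat hF 2.
    by apply: (sub_div hF); [exact: (subB hF) | exact: (subD hF)].
  have Fs := param _ _ _ g0 tp1 e1; have Fs2 := param _ _ _ g1 tN sN.
  have wn : (ratr w : R) != 0 by rewrite fmorph_eq0.
  have -> : th ^+ 2 = (ratr w * th) ^+ 2 * s / s / ratr w ^+ 2.
    by rewrite mulfK // exprMn mulrAC divff ?mul1r // expf_neq0.
  apply: (sub_div hF); first exact: (sub_div hF).
  by apply: (subX hF); exact: sub_rat.
split.
  move=> z; split; first exact: K_trace.
  exact: (trace_field_sub hC hK Ka Kb hIJ C_in).
have alg_add := quat_alg_add (g := g) (C := C).
have alg_scale := quat_alg_scale hC hK Ka Kb hIJ C_in K_trace.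
have alg1 := quat_alg1 hK K_trace.
have gen := quat_alg_gen hC hK Ka Kb hIJ C_in K_trace.
have n2 : (2 : R) != 0 by rewrite pnatr_eq0.
have h1 : inv_quat_alg ab (1 + p1).
  by apply: gen g0 (gdet _ g0) _ _; [exact: AD | rewrite trD2 tr1_2 tp1 addr0].
have h2 : inv_quat_alg ab (1 - p2).
  by apply: gen g1 (gdet _ g1) _ _; [exact: AB | rewrite trD2 tr1_2 tN addr0].
have g3 := Gammabar_mul g0 g1.
rewrite -scalerAl -scalerAr scalerA in g3.
have h3 : inv_quat_alg ab ((1 + p1) * (1 - p2)).
  by apply: gen g3 (gdet _ g3) _ _ => //; apply: (AM); [exact: AD | exact: AB].
have KN1 : K (-1) by apply: (subN hK); exact: sub1.
have alg_sub X Y : inv_quat_alg ab X -> inv_quat_alg ab Y -> inv_quat_alg ab (X - Y).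
  by move=> hX hY; rewrite -scaleN1r; apply: alg_add hX _; exact: alg_scale.
have hp1 : inv_quat_alg ab p1 by rewrite -[p1](addKr 1) addrC; exact: alg_sub.
have hp2 : inv_quat_alg ab p2 by rewrite -[p2](subKr 1); exact: alg_sub.
have hp12 : inv_quat_alg ab (p1 * p2).
  have -> : p1 * p2 = 1 + p1 - p2 - (1 + p1) * (1 - p2).
    by rewrite mulrBr mulr1 mulrDl mul1r !opprD !opprK addrACA; apply: mx2P; rewrite !mx2E; ring.
  by apply: (alg_sub) => //; apply: (alg_sub) => //; exact: alg_add.
have Ks : K s.
  have : A (p1 * p1) by exact: AM.
  rewrite e1 => /(inA_tr hIJ hK); rewrite !mx2E -mulr2n => Kt.
  have -> : s = s *+ 2 / 2 by rewrite mulr2n; field.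
  by apply: (sub_div hK) => //; exact: (sub_nat hK 2).
have KdX : K (\det X0) by exact: (inA_det hIJ hK Ka Kb).
have dX0 : \det X0 != 0.
  by have := ht_det hC 0; rewrite c0 => /det1_scale[].
have hX0 : inv_quat_alg ab X0.
  have -> : X0 = (- (y * s)^-1) *: (p1 * p2 - (x * s) *: 1).
    have q : p1 * p2 = (x * s) *: 1 - (y * s) *: X0.
      rewrite e2 mulrDr -!scalerAr (mulrA p1 X0) pX mulNr -(mulrA X0 p1) e1 scalar2Z.
      by rewrite -scalerAr mulr1 scalerN !scalerA.
    rewrite q addrAC subrr add0r scalerN scaleNr opprK scalerA mulVf ?scale1r //.
    by rewrite mulf_neq0.
  apply: (alg_scale); first by apply: (subN hK); apply: (subV hK); exact: (subM hK).
  by apply: (alg_sub) => //; apply: (alg_scale) => //; exact: (subM hK).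
have hXp : inv_quat_alg ab (X0 * p1).
  have -> : X0 * p1 = y^-1 *: (p2 - x *: p1).
    by rewrite e2 addrAC subrr add0r scalerA mulVf ?scale1r.
  apply: (alg_scale); first exact: (subV hK).
  by apply: (alg_sub) => //; exact: alg_scale.
have pair : quat_pair (- \det X0) s X0 p1.
  by split; rewrite ?oppr_eq0 // X2 scalar2Z.
move=> X AX; have KdN := subN hK KdX.
have [u0 [u1 [u2 [u3 [K0 K1 K2 K3 ->]]]]] := inA_change hK Ka Kb KdN Ks hIJ pair AX0 Ap1 AX.
by do 3?[apply: (alg_add)]; apply: (alg_scale).
Qed.

Theorem config_quat_iso : inv_quat_alg_iso ab K a b.
Proof.
have [hF hA] := config_invariants; exists I, J.
have [a0 b0 II JJ IJ] := hIJ; split; last split.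
- by apply: hA; exact: (inA_I _ _ hK).
- by apply: hA; exact: (inA_J _ _ hK).
do 3?[split=> //].
  split; last by move=> ? ? ? ? _ _ _ _; exact: (quat_free hIJ).
move=> X; split; last exact: hA.
by case: hcf => C_in _; exact: (quat_alg_sub hC hK Ka Kb hIJ C_in).
Qed.

End Config.

(** * Traces of products of regular half-turns *)

Section RegularTraces.
Variables (R : realType) (m : nat).
Hypothesis m_ge6 : (6 <= m)%N.
Local Notation reg := (@reg R m).
Local Notation al := (ral R m).
Implicit Types (D E p : 'M[R]_2).

(** The condition on the off-diagonal entries fixes the sense of rotation, that is, it selects one
    of the two lifts D and -D. *)
Lemma halfturn_offdiag D : \det D = 1 -> \tr D = 0 -> D 1 0 < D 0 1 ->
  0 < D 0 1 /\ D 0 1 * D 1 0 = - (1 + D 0 0 ^+ 2).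
Proof.
rewrite !mx2E => d t lt.
have e : D 1 1 = - D 0 0 by apply/eqP; rewrite -addr_eq0 addrC t.
rewrite e in d; have e2 : D 0 1 * D 1 0 = - (1 + D 0 0 ^+ 2) by rewrite -d; ring.
split=> //; rewrite ltNge; apply/negP => le0.
have := mulr_le0 le0 (ltW (lt_le_trans lt le0)); have := sqr_ge0 (D 0 0); lra.
Qed.

(* Half-turns about two points at distance [r] have product of trace [- 2 cosh r]. *)
Lemma tr_halfturns D E : \det D = 1 -> \tr D = 0 -> D 1 0 < D 0 1 ->
  \det E = 1 -> \tr E = 0 -> E 1 0 < E 0 1 ->
  \tr (D * E) <= - 2 /\ (\tr (D * E) = - 2 -> D = E).
Proof.
move=> d1 t1 o1 d2 t2 o2.
have [q1 r1] := halfturn_offdiag d1 t1 o1; have [q2 r2] := halfturn_offdiag d2 t2 o2.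
have e1 : D 1 1 = - D 0 0 by move/eqP: t1; rewrite !mx2E addrC addr_eq0 => /eqP.
have e2 : E 1 1 = - E 0 0 by move/eqP: t2; rewrite !mx2E addrC addr_eq0 => /eqP.
set x := D 0 1 * E 0 0 - E 0 1 * D 0 0; set y := D 0 1 - E 0 1.
have key : (\tr (D * E) + 2) * (D 0 1 * E 0 1) = - (x ^+ 2 + y ^+ 2).
  transitivity (2 * D 0 0 * E 0 0 * D 0 1 * E 0 1 + D 0 1 ^+ 2 * (E 0 1 * E 1 0) +
    E 0 1 ^+ 2 * (D 0 1 * D 1 0) + 2 * D 0 1 * E 0 1).
    by rewrite !mx2E e1 e2; ring.
  by rewrite r1 r2 /x /y; ring.
have qq : 0 < D 0 1 * E 0 1 by rewrite mulr_gt0.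
have x0 := sqr_ge0 x; have y0 := sqr_ge0 y; split.
  by rewrite -(ler_pM2r qq); lra.
move=> e; rewrite e addNr mul0r in key.
have /eqP : y ^+ 2 = 0 by lra.
have /eqP : x ^+ 2 = 0 by lra.
rewrite !sqrf_eq0 !subr_eq0 => /eqP ex /eqP ey.
have qn : E 0 1 != 0 by rewrite gt_eqF.
have ep : D 0 0 = E 0 0 by apply: (mulfI qn); rewrite -ex ey.
by apply: mx2P; rewrite ?e1 ?e2 ?ep //; apply: (mulfI qn); rewrite -{1}ey r1 r2 ep.
Qed.

(** The difference of the off-diagonal entries is invariant under conjugation by [rot], so it is the
    same for all sides. *)
Lemma reg_offdiag k : reg k 1 0 < reg k 0 1.
Proof.
have conj t M : (rot t * M * rot (- t)) 0 1 - (rot t * M * rot (- t)) 1 0 =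
    M 0 1 - M 1 0.
  rewrite !mx2E cosN sinN; transitivity ((M 0 1 - M 1 0) * (cos t ^+ 2 + sin t ^+ 2)).
    by ring.
  by rewrite cos2Dsin2 mulr1.
have e : - (al *+ k.+1) = - al + - (al *+ k) by rewrite mulrSr opprD addrC.
rewrite -subr_gt0 /reg e rotD mulrA -(mulrA (rot _) (ell _ _)) conj.
rewrite !mx2E cosN sinN.
have s0 := s_gt0 R m_ge6; have c0 := c_gt0 R m_ge6; have q1 := q_gt1 R m_ge6.
have -> : forall x, x = sin al * cos al * (2 + 2 * rq R m) -> 0 < x.
  by move=> x ->; rewrite !mulr_gt0 //; lra.
- by [].
by rewrite /rmu /rnu; ring.
Qed.

Lemma tr_reg_le i j : \tr (reg i * reg j) <= - 2.
Proof.
apply: (tr_halfturns _ _ _ _ _ _).1;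
  by [exact: reg_det|exact: reg_tr|exact: reg_offdiag].
Qed.

(** Equality would identify two adjacent half-turns; their product -1 would then force
    [ell (2 al) = - rot (2 al)], hence [cos (2 al) = 0]. *)
Lemma tr_reg_next i : \tr (reg i * reg i.+1) < - 2.
Proof.
rewrite lt_neqAle tr_reg_le andbT; apply/eqP => e.
have eD : reg i = reg i.+1.
  apply: (tr_halfturns _ _ _ _ _ _).2 e;
    by [exact: reg_det|exact: reg_tr|exact: reg_offdiag].
have := ev_reg R m_ge6 i 2; rewrite /= !ev_cons ev_nil mulr1 -eD.
rewrite (sqr_pure (reg_det _ m_ge6 i) (reg_tr _ m_ge6 i)) => h.
have h2 : ell m (al *+ 2) = - rot (al *+ 2).
  have : rot (- (al *+ i)) * (rot (al *+ i) * ell m (al *+ 2) * rot (- (al *+ (i + 2))))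
      * rot (al *+ (i + 2)) = ell m (al *+ 2).
    by rewrite !mulrA rotVK mul1r -mulrA rotVK mulr1.
  by rewrite -h mulrN1 mulNr -rotD mulrnDr addKr => <-.
have := congr1 (fun M : 'M[R]_2 => M 0 0) h2; rewrite !mx2E => /half0.
rewrite -mulr_natl => e0; have := cos2_gt0 R m_ge6; rewrite -cos2alE e0 ltxx //.
Qed.

(** The trace of a product of three half-turns vanishes exactly when their centers are collinear.
    Here it is [2 (cos^2 t - q sin^2 t)] at [t = 3 al], which is negative. *)
Lemma tr_reg012 : \tr (reg 0 * reg 1 * reg 2) != 0.
Proof.
have -> : reg 0 * reg 1 * reg 2 = ev reg (iota 0 3).
  by rewrite /= !ev_cons ev_nil mulr1 !mulrA.
rewrite (ev_reg R m_ge6) mulr0n rot0 mul1r add0n; set t := al *+ 3.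
have -> : \tr (ell m t * rot (- t)) = 2 * (cos t ^+ 2 - rq R m * sin t ^+ 2).
  by rewrite !mx2E cosN sinN /rmu /rnu; ring.
have hl : (2 <= 3 <= m - 2)%N by move: m_ge6; lia.
have [cl sl] := trig_mid R m_ge6 hl.
rewrite mulf_neq0 ?pnatr_eq0 // lt_eqF // subr_lt0.
have s0 := s_gt0 R m_ge6; have c0 := c_gt0 R m_ge6; have q1 := q_gt1 R m_ge6.
rewrite -/t cos2alE in cl; rewrite -/t sin2alE in sl.
have qs := qs R m_ge6; have c2 := cos2_gt0 R m_ge6.
have h1 : cos t ^+ 2 <= (cos al ^+ 2 - sin al ^+ 2) ^+ 2.
  rewrite -[cos t ^+ 2]real_normK ?num_real // ler_pXn2r ?nnegrE //; exact: ltW.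
have sc0 : 0 <= 2 * sin al * cos al by rewrite !mulr_ge0 // ltW.
have h2 : (2 * sin al * cos al) ^+ 2 <= sin t ^+ 2.
  by rewrite ler_pXn2r ?nnegrE // (le_trans sc0).
have q0 : 0 <= rq R m by lra.
have h3 := ler_wpM2l q0 h2.
have e3 : rq R m * (2 * sin al * cos al) ^+ 2 = 4 * (cos al ^+ 2) ^+ 2.
  by transitivity (4 * (rq R m * sin al ^+ 2) * cos al ^+ 2); [ring | rewrite qs; ring].
rewrite e3 in h3; apply: le_lt_trans h1 _; apply: lt_le_trans h3.
have c4 : 0 < cos al ^+ 2 by rewrite exprn_gt0.
have s4 := sqr_ge0 (sin al); nra.
Qed.

End RegularTraces.

(** * Half-turns as pure quaternions: factorisations and commutators *)

Section HalfturnAlgebra.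
Variable R : realType.
Implicit Types (D E p X Y : 'M[R]_2).

Lemma pure_anti X Y : \tr X = 0 -> \tr Y = 0 -> \tr (X * Y) = 0 -> X * Y = - (Y * X).
Proof.
move=> tX tY tXY; apply/eqP; rewrite -addr_eq0 pure_anticomm // tXY scale0r //.
Qed.

(** [- D E] has scalar part [k], and [p] is its pure part divided by [k]. Determinants give
    [k^2 (1 - s) = 1], so [s] vanishes only for [k = 1]. *)
Lemma halfturn_factor D E : \det D = 1 -> \tr D = 0 -> \det E = 1 -> \tr E = 0 ->
  \tr (D * E) <= - 2 -> exists k p s, [/\ k != 0, E = k *: (D * (1 + p)),
    [/\ \tr p = 0 & \tr (D * p) = 0] & p * p = s%:M /\ (\tr (D * E) < - 2 -> s != 0)].
Proof.
move=> dD tD dE tE le; pose k := - \tr (D * E) / 2.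
have k1 : 1 <= k by rewrite /k; lra.
have k0 : k != 0 by rewrite gt_eqF // (lt_le_trans ltr01).
have DD := sqr_pure dD tD.
pose p := k^-1 *: (- (D * E)) - 1.
have tp : \tr p = 0.
  rewrite trD2 trZ2 !tr_opp2 tr1_2 (_ : - \tr (D * E) = k * 2).
    by rewrite mulrA mulVf // mul1r subrr.
  by rewrite /k; field.
have ep : 1 + p = k^-1 *: (- (D * E)) by rewrite addrC subrK.
have eE : E = k *: (D * (1 + p)).
  by rewrite ep -scalerAr scalerA mulfV // scale1r mulrN mulrA DD mulN1r opprK.
have tDp : \tr (D * p) = 0.
  have := congr1 (fun M => \tr M) eE; rewrite tE trZ2 mulrDr mulr1 trD2 tD add0r.
  by move/esym/eqP; rewrite mulf_eq0 (negbTE k0) => /eqP.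
exists k, p, (- \det p); split=> //; split.
  by rewrite pure_sqr // scalar2Z.
move=> lt; have {}k1 : 1 < k by rewrite /k; lra.
have : k ^+ 2 * \det (1 + p) = 1.
  by rewrite -dE eE det2_scale det2M dD mul1r.
have -> : \det (1 + p) = 1 + \det p.
  transitivity (1 + \tr p + \det p); first by rewrite !mx2E; ring.
  by rewrite tp addr0.
move=> e; rewrite oppr_eq0; apply/eqP => d0; move: e; rewrite d0 addr0 mulr1; nra.
Qed.

(** Commutators with [P = D E] fill the trace-orthogonal complement of 1 and P as soon as [(tr P)^2]
    differs from 4, and E lies there because [P E = - D] is traceless. The solution is sought in the
    span of D and E. *)
Lemma halfturn_commutator D E : \det D = 1 -> \tr D = 0 -> \det E = 1 -> \tr E = 0 ->
  \tr (D * E) < - 2 -> exists Y, D * E * Y - Y * (D * E) = E.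
Proof.
move=> dD tD dE tE lt; set t := \tr (D * E) in lt.
have n : 4 - t ^+ 2 != 0 by apply/eqP; nra.
pose y := 2 / (4 - t ^+ 2); exists (y *: ((t / 2) *: E + D)).
have e1 : D 1 1 = - D 0 0 by move/eqP: tD; rewrite !mx2E addrC addr_eq0 => /eqP.
have e2 : E 1 1 = - E 0 0 by move/eqP: tE; rewrite !mx2E addrC addr_eq0 => /eqP.
have DE : E * D = t *: 1 - D * E.
  by rewrite -(pure_anticomm tD tE) addrC addKr.
have DD := sqr_pure dD tD; have EE := sqr_pure dE tE.
have dee : D * E * E = - D by rewrite -mulrA EE mulrN1.
have ede : E * (D * E) = t *: E + D by rewrite mulrA DE mulrBl -scalerAl mul1r dee opprK.
have dde : D * (D * E) = - E by rewrite mulrA DD mulN1r.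
have ded : D * E * D = t *: D + E.
  by rewrite -mulrA DE mulrBr -scalerAr mulr1 dde opprK.
rewrite -scalerAr -scalerAl -scalerBr mulrDr mulrDl -scalerAr -scalerAl opprD addrACA.
rewrite dee ede ded dde /y; apply: mx2P; rewrite !mx2E; field; exact: n.
Qed.

Lemma tr_commutator X Y : \tr (X * Y - Y * X) = 0.
Proof. by rewrite trD2 tr_opp2 (tr2C Y) subrr. Qed.

Lemma tr_mul_commutator X Y : \tr (X * (X * Y - Y * X)) = 0.
Proof. by rewrite mulrBr trD2 tr_opp2 (mulrA X Y X) (tr2C (X * Y) X) subrr. Qed.

End HalfturnAlgebra.

(** * Approximation *)

Section Limits.
Local Open Scope classical_set_scope.
Variable R : realType.
Implicit Types (u v : nat -> R) (x y : R) (M N : nat -> 'M[R]_2) (L P : 'M[R]_2).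

Definition tends u x := u @ \oo --> x.

Lemma tends_ext u v x : (forall n, u n = v n) -> tends u x -> tends v x.
Proof. by move=> /funext ->. Qed.

Lemma tends_cst x : tends (fun=> x) x. Proof. exact: cvg_cst. Qed.
Lemma tendsD u v x y : tends u x -> tends v y -> tends (fun n => u n + v n) (x + y).
Proof. exact: cvgD. Qed.
Lemma tendsN u x : tends u x -> tends (fun n => - u n) (- x).
Proof. exact: cvgN. Qed.
Lemma tendsM u v x y : tends u x -> tends v y -> tends (fun n => u n * v n) (x * y).
Proof. exact: cvgM. Qed.
Lemma tendsB u v x y : tends u x -> tends v y -> tends (fun n => u n - v n) (x - y).
Proof. exact: cvgB. Qed.
Lemma tendsV u x : x != 0 -> tends u x -> tends (fun n => (u n)^-1) x^-1.
Proof. exact: cvgV. Qed.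
Lemma tends_sqrt u x : tends u x -> tends (fun n => Num.sqrt (u n)) (Num.sqrt x).
Proof. by move=> h; apply: continuous_cvg h; exact: sqrt_continuous. Qed.

Lemma tends_rat x : exists q : nat -> rat, tends (fun n => ratr (q n)) x.
Proof.
have ex n : exists q : rat, x < ratr q < x + n.+1%:R^-1.
  have [|q] := @rat_in_itvoo R x (x + n.+1%:R^-1); first by rewrite ltrDl invr_gt0 ltr0n.
  by rewrite in_itv; exists q.
have [q hq] := choice ex; exists q.
apply: (@squeeze_cvgr _ _ _ _ (fun=> x) (fun n => x + n.+1%:R^-1)).
- by near=> n; have /andP[h1 h2] := hq n; rewrite !ltW.
- exact: cvg_cst.
- rewrite -[X in _ --> X]addr0; apply: cvgD; [exact: cvg_cst | exact: cvg_harmonic].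
Unshelve. all: by end_near. Qed.

Definition mtends M L := forall i j, tends (fun n => M n i j) (L i j).

Lemma mtends_cst L : mtends (fun=> L) L. Proof. by move=> i j; exact: tends_cst. Qed.

Lemma mtendsD M N L P : mtends M L -> mtends N P -> mtends (fun n => M n + N n) (L + P).
Proof.
move=> hM hN i j; rewrite add2E; apply: tends_ext (tendsD (hM i j) (hN i j)).
by move=> n; rewrite add2E.
Qed.

Lemma mtendsZ u x M L : tends u x -> mtends M L -> mtends (fun n => u n *: M n) (x *: L).
Proof.
move=> hu hM i j; rewrite scale2E; apply: tends_ext (tendsM hu (hM i j)).
by move=> n; rewrite scale2E.
Qed.

Lemma mtendsB M N L P : mtends M L -> mtends N P -> mtends (fun n => M n - N n) (L - P).
Proof.
move=> hM hN i j; rewrite add2E opp2E; apply: tends_ext (tendsB (hM i j) (hN i j)).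
by move=> n; rewrite add2E opp2E.
Qed.

Lemma mtendsM M N L P : mtends M L -> mtends N P -> mtends (fun n => M n * N n) (L * P).
Proof.
move=> hM hN i j; rewrite mul2E.
apply: tends_ext (tendsD (tendsM (hM i 0) (hN 0 j)) (tendsM (hM i 1) (hN 1 j))).
by move=> n; rewrite mul2E.
Qed.

Lemma mtends_tr M L : mtends M L -> tends (fun n => \tr (M n)) (\tr L).
Proof.
move=> hM; rewrite tr2E; apply: tends_ext (tendsD (hM 0 0) (hM 1 1)).
by move=> n; rewrite tr2E.
Qed.

Lemma mtends_det M L : mtends M L -> tends (fun n => \det (M n)) (\det L).
Proof.
move=> hM; rewrite det2E.
apply: tends_ext (tendsB (tendsM (hM 0 0) (hM 1 1)) (tendsM (hM 0 1) (hM 1 0))).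
by move=> n; rewrite det2E.
Qed.

Lemma mtends_adj M L : mtends M L -> mtends (fun n => adj2 (M n)) (adj2 L).
Proof.
move=> hM; have hs : mtends (fun n => (\tr (M n))%:M) (\tr L)%:M.
  have h := mtendsZ (mtends_tr hM) (@mtends_cst 1).
  move=> i j; rewrite scalar2Z; apply: (tends_ext _ (h i j)).
  by move=> n; rewrite -scalar2Z.
exact: mtendsB.
Qed.

Lemma mtends_ev (M : nat -> nat -> 'M[R]_2) (L : nat -> 'M[R]_2) w :
  (forall i, i \in w -> mtends (M i) (L i)) ->
  mtends (fun n => ev (fun i => M i n) w) (ev L w).
Proof.
elim: w => [|i w IH] h.
  rewrite ev_nil => a b; apply: (tends_ext _ (@mtends_cst 1 a b)) => n; by rewrite ev_nil.
have hw : mtends (fun n => ev (fun i => M i n) w) (ev L w).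
  by apply: IH => j jw; apply: h; rewrite inE jw orbT.
have hh := mtendsM (h i (mem_head _ _)) hw.
rewrite ev_cons => a b; apply: (tends_ext _ (hh a b)).
by move=> n; rewrite ev_cons.
Qed.

Lemma near_below (P : nat -> nat -> Prop) k :
  (forall i, (i < k)%N -> \forall n \near \oo, P i n) ->
  \forall n \near \oo, forall i, (i < k)%N -> P i n.
Proof.
elim: k => [|k IH] h; first by near=> n.
have hk := h k (ltnSn k); have {}IH := IH (fun i lt_i => h i (ltnW lt_i)).
near=> n => i; rewrite ltnS leq_eqVlt => /predU1P[->|lt_i]; first by near: n.
by move: i lt_i; near: n.
Unshelve. all: by end_near. Qed.

Lemma near_close (M : nat -> 'M[R]_2) L e : 0 < e -> mtends M L ->
  \forall n \near \oo, close e (M n) L.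
Proof.
move=> e0 hM; have one i j : \forall n \near \oo, `|M n i j - L i j| <= e.
  by apply: cvgr_distC_le => //; exact: hM.
near=> n; do 2!apply: forall_ord2; near: n; exact: one.
Unshelve. all: by end_near. Qed.

Lemma near_neq0 u x : tends u x -> x != 0 -> \forall n \near \oo, u n != 0.
Proof. by move=> h x0; exact: cvgr_neq0 h x0. Qed.

Lemma near_gt0 u x : tends u x -> 0 < x -> \forall n \near \oo, 0 < u n.
Proof. by move=> h x0; exact: cvgr_gt h _ x0. Qed.

End Limits.

(** * Density of the algebra in M_2(R) *)

Section Dense.
Variables (R : realType) (K : R -> Prop) (a b : R) (I J : 'M[R]_2).
Hypotheses (hK : is_subfield K) (hIJ : quat_pair a b I J).
Local Notation A := (inA I J K).

Lemma inA_dense (L : 'M[R]_2) : exists2 u : nat -> 'M[R]_2,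
  forall n, A (u n) & mtends u L.
Proof.
rewrite (quat_decomp hIJ L); set c0 := _ / 2; set c1 := _ / (2 * a).
set c2 := _ / (2 * b); set c3 := _ / (2 * (a * b)).
have [q0 h0] := tends_rat c0; have [q1 h1] := tends_rat c1.
have [q2 h2] := tends_rat c2; have [q3 h3] := tends_rat c3.
exists (fun n => quat I J (ratr (q0 n)) (ratr (q1 n)) (ratr (q2 n)) (ratr (q3 n))).
  move=> n; exists (ratr (q0 n)), (ratr (q1 n)), (ratr (q2 n)), (ratr (q3 n)).
  by split=> //; exact: sub_rat.
have cst := @mtends_cst R.
exact: mtendsD (mtendsD (mtendsD (mtendsZ h0 (cst 1)) (mtendsZ h1 (cst I)))
  (mtendsZ h2 (cst J))) (mtendsZ h3 (cst (I * J))).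
Qed.

Lemma inA_pure_dense (L : 'M[R]_2) : \tr L = 0 -> exists2 u : nat -> 'M[R]_2,
  forall n, A (u n) /\ \tr (u n) = 0 & mtends u L.
Proof.
move=> tL; have [u hu lu] := inA_dense L.
exists (fun n => u n - (\tr (u n) / 2) *: 1).
  move=> n; split.
    apply: (inA_sub hK); first exact: hu.
    apply: (inA_scale hK); last exact: inA1.
    by apply: (sub_div hK); [exact: (inA_tr hIJ hK) | exact: (sub_nat hK 2)].
  by rewrite trD2 tr_opp2 trZ2 tr1_2; field.
have -> : L = L - (\tr L / 2) *: 1 by rewrite tL mul0r scale0r subr0.
apply: mtendsB => //; apply: mtendsZ (@mtends_cst _ _).
exact: tendsM (mtends_tr lu) (@tends_cst _ _).
Qed.

End Dense.

(** * Closing up a family of half-turns *)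

Section CloseUp.
Variable R : realType.
Implicit Types (Z : nat -> 'M[R]_2).

Definition unimod (X : 'M[R]_2) := (Num.sqrt (\det X))^-1 *: X.

Lemma unimod_det X : 0 < \det X -> \det (unimod X) = 1.
Proof.
move=> d0; rewrite det2_scale exprVn sqr_sqrtr ?ltW // mulVf ?gt_eqF //.
Qed.

Lemma unimod_tr X : \tr X = 0 -> \tr (unimod X) = 0.
Proof. by move=> t0; rewrite trZ2 t0 mulr0. Qed.

Lemma ev_unimod Z w : exists r, ev (fun i => unimod (Z i)) w = r *: ev Z w.
Proof.
elim: w => [|i w [r IH]]; first by exists 1; rewrite !ev_nil scale1r.
exists ((Num.sqrt (\det (Z i)))^-1 * r).
by rewrite !ev_cons IH /unimod -scalerAl -scalerAr scalerA.
Qed.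

(* The last half-turn is determined by the relation. *)
Definition close_up (n : nat) Z (k : nat) : 'M[R]_2 :=
  let i := (k %% n.+2)%N in
  if i == n.+1 then adj2 (ev (fun i => unimod (Z i)) (iota 0 n.+1)) else unimod (Z i).

Lemma close_up_small n Z i : (i <= n)%N -> close_up n Z i = unimod (Z i).
Proof.
move=> le_i; rewrite /close_up modn_small; last exact: leq_trans le_i _.
by rewrite ltn_eqF.
Qed.

(** The last free element is a commutator with the product of its predecessors, so multiplying it by
    that product gives trace 0; the inverse of the whole product is therefore again a half-turn. *)
Lemma close_up_halfturns n Z Y : (2 <= n)%N ->
  (forall i, (i <= n)%N -> 0 < \det (Z i)) -> (forall i, (i <= n)%N -> \tr (Z i) = 0) ->
  Z n = ev Z (iota 0 n) * Y - Y * ev Z (iota 0 n) ->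
  halfturns (close_up n Z) n.+2.
Proof.
move=> n2 dZ tZ eZ; set E := ev (fun i => unimod (Z i)) (iota 0 n.+1).
have dE : \det E = 1.
  have : forall w, all (fun i => i <= n)%N w -> \det (ev (fun i => unimod (Z i)) w) = 1.
    elim=> [|i w IH] /=; first by rewrite ev_nil det1.
    by move=> /andP[le_i /IH h]; rewrite ev_cons det2M unimod_det ?dZ // h mulr1.
  by apply; apply/allP => i; rewrite mem_iota.
have tE : \tr E = 0.
  have [r er] := ev_unimod Z (iota 0 n).
  rewrite /E -[n.+1]addn1 iotaD ev_cat er ev_seq1 add0n /unimod -scalerAl -scalerAr.
  by rewrite !trZ2 {2}eZ tr_mul_commutator !mulr0.
have below k : (k %% n.+2 == n.+1)%N = false -> (k %% n.+2 <= n)%N.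
  move=> ne; have := ltn_pmod k (isT : (0 < n.+2)%N).
  by rewrite ltnS leq_eqVlt ne.
split.
- by [].
- move=> k; rewrite /close_up; case: ifP => [_|/below le_k].
    by rewrite -dE adj2E !mx2E -/E; ring.
  by rewrite unimod_det // dZ.
- move=> k; rewrite /close_up; case: ifP => [_|/below le_k].
    by rewrite -tE adj2E !mx2E -/E; ring.
  by rewrite unimod_tr // tZ.
- by move=> k; rewrite /close_up modnDr.
- rewrite -[n.+2]addn1 iotaD ev_cat add0n ev_seq1.
  have -> : ev (close_up n Z) (iota 0 n.+1) = E.
    rewrite /E /ev; apply: eq_big_seq => i; rewrite mem_iota => /andP[_ lt_i].
    exact: close_up_small.
  by rewrite /close_up modn_small ?eqxx // -/E mul_adj2 dE.
Qed.

End CloseUp.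

(** * Approximating the regular half-turns inside the algebra *)

Section Approximation.
Local Open Scope classical_set_scope.
Local Open Scope ring_scope.
Variables (R : realType) (g : nat).
Hypothesis g2 : (2 <= g)%N.
Variables (K : R -> Prop) (a b : R) (I J : 'M[R]_2).
Hypotheses (hK : is_subfield K) (Ka : K a) (Kb : K b) (hIJ : quat_pair a b I J).
Local Notation A := (inA I J K).
Variable th : R.
Hypotheses (Kth : K th) (th0 : th != 0).
Local Notation N := (g.*2).
Local Notation m := (N.+2).
Local Notation reg := (@reg R m).

Let N_ge4 : (4 <= N)%N. Proof. by move: g2; lia. Qed.
Let m_ge6 : (6 <= m)%N. Proof. by rewrite !ltnS. Qed.

Let rdet k : \det (reg k) = 1. Proof. exact: reg_det. Qed.
Let rtr k : \tr (reg k) = 0. Proof. exact: reg_tr. Qed.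

(* The scalars of a rotated multiple [(cx + cy X) p] of [p], where [d = det X]:
   the rotation is conjugation by [x + y X], and the square of the result is
   [(w th)^2 p^2]. *)
Definition rot_den (x y d : R) := x ^+ 2 + y ^+ 2 * d.
Definition rot_x (v x y d : R) := v / rot_den x y d * (x ^+ 2 - y ^+ 2 * d).
Definition rot_y (v x y d : R) := v / rot_den x y d * (2 * x * y).

Lemma rot_sqr v x y d (X p : 'M[R]_2) s : rot_y v x y d != 0 -> \det X = d -> \tr X = 0 ->
  X * p = - (p * X) -> p * p = s%:M ->
  let p2 := rot_x v x y d *: p + rot_y v x y d *: (X * p) in p2 * p2 = (v ^+ 2 * s)%:M.
Proof.
move=> ry dX tX Xp pp.
(* The inverse of 0 is 0, so a nonzero [rot_y] forces a nonzero denominator. *)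
have D0 : rot_den x y d != 0.
  by apply: contraNneq ry => D0; rewrite /rot_y D0 invr0 mulr0 mul0r.
set cx := rot_x v x y d; set cy := rot_y v x y d => /=.
have pX : p * X = - (X * p) by rewrite Xp opprK.
have XX : X * X = (- d) *: 1 by rewrite pure_sqr // dX.
have pXp : p * (X * p) = - (s *: X).
  by rewrite mulrA pX mulNr -mulrA pp scalar2Z -scalerAr mulr1.
have Xpp : X * p * p = s *: X by rewrite -mulrA pp scalar2Z -scalerAr mulr1.
have XpXp : X * p * (X * p) = (d * s) *: 1.
  by rewrite -mulrA pXp mulrN -scalerAr XX scalerA -scaleNr; congr (_ *: _); ring.
have ev2 : v ^+ 2 * s = (cx ^+ 2 + cy ^+ 2 * d) * s.
  rewrite /cx /cy /rot_x /rot_y; congr (_ * _).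
  transitivity (v ^+ 2 / rot_den x y d ^+ 2 * rot_den x y d ^+ 2).
    by rewrite divfK // expf_neq0.
  rewrite {2}/rot_den; field; exact: D0.
set e := v ^+ 2 * s in ev2 *.
rewrite mulrDl !mulrDr -!scalerAl -!scalerAr pp pXp Xpp XpXp !scalar2Z ev2.
by apply: mx2P; rewrite !mx2E; ring.
Qed.

(** Half-angle formula: for [la] the length of [(al, be)], the vector [(la + al, be)] points at half
    its angle, and a nonzero [be] keeps [la + al] positive. *)
Lemma rot_limit (al be : R) : be != 0 -> exists v x y : R,
  [/\ rot_den x y 1 != 0, rot_x v x y 1 = al & rot_y v x y 1 = be].
Proof.
move=> be0; pose la := Num.sqrt (al ^+ 2 + be ^+ 2).
have b2 : 0 < be ^+ 2 by rewrite exprn_even_gt0.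
have la2 : la ^+ 2 = al ^+ 2 + be ^+ 2.
  by rewrite sqr_sqrtr // addr_ge0 ?sqr_ge0.
have la0 : 0 < la by rewrite sqrtr_gt0; have := sqr_ge0 al; lra.
have x0 : 0 < la + al.
  rewrite ltNge; apply/negP => le0.
  have : la * la <= - al * la by rewrite ler_pM2r //; lra.
  have : - al * la <= - al * - al by rewrite ler_wpM2l //; lra.
  rewrite !mulrNN mulNr -!expr2 la2; lra.
have den : rot_den (la + al) be 1 = 2 * la * (la + al).
  by rewrite /rot_den mulr1 sqrrD; have := la2; lra.
have n1 : la != 0 by rewrite gt_eqF.
have n2 : la + al != 0 by rewrite gt_eqF.
exists la, (la + al), be; split.
- by rewrite den !mulf_neq0 ?pnatr_eq0.
- rewrite /rot_x den mulr1 (_ : _ - _ = 2 * al * (la + al)); last first.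
    by rewrite sqrrD; have := la2; lra.
  by field; rewrite n1 n2.
- by rewrite /rot_y den; field; rewrite n1 n2.
Qed.

Lemma conj_half (D p : 'M[R]_2) : D * D = -1 -> p * D = - (D * p) ->
  D * (1 + p) * D = - (1 - p).
Proof.
move=> DD pD; rewrite -(mulrA D) mulrDl mul1r pD mulrBr (mulrA D D p) DD mulN1r.
by rewrite opprD.
Qed.

(** Parallel [p1] and [p2] mean collinear centers; since [tr_reg012] excludes this, the component of
    [p2] across [p1] is nonzero. *)
Lemma tr_half3 (D E1 E2 p : 'M[R]_2) k1 k2 al s :
  D * D = -1 -> p * D = - (D * p) -> \tr D = 0 -> \tr (D * p) = 0 -> p * p = s%:M ->
  E1 = k1 *: (D * (1 + p)) -> E2 = k2 *: (D * (1 + al *: p)) -> \tr (D * E1 * E2) = 0.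
Proof.
move=> DD pD tD tDp pp -> ->; rewrite -!scalerAr -!scalerAl !trZ2 (mulrA D D) DD.
rewrite mulN1r mulNr tr_opp2.
have -> : (1 + p) * (D * (1 + al *: p)) = D * ((1 - p) * (1 + al *: p)).
  by rewrite !mulrA; congr (_ * _); rewrite mulrDl mulrBr mul1r mulr1 pD.
have -> : (1 - p) * (1 + al *: p) = (1 - al * s) *: 1 + (al - 1) *: p.
  rewrite mulrBl mul1r mulrDr mulr1 -scalerAr pp scalar2Z.
  by apply: mx2P; rewrite !mx2E; ring.
by rewrite mulrDr -!scalerAr mulr1 trD2 !trZ2 tD tDp !mulr0 addr0 oppr0 !mulr0 scaler0.
Qed.

(** Reduces the trace condition of [config] to the trace of two half-turns, which is at most -2. *)
Lemma tr_half2 (D E1 E2 p1 p2 : 'M[R]_2) k1 k2 :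
  D * D = -1 -> p1 * D = - (D * p1) -> \tr p1 = 0 -> \tr p2 = 0 ->
  E1 = k1 *: (D * (1 + p1)) -> E2 = k2 *: (D * (1 + p2)) ->
  \tr (E1 * E2) = - (k1 * k2) * \tr ((1 + p1) * (1 - p2)).
Proof.
move=> DD pD t1 t2 -> ->; rewrite -!scalerAr -!scalerAl !trZ2 (mulrA (_ * _) D).
rewrite conj_half // mulNr tr_opp2.
have -> : \tr ((1 - p1) * (1 + p2)) = \tr ((1 + p1) * (1 - p2)).
  rewrite mulrBl mul1r mulrDl mul1r !(mulrDr p1) mulr1 mulrN.
  by rewrite !(trD2, tr_opp2) t1 t2; ring.
ring.
Qed.

Theorem approx eta : 0 < eta -> exists C : nat -> 'M[R]_2,
  [/\ halfturns C m, forall k, close eta (C k) (reg k) & config g C K I J th].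
Proof.
move=> eta0.
have A1 : A 1 by exact: inA1.
have AM X Y : A X -> A Y -> A (X * Y) by exact: (inA_mul hIJ hK Ka Kb).
have AD X Y : A X -> A Y -> A (X + Y) by exact: (inA_add hK).
have AB X Y : A X -> A Y -> A (X - Y) by exact: (inA_sub hK).
have AZ z X : K z -> A X -> A (z *: X) by exact: (inA_scale hK).
have [X0 hX0 lX0] := inA_pure_dense hK hIJ (rtr 0).
have tr_le i j := tr_reg_le R m_ge6 i j.
have [k1 [p1 [s1 [k10 e1 [tp1 tDp1] [pp1 s10]]]]] :=
  halfturn_factor (rdet 0) (rtr 0) (rdet 1) (rtr 1) (tr_le 0 1).
have [k2 [p2 [s2 [k20 e2 [tp2 tDp2] [pp2 _]]]]] :=
  halfturn_factor (rdet 0) (rtr 0) (rdet 2) (rtr 2) (tr_le 0 2).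
have {}s10 := s10 (tr_reg_next R m_ge6 0).
have DD := sqr_pure (rdet 0) (rtr 0).
have anti1 := pure_anti (rtr 0) tp1 tDp1.
have pD : p1 * reg 0 = - (reg 0 * p1) by rewrite anti1 opprK.
have [al [be ep2]] : exists al be, p2 = al *: p1 + be *: (reg 0 * p1).
  have pr : quat_pair (-1) s1 (reg 0) p1.
    by split=> //; rewrite ?oppr_eq0 ?oner_eq0 // DD scalar2Z scaleN1r.
  exists (\tr (p1 * p2) / (2 * s1)), (- \tr (reg 0 * (p1 * p2)) / (2 * (-1 * s1))).
  by rewrite {1}(quat_decomp pr p2) /quat tp2 tDp2 !mul0r !scale0r !add0r.
have be0 : be != 0.
  apply/eqP => b0; have /eqP := tr_reg012 R m_ge6; apply.
  rewrite b0 scale0r addr0 in ep2; rewrite ep2 in e2.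
  exact: tr_half3 DD pD (rtr 0) tDp1 pp1 e1 e2.
have tr12 : \tr ((1 + p1) * (1 - p2)) != 0.
  have := tr_le 1%N 2%N; rewrite (tr_half2 DD pD tp1 tp2 e1 e2) => le.
  by apply/eqP => e; move: le; rewrite e mulr0; lra.
have [v [x [y [den0 evx evy]]]] := rot_limit al be0.
have [qv lv] := tends_rat (v / th); have [qx lx] := tends_rat x.
have [qy ly] := tends_rat y.
have [qk1 lk1] := tends_rat k1; have [qk2 lk2] := tends_rat k2.
pose d n := \det (X0 n).
have ld : tends d 1 by rewrite -(rdet 0); exact: mtends_det.
(* A commutator with [X0 n] is pure and anticommutes with [X0 n] exactly, not only in the limit; the
   given matrix is a preimage of [p1] under the commutator with [reg 0]. *)
have [Zs hZ lZ] := inA_dense hK hIJ ((- (1 / 2)) *: (reg 0 * p1)).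
pose P1 n := X0 n * Zs n - Zs n * X0 n.
have lP1 : mtends P1 p1.
  have -> : p1 = reg 0 * ((- (1 / 2)) *: (reg 0 * p1)) - (- (1 / 2)) *: (reg 0 * p1) * reg 0.
    rewrite -scalerAr -scalerAl -(mulrA (reg 0) p1) pD mulrN !(mulrA (reg 0) (reg 0)) DD.
    by apply: mx2P; rewrite !mx2E; field.
  by apply: mtendsB; apply: mtendsM.
(* The length [v] is approximated by rational multiples of [th], so that its square is a rational
   square times [th^2]. *)
pose vn n := ratr (qv n) * th : R.
have lvn : tends vn v.
  by rewrite -(divfK th0 v); apply: tendsM => //; exact: tends_cst.
have lden : tends (fun n => rot_den (ratr (qx n)) (ratr (qy n)) (d n)) (rot_den x y 1).
  by rewrite /rot_den !expr2; apply: tendsD; do ?[apply: tendsM => //].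
pose cx n := rot_x (vn n) (ratr (qx n)) (ratr (qy n)) (d n).
pose cy n := rot_y (vn n) (ratr (qx n)) (ratr (qy n)) (d n).
have lcx : tends cx al.
  rewrite -evx; apply: tendsM; first by apply: tendsM => //; exact: tendsV.
  by rewrite !expr2; apply: tendsB; do ?[apply: tendsM => //].
have lcy : tends cy be.
  rewrite -evy; apply: tendsM; first by apply: tendsM => //; exact: tendsV.
  by do ?[apply: tendsM => //]; exact: tends_cst.
pose P2 n := cx n *: P1 n + cy n *: (X0 n * P1 n).
have lP2 : mtends P2 p2.
  rewrite ep2; apply: mtendsD; apply: mtendsZ => //; exact: mtendsM.
have exG i : exists u : nat -> 'M[R]_2,
    (forall n, A (u n) /\ \tr (u n) = 0) /\ mtends u (reg i).
  by have [u hu lu] := inA_pure_dense hK hIJ (rtr i); exists u.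
have [G hG] := choice exG.
(* Past index 2 any pure approximations do; index [N] is replaced by a commutator in [Zt]. *)
pose Xs i n : 'M[R]_2 := match i with
  | 0 => X0 n
  | 1 => ratr (qk1 n) *: (X0 n * (1 + P1 n))
  | 2 => ratr (qk2 n) *: (X0 n * (1 + P2 n))
  | _ => G i n end.
have AX0 n : A (X0 n) by have [] := hX0 n.
have tX0 n : \tr (X0 n) = 0 by have [] := hX0 n.
have AP1 n : A (P1 n) by apply: AB; exact: AM.
have tP1 n : \tr (P1 n) = 0 by exact: tr_commutator.
have tXP1 n : \tr (X0 n * P1 n) = 0 by exact: tr_mul_commutator.
have XP1 n : X0 n * P1 n = - (P1 n * X0 n) by exact: pure_anti.
have XX n : X0 n * X0 n = (- d n) *: 1 by exact: pure_sqr.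
have Kd n : K (d n) by exact: (inA_det hIJ hK Ka Kb).
have Kq (q : rat) : K (ratr q) by exact: sub_rat.
have K2 := sub_nat hK 2.
have Kv n : K (vn n) by apply: (subM hK).
have Kden n : K (rot_den (ratr (qx n)) (ratr (qy n)) (d n)).
  apply: (subD hK); first exact: (subX hK).
  by apply: (subM hK) => //; exact: (subX hK).
have Kcx n : K (cx n).
  apply: (subM hK); first exact: (sub_div hK).
  apply: (subB hK); first exact: (subX hK).
  by apply: (subM hK) => //; exact: (subX hK).
have Kcy n : K (cy n).
  apply: (subM hK); first exact: (sub_div hK).
  by apply: (subM hK) => //; exact: (subM hK).
have AP2 n : A (P2 n) by apply: AD; apply: (AZ) => //; exact: AM.
have tXP2 n : \tr (X0 n * P2 n) = 0.
  rewrite mulrDr -!scalerAr mulrA XX -scalerAl mul1r trD2 !trZ2 tXP1 tP1.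
  by rewrite !mulr0 addr0.
have AXs i n : A (Xs i n).
  case: i => [|[|[|i]]] //=; last by have [/(_ n)[]] := hG i.+3.
    by apply: AZ => //; apply: AM => //; exact: AD.
  by apply: AZ => //; apply: AM => //; exact: AD.
have tXs i n : \tr (Xs i n) = 0.
  case: i => [|[|[|i]]] //=; last by have [/(_ n)[]] := hG i.+3.
    by rewrite trZ2 mulrDr mulr1 trD2 tX0 tXP1 addr0 mulr0.
  by rewrite trZ2 mulrDr mulr1 trD2 tX0 tXP2 addr0 mulr0.
have lXs i : mtends (Xs i) (reg i).
  case: i => [|[|[|i]]] //=; last by have [_] := hG i.+3.
    rewrite e1; apply: mtendsZ => //; apply: mtendsM => //.
    by apply: mtendsD => //; exact: mtends_cst.
  rewrite e2; apply: mtendsZ => //; apply: mtendsM => //.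
  by apply: mtendsD => //; exact: mtends_cst.
have lt_end : \tr (reg N.+1 * reg N) < - 2 by rewrite tr2C; exact: tr_reg_next.
have [Y hY] := halfturn_commutator (rdet N.+1) (rtr N.+1) (rdet N) (rtr N) lt_end.
(* The whole product is 1, so its first [N] factors multiply to the inverse of the last two; the
   signs of the two inverses cancel. *)
have regE : ev reg (iota 0 N) = reg N.+1 * reg N.
  have DDk k := sqr_pure (rdet k) (rtr k).
  apply: (mulIr (unit_det1 (rdet N))); apply: (mulIr (unit_det1 (rdet N.+1))).
  rewrite -(mulrA _ (reg N) (reg N)) DDk mulrN1 mulNr DDk opprK.
  rewrite -(ht_rel (reg_halfturns R m_ge6)) -!ev_rcons -!cats1 -catA.
  by rewrite -[m]addn2 iotaD.
have [Ys hYs lY] := inA_dense hK hIJ Y.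
pose P n := ev (fun i => Xs i n) (iota 0 N).
have lP : mtends P (reg N.+1 * reg N).
  by rewrite -regE; apply: mtends_ev => i _; exact: lXs.
have AP n : A (P n).
  by rewrite /P; elim: (iota 0 N) => [|i w IH]; rewrite ?ev_nil // ev_cons; exact: AM.
pose Zt i n := if i == N then P n * Ys n - Ys n * P n else Xs i n.
have AZt i n : A (Zt i n).
  by rewrite /Zt; case: eqP => // _; apply: AB; exact: AM.
have tZt i n : \tr (Zt i n) = 0.
  by rewrite /Zt; case: eqP => // _; exact: tr_commutator.
have lZt i : mtends (Zt i) (reg i).
  rewrite /Zt; case: eqP => [->|_]; last exact: lXs.
  by rewrite -hY; apply: mtendsB; apply: mtendsM.
have ldet i : tends (fun n => \det (Zt i n)) 1 by rewrite -(rdet i); exact: mtends_det.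
have lU i : mtends (fun n => unimod (Zt i n)) (reg i).
  rewrite -[reg i]scale1r -invr1 -sqrtr1; apply: mtendsZ => //.
  by apply: tendsV; [rewrite sqrtr1 oner_neq0 | exact: tends_sqrt].
have lE : mtends (fun n => adj2 (ev (fun i => unimod (Zt i n)) (iota 0 N.+1))) (reg N.+1).
  have -> : reg N.+1 = adj2 (ev reg (iota 0 N.+1)).
    rewrite -inv2_det1 ?(ev_det (reg_halfturns R m_ge6)) //.
    have u := ev_unit (reg_halfturns R m_ge6) (iota 0 N.+1).
    apply: (mulrI u); rewrite mulrV // -(ht_rel (reg_halfturns R m_ge6)) -ev_rcons.
    by rewrite -cats1 -[m]addn1 iotaD.
  by apply/mtends_adj/mtends_ev => i _; exact: lU.
have pos : \forall n \near \oo, forall i, (i < N.+1)%N -> 0 < \det (Zt i n).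
  by apply: near_below => i _; apply: near_gt0 (ldet i) _.
have cl : \forall n \near \oo, forall i, (i < N.+1)%N -> close eta (unimod (Zt i n)) (reg i).
  by apply: near_below => i _; exact: near_close (lU i).
have cle := near_close eta0 lE.
have s1E : s1 = - \det p1.
  have := pure_sqr tp1; rewrite pp1 => /(congr1 (fun M : 'M[R]_2 => M 0 0)).
  by rewrite !mx2E mulr1.
have ls : tends (fun n => - \det (P1 n)) s1 by rewrite s1E; apply/tendsN/mtends_det.
have ns := near_neq0 ls s10; have ny := near_neq0 lcy be0.
have lt12 : tends (fun n => \tr ((1 + P1 n) * (1 - P2 n))) (\tr ((1 + p1) * (1 - p2))).
  by apply: mtends_tr; apply: mtendsM; [apply: mtendsD | apply: mtendsB] => //;
    exact: mtends_cst.
have nt := near_neq0 lt12 tr12.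
have [n [[[pn cn] [en sn]] [yn tn]]] :=
  filter_ex (filterI (filterI (filterI pos cl) (filterI cle ns)) (filterI ny nt)).
exists (close_up N (fun i => Zt i n)); split.
- apply: (@close_up_halfturns _ _ _ (Ys n)) => //; first exact: leq_trans N_ge4.
  have -> : ev (fun i => Zt i n) (iota 0 N) = P n.
    rewrite /P /ev; apply: eq_big_seq => i; rewrite mem_iota => /andP[_ lt_i].
    by rewrite /Zt ltn_eqF.
  by rewrite /Zt eqxx.
- move=> k; rewrite -(C_mod (reg_halfturns R m_ge6) (modn_mod k m)) /close_up.
  have := ltn_pmod k (isT : (0 < m)%N); rewrite ltnS leq_eqVlt => /predU1P[->|lt_k].
    by rewrite eqxx; exact: en.
  by rewrite ltn_eqF //; exact: cn.
- split.
    move=> i le_i; rewrite close_up_small //.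
    by exists (Num.sqrt (\det (Zt i n)))^-1, (Zt i n).
  have w0 : qv n != 0.
    apply: contraNneq yn => w0.
    by rewrite /cy /rot_y /vn w0 rmorph0 !mul0r.
  have n0 : (0 == N)%N = false by rewrite ltn_eqF // (leq_trans _ N_ge4).
  have n1 : (1 == N)%N = false by rewrite ltn_eqF // (leq_trans _ N_ge4).
  have nn2 : (2 == N)%N = false by rewrite ltn_eqF // (leq_trans _ N_ge4).
  pose r i := (Num.sqrt (\det (Zt i n)))^-1.
  exists (r 0), (r 1 * ratr (qk1 n)), (r 2 * ratr (qk2 n)), (- \det (P1 n)), (cx n), (cy n).
  exists (qv n), (X0 n), (P1 n), (P2 n).
  have pp : P1 n * P1 n = (- \det (P1 n))%:M by rewrite pure_sqr // scalar2Z.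
  split=> //; last first.
  + split=> //; exact: rot_sqr.
  + rewrite !close_up_small ?(leq_trans _ N_ge4) // /unimod.
    rewrite -/(r 0) -/(r 1) -/(r 2) /r /Zt n0 n1 nn2 /= !scalerA //.
Qed.

End Approximation.

(** * Realising K and A on the surface of genus g *)

Unset Implicit Arguments.

Theorem theorem1p2 (R : realType) (g : nat) (K : R -> Prop) (a b : R) :
  (2 <= g)%N -> real_number_field K ->
  K a -> K b -> a != 0 -> b != 0 -> quat_splits_over_R a b ->
  exists ab : 'I_g -> 'M[R]_2 * 'M[R]_2,
    [/\ hyperbolic_structure ab,
        (forall x, K x <-> inv_trace_field ab x) &
        inv_quat_alg_iso ab K a b].
Proof.
move=> g2 hNF Ka Kb a0 b0 [I [J [II JJ IJ]]].
have hK : is_subfield K := hNF.1.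
have [th [Kth th0 th_gen]] := square_generator hNF.
have hIJ : quat_pair a b I J by [].
have m_ge6 : (6 <= g.*2.+2)%N by lia.
have [d [eta [eta0 stable]]] := regular_stable R m_ge6.
have [C [hC closeC cfC]] := approx g2 hK Ka Kb hIJ Kth th0 eta0.
have g_gt0 : (0 < g)%N := ltnW g2.
exists (gens C); split.
- exact: gens_hyperbolic hC (stable C closeC).
- exact: (config_invariants hC g_gt0 hK Ka Kb hIJ th_gen cfC).1.
- exact: (config_quat_iso hC g_gt0 hK Ka Kb hIJ th_gen cfC).
Qed.
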